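(* Let $\mathcal{A}$ be a unital $C^*$-algebra and let $\mathcal{S}_1$ and $\mathcal{S}_2$ be two faithful operator $\mathcal{A}$-systems. Then $$C^*_{u,\mathcal{A}}(\mathcal{S}_1\oplus_{\mathcal{A}}\mathcal{S}_2)\;\cong\;C^*_{u,\mathcal{A}}(\mathcal{S}_1)*_{\mathcal{A}}C^*_{u,\mathcal{A}}(\mathcal{S}_2)$$ as $C^*$-algebras, where the right-hand side is the $C^*$-algebra free product amalgamated over $\mathcal{A}$.
   Context: An operator system is a matrix ordered $*$-vector space with an Archimedean matrix order unit $e$. ''Ucp'' means unital completely positive. An operator system $\mathcal{S}$ is an operator $\mathcal{A}$-system if it is a (unital) $\mathcal{A}$-bimodule such that $(a\cdot s)^*=s^*\cdot a^*$, $a\cdot e=e\cdot a$, and $[a_{ij}]\cdot[s_{ij}]\cdot[a_{ij}]^*\in M_n(\mathcal{S})^+$ for all $a\in\mathcal{A}$, $s\in\mathcal{S}$, $[a_{ij}]\in M_{n,m}(\mathcal{A})$, $[s_{ij}]\in M_m(\mathcal{S})^+$. It is faithful if $a\cdot e\ne0$ for all $a\in\mathcal{A}\setminus\{0\}$. A linear map $\phi$ between operator $\mathcal{A}$-systems is an $\mathcal{A}$-bimodule map if $\phi(a_1\cdot s\cdot a_2)=a_1\cdot\phi(s)\cdot a_2$. Coproduct: for faithful operator $\mathcal{A}$-systems $\mathcal{S}_1,\mathcal{S}_2$, the coproduct $\mathcal{S}_1\oplus_{\mathcal{A}}\mathcal{S}_2$ is the unique faithful operator $\mathcal{A}$-system,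 together with unital complete order embeddings $\phi_i:\mathcal{S}_i\hookrightarrow\mathcal{S}_1\oplus_{\mathcal{A}}\mathcal{S}_2$ that are $\mathcal{A}$-bimodule maps, such that for every operator $\mathcal{A}$-system $\mathcal{R}$ and ucp $\mathcal{A}$-bimodule maps $\psi_i:\mathcal{S}_i\to\mathcal{R}$ ($i=1,2$) there is a unique ucp $\mathcal{A}$-bimodule map $\Psi$ on $\mathcal{S}_1\oplus_{\mathcal{A}}\mathcal{S}_2$ with $\Psi\circ\phi_i=\psi_i$. Universal $C^*$-algebra $C^*_{u,\mathcal{A}}(\mathcal{S})$ of an operator $\mathcal{A}$-system $\mathcal{S}$: let $\mathcal{F}(\mathcal{S})=\bigoplus_{n\ge1}\mathcal{S}\otimes_{\mathcal{A}}\cdots\otimes_{\mathcal{A}}\mathcal{S}$ ($n$ factors, algebraic bimodule tensor products over $\mathcal{A}$, algebraic direct sum), a $*$-algebra and $\mathcal{A}$-bimodule with product given by concatenation of tensors, $(s_1\otimes\cdots\otimes s_n)^*=s_n^*\otimes\cdots\otimes s_1^*$, and $\mathcal{A}$ acting on the outermost factors. Every ucp map $\phi:\mathcal{S}\to B(H)$ for which there is a unital $*$-homomorphism $\rho:\mathcal{A}\to B(H)$ with $\phi(a\cdot s)=\rho(a)\phi(s)$ induces a $*$-homomorphism $\pi_\phi:\mathcal{F}(\mathcal{S})\to B(H)$, $\pi_\phi(s_1\otimes\cdots\otimes s_n)=\phi(s_1)\cdots\phi(s_n)$. Put $\|u\|=\sup_\phi\|\pi_\phi(u)\|$ over all such $\phi$;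 $C^*_{u,\mathcal{A}}(\mathcal{S})$ is the completion of $\mathcal{F}(\mathcal{S})/\{u:\|u\|=0\}$. It has the universal property that every ucp $\mathcal{A}$-bimodule map from $\mathcal{S}$ into a unital $C^*$-algebra $\mathcal{B}$ (with $\mathcal{A}$ acting on $\mathcal{B}$ through a unital $*$-homomorphism $\mathcal{A}\to\mathcal{B}$) extends to an $\mathcal{A}$-bimodule $*$-homomorphism $C^*_{u,\mathcal{A}}(\mathcal{S})\to\mathcal{B}$. When $\mathcal{S}$ is faithful, $\mathcal{A}$ embeds unitally in $C^*_{u,\mathcal{A}}(\mathcal{S})$ via $a\mapsto a\cdot e$; the free product is amalgamated along these embeddings. *)

(* Defs.v *)
From HB Require Import structures.
From mathcomp Require Import all_boot all_order all_algebra.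
From mathcomp Require Import boolp classical_sets reals.
From mathcomp Require Import complex.

Set Implicit Arguments.
Unset Strict Implicit.
Unset Printing Implicit Defensive.

Import Order.TTheory GRing.Theory Num.Theory.

Local Open Scope classical_set_scope.
Local Open Scope complex_scope.
Local Open Scope ring_scope.

HB.mixin Record Lmodule_isStarSpace (R : realType) V
    of GRing.Lmodule R[i] V := {
  star : V -> V;
  starK : involutive star;
  starD : {morph star : x y / x + y};
  starZ : forall (c : R[i]) x, star (c *: x) = (Num.conj c) *: star x }.

#[short(type="starSpaceType")]
HB.structure Definition StarSpace (R : realType) :=
  {V of GRing.Lmodule R[i] V & Lmodule_isStarSpace R V}.

(* The norm is declared here rather than inherited from
   [completeNormedModType R[i]]: in the library's hierarchy the only types that
   carry both a norm and a ring structure are the number domains, so a normed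
   algebra cannot be declared on top of [normedModType]. *)
HB.mixin Record Lmodule_isBanach (R : realType) V of GRing.Lmodule R[i] V := {
  vnorm : V -> R;
  vnormD : forall x y, vnorm (x + y) <= vnorm x + vnorm y;
  vnormZ : forall (c : R[i]) x, (vnorm (c *: x))%:C = `|c| * (vnorm x)%:C;
  vnorm0_eq0 : forall x, vnorm x = 0 -> x = 0;
  vnorm_complete : forall u : nat -> V,
    (forall e : R, 0 < e -> exists N, forall m n, (N <= m)%N -> (N <= n)%N ->
       vnorm (u m - u n) < e) ->
    exists l, forall e : R, 0 < e -> exists N, forall n, (N <= n)%N ->
       vnorm (u n - l) < e }.

#[short(type="banachType")]
HB.structure Definition Banach (R : realType) :=
  {V of GRing.Lmodule R[i] V & Lmodule_isBanach R V}.

(* Unital C*-algebras; [algType] imposes 1 != 0. *)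
HB.mixin Record Algebra_isCStar (R : realType) A
    of GRing.Algebra R[i] A & StarSpace R A & Banach R A := {
  starM : forall x y : A, star (x * y) = star y * star x;
  vnormM : forall x y : A, vnorm (x * y) <= vnorm x * vnorm y;
  vnorm_starM : forall x : A, vnorm (star x * x) = vnorm x ^+ 2 }.

#[short(type="cstarType")]
HB.structure Definition CStar (R : realType) :=
  {A of GRing.Algebra R[i] A & StarSpace R A & Banach R A
   & Algebra_isCStar R A}.

HB.mixin Record Banach_isHilbert (R : realType) H of Banach R H := {
  dot : H -> H -> R[i];
  dot_scalar : forall y, scalar (dot^~ y);
  dot_conj : forall x y, dot y x = Num.conj (dot x y);
  dot_vnorm : forall x, dot x x = (vnorm x ^+ 2)%:C }.

#[short(type="hilbertType")]
HB.structure Definition Hilbert (R : realType) :=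
  {H of Banach R H & Banach_isHilbert R H}.

Definition unit_mx_of (R : realType) (V : lmodType R[i]) (e : V) (r : R) n
  : 'M[V]_n := \matrix_(i, j) (if i == j then r%:C *: e else 0).

HB.mixin Record StarSpace_isOpSystem (R : realType) S of StarSpace R S := {
  ounit : S;
  mpos : forall n, set 'M[S]_n;
  mpos_star : forall n (X : 'M[S]_n), mpos n X -> (map_mx star X)^T = X;
  mpos0 : forall n, mpos n 0;
  mposD : forall n (X Y : 'M[S]_n), mpos n X -> mpos n Y -> mpos n (X + Y);
  mposZ : forall n (r : R) (X : 'M[S]_n), 0 <= r ->
    mpos n X -> mpos n (map_mx ( *:%R r%:C) X);
  mpos_proper : forall n (X : 'M[S]_n), mpos n X -> mpos n (- X) -> X = 0;
  mpos_congr : forall m n (M : 'M[R[i]]_(m, n)) (X : 'M[S]_m), mpos m X ->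
    mpos n (\matrix_(i, j) \sum_k \sum_l
              (Num.conj (M k i) * M l j) *: X k l);
  ounit_star : star ounit = ounit;
  ounit_order : forall n (X : 'M[S]_n), (map_mx star X)^T = X ->
    exists2 r : R, 0 < r & mpos n (unit_mx_of ounit r n - X);
  ounit_archi : forall n (X : 'M[S]_n),
    (forall r : R, 0 < r -> mpos n (unit_mx_of ounit r n + X)) -> mpos n X }.

#[short(type="opSystemType")]
HB.structure Definition OpSystem (R : realType) :=
  {S of StarSpace R S & StarSpace_isOpSystem R S}.

HB.mixin Record OpSystem_isOpASystem (R : realType) (A : cstarType R) S
    of OpSystem R S := {
  lact : A -> S -> S;
  ract : S -> A -> S;
  lact_linear : forall a, linear (lact a);
  lact_linearl : forall s, linear (lact^~ s);
  ract_linear : forall s, linear (ract s);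
  ract_linearl : forall a, linear (ract^~ a);
  lact1 : forall s, lact 1 s = s;
  ract1 : forall s, ract s 1 = s;
  lactA : forall a b s, lact (a * b) s = lact a (lact b s);
  ractA : forall s a b, ract s (a * b) = ract (ract s a) b;
  lractA : forall a s b, ract (lact a s) b = lact a (ract s b);
  star_lact : forall a s, star (lact a s) = ract (star s) (star a);
  lact_ounit : forall a, lact a ounit = ract ounit a;
  mpos_act : forall n m (a : 'M[A]_(n, m)) (X : 'M[S]_m), mpos m X ->
    mpos n (\matrix_(i, j) \sum_k \sum_l
              ract (lact (a i k) (X k l)) (star (a j l))) }.

#[short(type="opASystemType")]
HB.structure Definition OpASystem (R : realType) (A : cstarType R) :=
  {S of OpSystem R S & OpSystem_isOpASystem R A S}.

(* The tensor *-algebra F(S): the direct sum over n >= 1 of the n-fold algebraic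
   tensor powers of S over A.  The word (s1, [:: s2; ...; sn]) stands for the
   simple tensor s1 (x) ... (x) sn, and a sequence of words for their formal
   sum.  F(S) is the quotient by multi-additivity and A-balancedness; together
   with unitality of the bimodule, balancedness over the scalars of A makes the
   tensors C-multilinear. *)
Section TensorAlgebra.
Context (R : realType) (A : cstarType R) (S : opASystemType A).

Definition word := (S * seq S)%type.

Definition wseq (w : word) : seq S := w.1 :: w.2.

Definition slot (l : seq S) (s : S) (r : seq S) : word :=
  if l is x :: l' then (x, l' ++ s :: r) else (s, r).

Lemma wseq_inj : injective wseq.
Proof. by case=> [s l] [t m] [-> ->]. Qed.

Lemma wseq_slot l s r : wseq (slot l s r) = l ++ s :: r.
Proof. by case: l. Qed.

Inductive tens_eq : seq word -> seq word -> Prop :=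
| tens_refl u : tens_eq u u
| tens_sym u v : tens_eq u v -> tens_eq v u
| tens_trans u v w : tens_eq u v -> tens_eq v w -> tens_eq u w
| tens_cat u u' v v' : tens_eq u u' -> tens_eq v v' ->
    tens_eq (u ++ v) (u' ++ v')
| tens_catC u v : tens_eq (u ++ v) (v ++ u)
| tens_add l s t r :
    tens_eq [:: slot l (s + t) r] [:: slot l s r; slot l t r]
| tens_zero l r : tens_eq [:: slot l 0 r] [::]
| tens_bal l s a t r :
    tens_eq [:: slot l (ract s a) (t :: r)] [:: slot l s (lact a t :: r)].

Definition tens_eqb (u v : seq word) : bool := `[< tens_eq u v >].

Lemma tens_eqb_refl : reflexive tens_eqb.
Proof. by move=> u; apply/asboolP; exact: tens_refl. Qed.

Lemma tens_eqb_sym : symmetric tens_eqb.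
Proof. by move=> u v; apply/asboolP/asboolP; exact: tens_sym. Qed.

Lemma tens_eqb_trans : transitive tens_eqb.
Proof.
move=> v u w /asboolP uv /asboolP vw.
by apply/asboolP; exact: tens_trans uv vw.
Qed.

Canonical tens_equiv :=
  EquivRel tens_eqb tens_eqb_refl tens_eqb_sym tens_eqb_trans.

Definition tensAlg := {eq_quot tens_equiv}%qT.

HB.instance Definition _ := Choice.on tensAlg.
HB.instance Definition _ := EqQuotient.on tensAlg.

Definition tpi (u : seq word) : tensAlg := (\pi u)%qT.

Lemma tpi_eq u v : tens_eq u v <-> tpi u = tpi v.
Proof.
split=> [uv | /eqmodP /asboolP //].
by apply/eqmodP/asboolP.
Qed.

Lemma tpiK (x : tensAlg) : tpi (repr x) = x.
Proof. exact: reprK. Qed.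

Lemma repr_tpi u : tens_eq (repr (tpi u)) u.
Proof. by apply/tpi_eq; rewrite tpiK. Qed.

Definition wscale (c : R[i]) (w : word) : word := (c *: w.1, w.2).

Definition wmul (w w' : word) : word := (w.1, w.2 ++ wseq w').

Definition wstar (w : word) : word :=
  if rev (map star (wseq w)) is s :: l then (s, l) else w.

Lemma wseq_mul w w' : wseq (wmul w w') = wseq w ++ wseq w'.
Proof. by []. Qed.

Lemma wseq_star w : wseq (wstar w) = rev (map star (wseq w)).
Proof.
rewrite /wstar; case E: (rev _) => [|s l] //.
by move/(congr1 size): E; rewrite size_rev.
Qed.

Lemma wmul_slotl l s r w : wmul (slot l s r) w = slot l s (r ++ wseq w).
Proof. by apply: wseq_inj; rewrite wseq_mul !wseq_slot -catA. Qed.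

Lemma wmul_slotr l s r w : wmul w (slot l s r) = slot (wseq w ++ l) s r.
Proof. by apply: wseq_inj; rewrite wseq_mul !wseq_slot catA. Qed.

Lemma wstar_slot l s r :
  wstar (slot l s r) = slot (rev (map star r)) (star s) (rev (map star l)).
Proof.
apply: wseq_inj; rewrite wseq_star !wseq_slot map_cat rev_cat /= rev_cons.
by rewrite cat_rcons.
Qed.

Definition fscale c (u : seq word) := map (wscale c) u.
Definition fmul (u v : seq word) := [seq wmul w w' | w <- u, w' <- v].
Definition fstar (u : seq word) := map wstar u.

Lemma star_ract (s : S) (a : A) : star (ract s a) = lact (star a) (star s).
Proof. by rewrite -[RHS]starK star_lact !starK. Qed.

Lemma fscaleP c u v : tens_eq u v -> tens_eq (fscale c u) (fscale c v).
Proof.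
elim=> {u v}.
- by move=> u; exact: tens_refl.
- by move=> u v _; exact: tens_sym.
- by move=> u v w _ + _; exact: tens_trans.
- by move=> u u' v v' _ ? _ ?; rewrite /fscale !map_cat; exact: tens_cat.
- by move=> u v; rewrite /fscale !map_cat; exact: tens_catC.
- case=> [|x l] s t r /=; rewrite /wscale /=.
    by rewrite scalerDr; exact: (tens_add [::]).
  exact: (tens_add (c *: x :: l)).
- case=> [|x l] r /=; rewrite /wscale /=.
    by rewrite scaler0; exact: (tens_zero [::]).
  exact: (tens_zero (c *: x :: l)).
- case=> [|x l] s a t r /=; rewrite /wscale /=.
    have -> : c *: ract s a = ract (c *: s) a.
      have := @ract_linearl _ _ S a c s 0.
      have := @ract_linearl _ _ S a (-1) 0 0.
      by rewrite scaler0 addr0 scaleN1r addNr => -> ; rewrite !addr0.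
    exact: (tens_bal [::]).
  exact: (tens_bal (c *: x :: l)).
Qed.

Lemma fstarP u v : tens_eq u v -> tens_eq (fstar u) (fstar v).
Proof.
elim=> {u v}.
- by move=> u; exact: tens_refl.
- by move=> u v _; exact: tens_sym.
- by move=> u v w _ + _; exact: tens_trans.
- by move=> u u' v v' _ ? _ ?; rewrite /fstar !map_cat; exact: tens_cat.
- by move=> u v; rewrite /fstar !map_cat; exact: tens_catC.
- by move=> l s t r; rewrite /= !wstar_slot starD; exact: tens_add.
- move=> l r; rewrite /= wstar_slot.
  have -> : star (0 : S) = 0.
    by apply: (addrI (star (0 : S))); rewrite -starD !addr0.
  exact: tens_zero.
- move=> l s a t r; rewrite /= !wstar_slot /= !rev_cons star_ract star_lact.
  have E (x y : S) m k : slot (rcons m x) y k = slot m x (y :: k).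
    by apply: wseq_inj; rewrite !wseq_slot cat_rcons.
  by rewrite !E; apply: tens_sym; exact: tens_bal.
Qed.

Lemma tens_pairs (T : Type) (f g h : T -> word) (v : seq T) :
  (forall x, tens_eq [:: f x] [:: g x; h x]) ->
  tens_eq (map f v) (map g v ++ map h v).
Proof.
move=> fgh; elim: v => [|x v IHv] /=; first exact: tens_refl.
apply: tens_trans (tens_cat (fgh x) IHv) _ => /=.
apply: (tens_cat (tens_refl [:: g x])).
rewrite -cat1s -[X in tens_eq _ X]/(map g v ++ ([:: h x] ++ map h v)) !catA.
by apply: tens_cat; [exact: tens_catC | exact: tens_refl].
Qed.

Lemma tens_map (T : Type) (f g : T -> word) (v : seq T) :
  (forall x, tens_eq [:: f x] [:: g x]) -> tens_eq (map f v) (map g v).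
Proof.
move=> fg; elim: v => [|x v IHv] /=; first exact: tens_refl.
exact: tens_cat (fg x) IHv.
Qed.

Lemma tens_map0 (T : Type) (f : T -> word) (v : seq T) :
  (forall x, tens_eq [:: f x] [::]) -> tens_eq (map f v) [::].
Proof.
move=> f0; elim: v => [|x v IHv] /=; first exact: tens_refl.
exact: tens_cat (f0 x) IHv.
Qed.

Lemma fmul1l w v : fmul [:: w] v = map (wmul w) v.
Proof. by rewrite /fmul /= cats0. Qed.

Lemma fmul_catl u u' v : fmul (u ++ u') v = fmul u v ++ fmul u' v.
Proof. by rewrite /fmul allpairs_cat. Qed.

Lemma fmulPl u u' v : tens_eq u u' -> tens_eq (fmul u v) (fmul u' v).
Proof.
elim=> {u u'}.
- by move=> u; exact: tens_refl.
- by move=> u u' _; exact: tens_sym.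
- by move=> u u' w _ + _; exact: tens_trans.
- by move=> u u' w w' _ ? _ ?; rewrite !fmul_catl; exact: tens_cat.
- by move=> u u'; rewrite !fmul_catl; exact: tens_catC.
- move=> l s t r.
  rewrite -(cat1s (slot l s r) [:: slot l t r]) fmul_catl !fmul1l.
  by apply: tens_pairs => x; rewrite !wmul_slotl; exact: tens_add.
- move=> l r; rewrite fmul1l.
  by apply: tens_map0 => x; rewrite wmul_slotl; exact: tens_zero.
- move=> l s a t r; rewrite !fmul1l.
  by apply: tens_map => x; rewrite !wmul_slotl; exact: tens_bal.
Qed.

Lemma wmulP w v v' : tens_eq v v' ->
  tens_eq (map (wmul w) v) (map (wmul w) v').
Proof.
elim=> {v v'}.
- by move=> u; exact: tens_refl.
- by move=> u u' _; exact: tens_sym.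
- by move=> u u' z _ + _; exact: tens_trans.
- by move=> u u' z z' _ ? _ ?; rewrite !map_cat; exact: tens_cat.
- by move=> u u'; rewrite !map_cat; exact: tens_catC.
- by move=> l s t r /=; rewrite !wmul_slotr; exact: tens_add.
- by move=> l r /=; rewrite wmul_slotr; exact: tens_zero.
- by move=> l s a t r /=; rewrite !wmul_slotr; exact: tens_bal.
Qed.

Lemma fmulPr u v v' : tens_eq v v' -> tens_eq (fmul u v) (fmul u v').
Proof.
move=> vv'; elim: u => [|w u IHu]; first exact: tens_refl.
by rewrite -cat1s !fmul_catl !fmul1l; apply: tens_cat IHu; exact: wmulP.
Qed.

Definition tadd (x y : tensAlg) := tpi (repr x ++ repr y).
Definition tscale c (x : tensAlg) := tpi (fscale c (repr x)).
Definition topp (x : tensAlg) := tscale (-1) x.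
Definition tmul (x y : tensAlg) := tpi (fmul (repr x) (repr y)).
Definition tstar (x : tensAlg) := tpi (fstar (repr x)).

(* s1 (x) ... (x) sn, for w = (s1, [:: s2; ...; sn]) *)
Definition tens (w : word) : tensAlg := tpi [:: w].

Lemma tadd_tpi u v : tadd (tpi u) (tpi v) = tpi (u ++ v).
Proof. by apply/tpi_eq/tens_cat; exact: repr_tpi. Qed.

Lemma tscale_tpi c u : tscale c (tpi u) = tpi (fscale c u).
Proof. by apply/tpi_eq/fscaleP; exact: repr_tpi. Qed.

Lemma tmul_tpi u v : tmul (tpi u) (tpi v) = tpi (fmul u v).
Proof.
apply/tpi_eq; apply: tens_trans (fmulPl _ (repr_tpi u)) _.
by apply: fmulPr; exact: repr_tpi.
Qed.

Lemma tstar_tpi u : tstar (tpi u) = tpi (fstar u).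
Proof. by apply/tpi_eq/fstarP; exact: repr_tpi. Qed.

Lemma taddA : associative tadd.
Proof.
by move=> x y z; rewrite -(tpiK x) -(tpiK y) -(tpiK z) !tadd_tpi catA.
Qed.

Lemma taddC : commutative tadd.
Proof.
move=> x y; rewrite -(tpiK x) -(tpiK y) !tadd_tpi.
by apply/tpi_eq; exact: tens_catC.
Qed.

Lemma tadd0 : left_id (tpi [::]) tadd.
Proof. by move=> x; rewrite -(tpiK x) tadd_tpi. Qed.

Lemma tscaleDl c d x : tscale (c + d) x = tadd (tscale c x) (tscale d x).
Proof.
rewrite -(tpiK x) !tscale_tpi tadd_tpi; apply/tpi_eq.
apply: tens_pairs => -[s r]; rewrite /wscale /= scalerDl.
exact: (tens_add [::]).
Qed.

Lemma tscale1 x : tscale 1 x = x.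
Proof.
rewrite -[RHS]tpiK -{1}(tpiK x) tscale_tpi; congr tpi.
by rewrite /fscale -[RHS]map_id; apply: eq_map => -[s r]; rewrite /wscale scale1r.
Qed.

Lemma tscaleA c d x : tscale c (tscale d x) = tscale (c * d) x.
Proof.
rewrite -(tpiK x) !tscale_tpi; congr tpi.
rewrite /fscale -map_comp; apply: eq_map => -[s r].
by rewrite /wscale /= scalerA.
Qed.

Lemma tscaleDr c x y : tscale c (tadd x y) = tadd (tscale c x) (tscale c y).
Proof.
by rewrite -(tpiK x) -(tpiK y) !(tscale_tpi, tadd_tpi) /fscale map_cat.
Qed.

Lemma taddN : left_inverse (tpi [::]) topp tadd.
Proof.
move=> x; rewrite -{2}(tscale1 x) -tscaleDl addNr -(tpiK x) tscale_tpi.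
apply/tpi_eq; apply: tens_map0 => -[s r]; rewrite /wscale scale0r.
exact: (tens_zero [::]).
Qed.

HB.instance Definition _ :=
  GRing.isZmodule.Build tensAlg taddA taddC tadd0 taddN.

HB.instance Definition _ :=
  GRing.Zmodule_isLmodule.Build R[i] tensAlg tscaleA tscale1
    (fun c x y => tscaleDr c x y) (fun x c d => tscaleDl c d x).

Lemma lact_scalar c (s : S) : lact (c%:A : A) s = c *: s.
Proof.
have lact0 : lact (0 : A) s = 0.
  have := @lact_linearl _ _ S s (-1) 0 0.
  by rewrite scaler0 addr0 scaleN1r addNr.
by have := @lact_linearl _ _ S s c 1 0; rewrite lact0 !addr0 lact1.
Qed.

Lemma ract_scalar c (s : S) : ract s (c%:A : A) = c *: s.
Proof.
have ract0 : ract s (0 : A) = 0.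
  have := @ract_linear _ _ S s (-1) 0 0.
  by rewrite scaler0 addr0 scaleN1r addNr.
by have := @ract_linear _ _ S s c 1 0; rewrite ract0 !addr0 ract1.
Qed.

Lemma tens_scale l c s r :
  tens_eq [:: slot l (c *: s) r] [:: wscale c (slot l s r)].
Proof.
elim/last_ind: l s r => [|l x IHl] s r; first exact: tens_refl.
have E y z k : slot (rcons l y) z k = slot l y (z :: k).
  by apply: wseq_inj; rewrite !wseq_slot cat_rcons.
rewrite !E -lact_scalar.
apply: tens_trans (tens_sym (tens_bal _ _ _ _ _)) _.
by rewrite ract_scalar; exact: IHl.
Qed.

Lemma tstarK : involutive tstar.
Proof.
move=> x; rewrite -(tpiK x) !tstar_tpi; congr tpi.
rewrite /fstar -map_comp -[RHS]map_id; apply: eq_map => w.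
apply: wseq_inj; rewrite /= !wseq_star map_rev revK -map_comp.
by rewrite -[RHS]map_id; apply: eq_map => s /=; rewrite starK.
Qed.

Lemma tstarD : {morph tstar : x y / x + y}.
Proof.
move=> x y; rewrite -(tpiK x) -(tpiK y).
rewrite -[_ + _]/(tadd _ _) -[X in _ = X]/(tadd _ _).
by rewrite !(tstar_tpi, tadd_tpi) /fstar map_cat.
Qed.

Lemma tstarZ c x : tstar (c *: x) = Num.conj c *: tstar x.
Proof.
rewrite -(tpiK x) -[_ *: _]/(tscale _ _) -[X in _ = X]/(tscale _ _).
rewrite !(tstar_tpi, tscale_tpi); apply/tpi_eq.
rewrite /fstar /fscale -!map_comp; apply: tens_map => -[s r].
rewrite -[(_ \o _) _]/(wstar (slot [::] (c *: s) r)) wstar_slot starZ.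
rewrite -[X in tens_eq _ [:: X]]/(wscale (Num.conj c) (wstar (slot [::] s r))).
by rewrite wstar_slot; exact: tens_scale.
Qed.

HB.instance Definition _ :=
  Lmodule_isStarSpace.Build R tensAlg tstarK tstarD tstarZ.

End TensorAlgebra.

(* [sup] is 0 on unbounded sets; the operator norm is only used on bounded
   operators. *)
Definition opnorm (R : realType) (H : hilbertType R) (T : H -> H) : R :=
  sup [set vnorm (T x) | x in [set x | vnorm x <= 1]].

Record bounded_op (R : realType) (H : hilbertType R) (T : H -> H) : Prop := {
  bop_linear : linear T;
  bop_bounded : exists M : R, forall x, vnorm (T x) <= M * vnorm x }.

Record unital_rep (R : realType) (A : cstarType R) (H : hilbertType R)
    (rho : A -> H -> H) : Prop := {
  rep_bop : forall a, bounded_op (rho a);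
  rep_linear : forall c a b x, rho (c *: a + b) x = c *: rho a x + rho b x;
  rep1 : forall x, rho 1 x = x;
  repM : forall a b x, rho (a * b) x = rho a (rho b x);
  rep_star : forall a x y, dot (rho a x) y = dot x (rho (star a) y) }.

(* Ucp maps S -> B(H); positivity in M_n(B(H)) = B(H^n). *)
Record ucp_BH (R : realType) (S : opSystemType R) (H : hilbertType R)
    (phi : S -> H -> H) : Prop := {
  ucpBH_bop : forall s, bounded_op (phi s);
  ucpBH_linear : forall c s t x, phi (c *: s + t) x = c *: phi s x + phi t x;
  ucpBH_unit : forall x, phi ounit x = x;
  ucpBH_pos : forall n (X : 'M[S]_n), mpos n X -> forall x : 'I_n -> H,
    0 <= \sum_i \sum_j dot (phi (X i j) (x j)) (x i) }.

Definition A_ucp_BH (R : realType) (A : cstarType R) (S : opASystemType A)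
    (H : hilbertType R) (phi : S -> H -> H) : Prop :=
  ucp_BH phi /\ exists2 rho : A -> H -> H, unital_rep rho &
    forall a s x, phi (lact a s) x = rho a (phi s x).

(* The extension of phi to F(S): on s1 (x) ... (x) sn it is the composite
   phi s1 \o ... \o phi sn.  It is computed on a representative; [pi_tpi] says
   that the choice does not matter. *)
Definition pi_words (R : realType) (A : cstarType R) (S : opASystemType A)
    (H : hilbertType R) (phi : S -> H -> H) (u : seq (word S)) (x : H) : H :=
  \sum_(w <- u) foldr phi x (wseq w).

Definition pi_ (R : realType) (A : cstarType R) (S : opASystemType A)
    (H : hilbertType R) (phi : S -> H -> H) (u : tensAlg S) : H -> H :=
  pi_words phi (repr u).

Section PiWellDefined.
Context (R : realType) (A : cstarType R) (S : opASystemType A).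
Context (H : hilbertType R) (phi : S -> H -> H).

Lemma dotDl (x y z : H) : dot (x + y) z = dot x z + dot y z.
Proof. by have := dot_scalar z 1 x y; rewrite scale1r mul1r. Qed.

Lemma dotZl c (x z : H) : dot (c *: x) z = c * dot x z.
Proof.
have dot0 : dot 0 z = 0.
  by apply: (addrI (dot 0 z)); rewrite -dotDl !addr0.
by have := dot_scalar z c x 0; rewrite dot0 !addr0.
Qed.

Lemma dotDr (x y z : H) : dot z (x + y) = dot z x + dot z y.
Proof. by rewrite !(dot_conj _ z) dotDl rmorphD. Qed.

Lemma dotZr c (x z : H) : dot z (c *: x) = Num.conj c * dot z x.
Proof. by rewrite !(dot_conj _ z) dotZl rmorphM. Qed.

Lemma dot_nondeg (x y : H) : (forall z, dot x z = dot y z) -> x = y.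
Proof.
move=> xy; apply/eqP; rewrite -subr_eq0; apply/eqP/vnorm0_eq0.
have : dot (x - y) (x - y) = 0.
  by rewrite -scaleN1r dotDl dotZl xy mulN1r addrN.
rewrite dot_vnorm => /(congr1 (@complex.Re R)) /= /eqP.
by rewrite sqrf_eq0 => /eqP.
Qed.

Context (phiP : A_ucp_BH phi).

Let phiD s t x : phi (s + t) x = phi s x + phi t x.
Proof. by have := ucpBH_linear phiP.1 1 s t x; rewrite !scale1r. Qed.

Let phi0 x : phi 0 x = 0.
Proof. by apply: (addrI (phi 0 x)); rewrite -phiD !addr0. Qed.

Let phiZ c s x : phi (c *: s) x = c *: phi s x.
Proof. by have := ucpBH_linear phiP.1 c s 0 x; rewrite phi0 !addr0. Qed.

Let phi_opD s x y : phi s (x + y) = phi s x + phi s y.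
Proof.
by have := bop_linear (ucpBH_bop phiP.1 s) 1 x y; rewrite !scale1r.
Qed.

Let phi_op0 s : phi s 0 = 0.
Proof. by apply: (addrI (phi s 0)); rewrite -phi_opD !addr0. Qed.

Let phi_opZ s c x : phi s (c *: x) = c *: phi s x.
Proof.
by have := bop_linear (ucpBH_bop phiP.1 s) c x 0; rewrite phi_op0 !addr0.
Qed.

Let phi_real s x : star s = s -> Num.conj (dot (phi s x) x) = dot (phi s x) x.
Proof.
move=> s_star.
have [|r r0] := @ounit_order _ S 1 (const_mx s).
  by apply/matrixP => i j; rewrite !mxE.
move=> /(ucpBH_pos phiP.1)/(_ (fun=> x)); rewrite !big_ord1 !mxE eqxx.
move=> /ger0_real/CrealP; rewrite phiD phiZ ucpBH_unit; last exact: phiP.1.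
rewrite -scaleN1r phiZ dotDl !dotZl.
rewrite rmorphD !rmorphM rmorphN rmorph1 /= -(dot_conj x x).
have -> : Num.conj (r%:C : R[i]) = r%:C.
  by apply/CrealP/ger0_real; rewrite lecR ltW.
by move/addrI; rewrite !mulN1r => /oppr_inj.
Qed.

Let phi_herm s x y : star s = s ->
  dot (phi s y) x = Num.conj (dot (phi s x) y).
Proof.
move=> s_star.
have := phi_real (x + y) s_star; have := phi_real (x + 'i%R *: y) s_star.
rewrite !(phi_opD, phi_opZ, dotDl, dotDr, dotZl, dotZr, rmorphD, rmorphM).
rewrite /= !conjCK !conjCi !(phi_real _ s_star).
move: (dot (phi s x) y) (dot (phi s y) x) => a b.
move: (dot (phi s x) x) (dot (phi s y) y) => p q.
rewrite -!addrA => /addrI; rewrite !addrA ![_ + _ * (_ * q)]addrC.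
rewrite ['i * (- 'i * q)]mulrA ['i * - 'i]mulrC -!mulrA -!addrA => /addrI E1.
move=> /addrI; rewrite !addrA => /addIr E2.
have {}E1 : b - a = Num.conj a - Num.conj b.
  apply: (mulfI (neq0Ci R[i])).
  by rewrite !mulrBr -[- (_ * a)]mulNr -E1 mulNr addrC.
have : b + b = Num.conj a + Num.conj a.
  have -> : b + b = (b + a) + (b - a) by rewrite addrACA subrr addr0.
  by rewrite -E2 E1 [X in X + _]addrC addrACA subrr addr0.
by rewrite -!mulr2n => /(pmulrnI (ltn0Sn 1)).
Qed.

Let phi_star s x y : dot (phi (star s) y) x = Num.conj (dot (phi s x) y).
Proof.
have E1 : star (s + star s) = s + star s by rewrite starD starK addrC.
have E2 : star ('i%R *: (s - star s)) = 'i%R *: (s - star s).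
  rewrite starZ conjCi -[X in star (_ + X)]scaleN1r starD starZ starK.
  by rewrite rmorphN rmorph1 !scaleN1r scaleNr -scalerN opprD opprK addrC.
have := phi_herm x y E1; have := phi_herm x y E2.
rewrite -scaleN1r !(phiD, phiZ) !(dotDl, dotZl) !(rmorphD, rmorphM) /=.
rewrite conjCi rmorphN rmorph1 !mulN1r mulNr -mulrN => /(mulfI (neq0Ci _)).
move: (dot (phi s y) x) (dot (phi (star s) y) x) => a b.
move: (Num.conj (dot (phi s x) y)) (Num.conj (dot (phi (star s) x) y)) => p q.
move=> E3 E4.
have : b + b = p + p.
  have -> : b + b = (a + b) - (a - b).
    by rewrite opprB [a + b]addrC addrACA subrr addr0.
  by rewrite E3 E4 opprK addrACA subrr addr0.
by rewrite -!mulr2n => /(pmulrnI (ltn0Sn 1)).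
Qed.

Let phi_bal s a t x : phi (ract s a) (phi t x) = phi s (phi (lact a t) x).
Proof.
have [rho rhoP rhoE] := phiP.2.
have phi_dot r y z : dot (phi r y) z = dot y (phi (star r) z).
  by rewrite (dot_conj _ y) phi_star conjCK.
rewrite rhoE; move: (phi t x) => {}x; apply: dot_nondeg => z.
by rewrite !phi_dot star_ract rhoE -(rep_star rhoP).
Qed.

Lemma pi_words_tens u v x : tens_eq u v -> pi_words phi u x = pi_words phi v x.
Proof.
rewrite /pi_words; elim=> {u v} //.
- by move=> u v w _ -> _ ->.
- by move=> u u' v v' _ E _ E'; rewrite !big_cat /= E E'.
- by move=> u v; rewrite !big_cat /= addrC.
- move=> l s t r; rewrite !big_cons !big_nil !addr0 !wseq_slot !foldr_cat /=.
  by rewrite phiD; elim: l => //= y l ->; exact: phi_opD.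
- move=> l r; rewrite !big_cons !big_nil addr0 wseq_slot foldr_cat /= phi0.
  by elim: l => //= y l ->.
- move=> l s a t r; rewrite !big_cons !big_nil !addr0 !wseq_slot !foldr_cat /=.
  by rewrite phi_bal.
Qed.

Lemma pi_tpi u : pi_ phi (tpi u) = pi_words phi u.
Proof. by apply: funext => x; apply: pi_words_tens; exact: repr_tpi. Qed.

End PiWellDefined.

(* The supremum is over a bounded set: a unital positive map phi satisfies
   ||phi s|| <= r for some r that depends on s only. *)
Definition tens_norm (R : realType) (A : cstarType R) (S : opASystemType A)
    (u : tensAlg S) : R :=
  sup [set r | exists (H : hilbertType R) (phi : S -> H -> H),
                 A_ucp_BH phi /\ r = opnorm (pi_ phi u)].

Record star_hom (R : realType) (A B : cstarType R) (f : A -> B) : Prop := {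
  shom_linear : linear f;
  shom1 : f 1 = 1;
  shomM : {morph f : x y / x * y};
  shom_star : {morph f : x / star x} }.

Definition cstar_isomorphic (R : realType) (A B : cstarType R) : Prop :=
  exists2 f : A -> B, star_hom f & bijective f.

(* U, together with the canonical map iota from F(S), is the completion of
   F(S) / {u | ||u|| = 0}. *)
Record is_universal_cstar (R : realType) (A : cstarType R)
    (S : opASystemType A) (U : cstarType R) (iota : tensAlg S -> U) : Prop := {
  ucstar_linear : linear iota;
  ucstarM : forall u v, iota (tmul u v) = iota u * iota v;
  ucstar_star : {morph iota : u / star u};
  ucstar_norm : forall u, vnorm (iota u) = tens_norm u;
  ucstar_dense : forall (x : U) (e : R), 0 < e ->
    exists u, vnorm (x - iota u) < e }.

Definition ucstar_incl (R : realType) (A : cstarType R) (S : opASystemType A)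
    (U : cstarType R) (iota : tensAlg S -> U) (a : A) : U :=
  iota (tens (lact a (ounit : S), [::])).

Definition faithful (R : realType) (A : cstarType R) (S : opASystemType A) :=
  forall a : A, a != 0 -> lact a (ounit : S) != 0.

Definition bimodule_map (R : realType) (A : cstarType R)
    (S T : opASystemType A) (f : S -> T) : Prop :=
  forall a s b, f (ract (lact a s) b) = ract (lact a (f s)) b.

Record ucp (R : realType) (S T : opSystemType R) (f : S -> T) : Prop := {
  ucp_linear : linear f;
  ucp_unit : f ounit = ounit;
  ucp_pos : forall n (X : 'M[S]_n), mpos n X -> mpos n (map_mx f X) }.

Record order_embedding (R : realType) (S T : opSystemType R) (f : S -> T)
    : Prop := {
  oemb_ucp : ucp f;
  oemb_inj : injective f;
  oemb_pos : forall n (X : 'M[S]_n), mpos n (map_mx f X) -> mpos n X }.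

Record is_coproduct (R : realType) (A : cstarType R)
    (S1 S2 S : opASystemType A) (phi1 : S1 -> S) (phi2 : S2 -> S) : Prop := {
  cop_faithful : faithful S;
  cop_emb1 : order_embedding phi1;
  cop_emb2 : order_embedding phi2;
  cop_bimod1 : bimodule_map phi1;
  cop_bimod2 : bimodule_map phi2;
  cop_universal : forall (T : opASystemType A) (psi1 : S1 -> T) (psi2 : S2 -> T),
    ucp psi1 -> bimodule_map psi1 -> ucp psi2 -> bimodule_map psi2 ->
    exists! Psi : S -> T, [/\ ucp Psi, bimodule_map Psi,
      Psi \o phi1 = psi1 & Psi \o phi2 = psi2] }.

(* P, together with j1 and j2, is the free product of U1 and U2 amalgamated over
   A along k1 and k2, i.e. their pushout among unital C*-algebras. *)
Record is_amalgamated_product (R : realType) (A U1 U2 P : cstarType R)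
    (k1 : A -> U1) (k2 : A -> U2) (j1 : U1 -> P) (j2 : U2 -> P) : Prop := {
  amal_hom1 : star_hom j1;
  amal_hom2 : star_hom j2;
  amal_comm : j1 \o k1 = j2 \o k2;
  amal_universal : forall (B : cstarType R) (f1 : U1 -> B) (f2 : U2 -> B),
    star_hom f1 -> star_hom f2 -> f1 \o k1 = f2 \o k2 ->
    exists! f : P -> B, [/\ star_hom f, f \o j1 = f1 & f \o j2 = f2] }.

(* Main.v *)
(** Both [U] and [P] are generated by copies of [S1] and [S2] glued along [A],
    so the two universal properties produce mutually inverse *-homomorphisms;
    for this a C*-algebra [B] with a unital *-homomorphism [A -> B] has to be
    an operator [A]-system, and [U] has to have its universal property with
    respect to an abstract [B].  The norm of [U] being a supremum over Hilbert
    space representations, the latter rests on the Gelfand-Naimark theorem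
    (positivity of [x^* x], Hahn-Banach, GNS).  A matrix [X] over [B] is called
    positive when every [sum b_i^* X_ij b_j] is positive in [B]; Cholesky
    factorization shows that *-homomorphisms and representations preserve this,
    and for the generators of [U] it is detected by the norm. *)

From HB Require Import structures.
Require Import Defs.
From mathcomp Require Import all_boot all_order all_algebra.
From mathcomp Require Import boolp classical_sets functions reals complex.
From mathcomp Require Import ring lra.

Set Implicit Arguments.
Unset Strict Implicit.
Unset Printing Implicit Defensive.

Import Order.TTheory GRing.Theory Num.Theory.
Local Open Scope classical_set_scope.
Local Open Scope complex_scope.
Local Open Scope ring_scope.

(** * Positivity in C*-algebras *)

(** The C*-axioms provide neither a spectrum nor a functional calculus. Positivity is therefore
    defined by the norm alone ([cpos]), and square roots commuting with everything that commutes
    with the given element stand in for functional calculus. The crux is [cpos_star_mul]: states,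
    the GNS representation and the contractivity of homomorphisms all depend on it. Matrix algebras
    over a C*-algebra receive no norm of their own. A homomorphism need not be onto, so the test
    vectors of its codomain are not images of test vectors; this is why factorizations are required,
    and they exist only for X + e with e > 0, whence the limits e -> 0. F(S) has no unit, and its
    norm is a supremum that defaults to 0 on an unbounded set. Hence bounds have to be uniform over
    all representations, and the unit law for the order unit holds only in the completion, where it
    is tested in representations. *)

Section Banach.
Context (R : realType) (V : banachType R).
Implicit Types (x y z : V) (u v : nat -> V) (r : R).

Lemma vnormZr r x : vnorm (r%:C *: x) = `|r| * vnorm x.
Proof.
apply: complexI; rewrite vnormZ rmorphM; congr (_ * _).
by rewrite normc_def /= expr0n addr0 sqrtr_sqr.
Qed.

Lemma vnorm0 : vnorm (0 : V) = 0.
Proof. by rewrite -(scale0r (0 : V)) vnormZr normr0 mul0r. Qed.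

Lemma vnormN x : vnorm (- x) = vnorm x.
Proof.
by rewrite -scaleN1r -(rmorphN1 (real_complex R)) vnormZr normrN1 mul1r.
Qed.

Lemma vnorm_ge0 x : 0 <= vnorm x.
Proof.
have := vnormD x (- x); rewrite subrr vnorm0 vnormN => h; lra.
Qed.

Lemma vdistC x y : vnorm (x - y) = vnorm (y - x).
Proof. by rewrite -vnormN opprB. Qed.

Lemma vdist_triangle z x y : vnorm (x - y) <= vnorm (x - z) + vnorm (z - y).
Proof. by apply: le_trans (vnormD _ _); rewrite addrA subrK. Qed.

Lemma vnorm_small x : (forall e, 0 < e -> vnorm x <= e) -> x = 0.
Proof.
move=> h; apply: vnorm0_eq0; apply/eqP; rewrite eq_le vnorm_ge0 andbT.
by apply/ler_addgt0Pr => e e0; rewrite add0r h.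
Qed.

Definition vlim u x :=
  forall e, 0 < e -> exists N, forall n, (N <= n)%N -> vnorm (u n - x) < e.

Lemma vlim_le u x y M : vlim u x ->
  (forall n, vnorm (u n - y) <= M) -> vnorm (x - y) <= M.
Proof.
move=> ux h; apply/ler_addgt0Pr => e e0.
have [N /(_ N (leqnn _)) hN] := ux e e0.
apply: le_trans (vdist_triangle (u N) _ _) _.
by rewrite vdistC addrC lerD ?h // ltW.
Qed.

Lemma vlim_unique u x y : vlim u x -> vlim u y -> x = y.
Proof.
move=> ux uy; apply/eqP; rewrite -subr_eq0; apply/eqP/vnorm_small => e e0.
have e20 : 0 < e / 2 by lra.
have [N hN] := ux _ e20; have [M hM] := uy _ e20.
apply: le_trans (vdist_triangle (u (maxn N M)) _ _) _.
have := hN _ (leq_maxl N M); have := hM _ (leq_maxr N M).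
by rewrite [vnorm (x - _)]vdistC => h1 h2; lra.
Qed.

Lemma vlim_eq u v x : u =1 v -> vlim u x -> vlim v x.
Proof. by move=> uv ux e /ux[N hN]; exists N => n /hN; rewrite uv. Qed.

Lemma vlim_cst x : vlim (fun=> x) x.
Proof. by move=> e e0; exists 0%N => n _; rewrite subrr vnorm0. Qed.

Lemma vlimD u v x y : vlim u x -> vlim v y -> vlim (fun n => u n + v n) (x + y).
Proof.
move=> ux vy e e0; have e20 : 0 < e / 2 by lra.
have [N hN] := ux _ e20; have [M hM] := vy _ e20.
exists (maxn N M) => n; rewrite geq_max => /andP[/hN h1 /hM h2].
rewrite opprD addrACA; apply: le_lt_trans (vnormD _ _) _; lra.
Qed.

Lemma vlim_sum (I : Type) (r : seq I) (F : I -> nat -> V) (G : I -> V) :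
  (forall i, vlim (F i) (G i)) ->
  vlim (fun n => \sum_(i <- r) F i n) (\sum_(i <- r) G i).
Proof.
move=> FG; elim: r => [|i r IH].
  by rewrite big_nil; apply: vlim_eq (vlim_cst 0) => n; rewrite big_nil.
by rewrite big_cons; apply: vlim_eq (vlimD (FG i) IH) => n; rewrite big_cons.
Qed.

(** Norms being nonnegative, [b] is nondecreasing, so from some rank on it is within [e] of its
    supremum, and the increments of [u] are small with it. This serves both the square-root
    iteration and the geometric series. *)
Lemma vlim_dominated u (b : nat -> R) M :
  (forall m n, (m <= n)%N -> vnorm (u n - u m) <= b n - b m) ->
  (forall n, b n <= M) -> exists x, vlim u x.
Proof.
move=> hu hb.
have b_mono m n : (m <= n)%N -> b m <= b n.
  by move=> /hu h; have := le_trans (vnorm_ge0 _) h; lra.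
have ub : has_ubound (range b) by exists M => _ [n _ <-].
have sb : has_sup (range b) by split=> //; exists (b 0%N), 0%N.
apply: vnorm_complete => e e0.
have [_ [N _ <-] hN] := sup_adherent e0 sb; exists N.
have key m n : (N <= m)%N -> (m <= n)%N -> vnorm (u n - u m) < e.
  move=> Nm mn; apply: le_lt_trans (hu _ _ mn) _.
  have : b n <= sup (range b) by apply: ub_le_sup => //; exists n.
  have := b_mono _ _ Nm; lra.
move=> m n Nm Nn; case: (leqP n m) => [nm|/ltnW mn]; first exact: key.
by rewrite vdistC; exact: key.
Qed.

End Banach.

Section StarSpaceTheory.
Context (R : realType) (V : starSpaceType R).

Lemma star0 : star (0 : V) = 0.
Proof. by apply: (addrI (star 0)); rewrite -starD !addr0. Qed.

Lemma starN (x : V) : star (- x) = - star x.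
Proof. by apply: (addIr (star x)); rewrite -starD !addNr star0. Qed.

Lemma starB (x y : V) : star (x - y) = star x - star y.
Proof. by rewrite starD starN. Qed.

Lemma starZr (r : R) (x : V) : star (r%:C *: x) = r%:C *: star x.
Proof. by rewrite starZ -[Num.conj _]/(r%:C^*)%C conjc_real. Qed.

Lemma star_sum (I : Type) (s : seq I) (P : pred I) (F : I -> V) :
  star (\sum_(i <- s | P i) F i) = \sum_(i <- s | P i) star (F i).
Proof. exact: (big_morph star (@starD _ _) star0). Qed.

End StarSpaceTheory.

(** * The C*-identity and square roots of 1 - a *)

Section Positive.
Context (R : realType) (B : cstarType R).
Implicit Types (x y z k l : B) (u v : nat -> B) (r t e : R).

Lemma star1 : star (1 : B) = 1.
Proof. by rewrite -[LHS]mulr1 -[X in _ * X]starK -starM mulr1 starK. Qed.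

(** The C*-identity |y|^2 = |y^* y| <= |y^*| |y| yields one inequality for every y, and the
    involution yields the other. *)
Lemma vnorm_star x : vnorm (star x) = vnorm x.
Proof.
suff le y : vnorm y <= vnorm (star y).
  by apply/eqP; rewrite eq_le le -{2}(starK x) le.
have [->|y0] := eqVneq (vnorm y) 0; first exact: vnorm_ge0.
have y1 : 0 < vnorm y by rewrite lt_def y0 vnorm_ge0.
by rewrite -(ler_pM2r y1) -expr2 -vnorm_starM vnormM.
Qed.

Lemma vnorm1 : vnorm (1 : B) = 1.
Proof.
have /eqP := vnorm_starM (1 : B); rewrite star1 mulr1 expr2 -subr_eq0.
rewrite -{1}[vnorm 1]mulr1 -mulrBr mulf_eq0 => /orP[/eqP/vnorm0_eq0|].
  by move/eqP; rewrite oner_eq0.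
by rewrite subr_eq0 => /eqP.
Qed.

Lemma vnorm_sqr k : star k = k -> vnorm (k * k) = vnorm k ^+ 2.
Proof. by move=> hk; rewrite -{1}hk vnorm_starM. Qed.

Lemma vnorm_scalar r : vnorm (r%:C%:A : B) = `|r|.
Proof. by rewrite vnormZr vnorm1 mulr1. Qed.

Lemma star_scalar r : star (r%:C%:A : B) = r%:C%:A.
Proof. by rewrite starZr star1. Qed.

Lemma vlimM u v x y : vlim u x -> vlim v y -> vlim (fun n => u n * v n) (x * y).
Proof.
move=> ux vy e e0.
pose K := vnorm x + vnorm y + 1.
have := vnorm_ge0 x; have := vnorm_ge0 y => y0 x0.
have K0 : 0 < K by rewrite /K; lra.
(* The 1 keeps [v n] bounded by |y| + 1, so that the total error is at most d K <= e / 2. *)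
pose d := Num.min 1 (e / (2 * K)).
have d0 : 0 < d by rewrite lt_min ltr01 divr_gt0 // mulr_gt0 // ltr0n.
have [N hN] := ux _ d0; have [M hM] := vy _ d0.
exists (maxn N M) => n; rewrite geq_max => /andP[/hN h1 /hM h2].
have -> : u n * v n - x * y = (u n - x) * v n + x * (v n - y).
  by rewrite mulrBl mulrBr addrA subrK.
apply: le_lt_trans (vnormD _ _) _.
have vn : vnorm (v n) <= vnorm y + d.
  by rewrite -[v n](subrK y) addrC (le_trans (vnormD _ _)) // lerD2l ltW.
have d1 : d <= 1 by rewrite ge_min lexx.
have : d * (2 * K) <= e by rewrite -ler_pdivlMr ?mulr_gt0 // ge_min lexx orbT.
have : vnorm ((u n - x) * v n) <= d * (vnorm y + 1).
  by apply: le_trans (vnormM _ _) _; apply: ler_pM; rewrite ?vnorm_ge0 //; lra.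
have : vnorm (x * (v n - y)) <= vnorm x * d.
  by apply: le_trans (vnormM _ _) _; apply: ler_pM; rewrite ?vnorm_ge0 // ltW.
rewrite /K; nra.
Qed.

Lemma vlimZ c u x : vlim u x -> vlim (fun n => c *: u n) (c *: x).
Proof.
move=> ux; rewrite -mulr_algl; apply: vlim_eq (vlimM (vlim_cst c%:A) ux) => n.
by rewrite mulr_algl.
Qed.

Lemma vlim_star u x : vlim u x -> vlim (fun n => star (u n)) (star x).
Proof.
by move=> ux e /ux[N hN]; exists N => n /hN; rewrite -starB vnorm_star.
Qed.

(* The limit [b] of the iteration [b := (a + b^2) / 2] satisfies
   [(1 - b)^2 = 1 - a]. *)
Lemma sqrt_one_sub a : star a = a -> vnorm a <= 1 ->
  exists k, [/\ star k = k, k * k = 1 - a, vnorm (1 - k) <= 1 &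
    forall y, GRing.comm y a -> GRing.comm y k].
Proof.
move=> aS a1.
pose h : R[i] := (2^-1 : R)%:C.
pose b := fix b n := if n is n'.+1 then h *: (a + b n' * b n') else (0 : B).
(* The same iteration in the reals at a = 1: it stays in [0, 1] and dominates both the norms and the
   increments of [b]. *)
pose c := fix c n := if n is n'.+1 then 2^-1 * (1 + c n' ^+ 2) else (0 : R).
have bS n : star (b n) = b n.
  by elim: n => [|n IH] /=; rewrite ?star0 // starZr starD aS starM IH.
have bC y n : GRing.comm y a -> GRing.comm y (b n).
  move=> ya; elim: n => [|n IH] /=; first exact: commr0.
  by rewrite /GRing.comm -scalerAr -scalerAl; congr (_ *: _);
    apply: commrD => //; apply: commrM.
(* Commuting iterates allow the difference of the squares of [b n] and [b m] to be factored. *)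
have bbC m n : b m * b n = b n * b m.
  by apply: (bC (b m) n); apply/commr_sym; exact: bC.
have c01 n : 0 <= c n <= 1.
  by elim: n => [|n /andP[? ?]] /=; first lra; apply/andP; split; nra.
have c_mono n : c n <= c n.+1.
  elim: n => [|n IH]; first by have /andP[] := c01 1%N.
  have cS m : c m.+1 = 2^-1 * (1 + c m ^+ 2) by [].
  rewrite (cS n.+1) {1}(cS n).
  have /andP[? ?] := c01 n; have /andP[? ?] := c01 n.+1; nra.
have bc n : vnorm (b n) <= c n.
  elim: n => [|n IH] /=; first by rewrite vnorm0.
  rewrite vnormZr ger0_norm ?invr_ge0 ?ler0n // ler_wpM2l ?invr_ge0 ?ler0n //.
  apply: le_trans (vnormD _ _) _; apply: lerD => //.
  by apply: le_trans (vnormM _ _) _; rewrite expr2 ler_pM ?vnorm_ge0.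
have bb m n : (m <= n)%N -> vnorm (b n - b m) <= c n - c m.
  elim: m n => [|m IH] n; first by rewrite !subr0.
  case: n => // n /IH {}IH /=.
  have -> : h *: (a + b n * b n) - h *: (a + b m * b m)
    = h *: ((b n - b m) * (b n + b m)).
    rewrite -scalerBr opprD addrACA subrr add0r mulrDr !mulrBl.
    by rewrite (bbC m n) addrA subrK.
  rewrite vnormZr ger0_norm ?invr_ge0 ?ler0n //.
  have -> : 2^-1 * (1 + c n ^+ 2) - 2^-1 * (1 + c m ^+ 2)
    = 2^-1 * ((c n - c m) * (c n + c m)) by ring.
  rewrite ler_wpM2l ?invr_ge0 ?ler0n //.
  apply: le_trans (vnormM _ _) _; apply: ler_pM; rewrite ?vnorm_ge0 //.
  by apply: le_trans (vnormD _ _) _; apply: lerD.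
have [l bl] : exists l, vlim b l.
  by apply: (@vlim_dominated _ _ _ c 1) => // n; have /andP[] := c01 n.
have lS : star l = l.
  by apply: (vlim_unique _ bl); apply: vlim_eq (vlim_star bl).
have l_eq : l = h *: (a + l * l).
  have bl' : vlim (fun n => b n.+1) l.
    by move=> e /bl[N hN]; exists N => n Nn; apply: hN; exact: leqW.
  apply: vlim_unique bl' _.
  exact: vlimZ (vlimD (vlim_cst a) (vlimM bl bl)).
have lC y : GRing.comm y a -> GRing.comm y l.
  move=> ya; apply: (@vlim_unique _ _ (fun n => y * b n)).
    exact: vlimM (vlim_cst y) bl.
  apply: vlim_eq (vlimM bl (vlim_cst y)) => n.
  by apply/esym/bC.
exists (1 - l); split.
- by rewrite starB star1 lS.
- have -> : a = h^-1 *: l - l * l.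
    rewrite {1}l_eq scalerA mulVf ?scale1r ?addrK //.
    by rewrite fmorph_eq0 invr_eq0 pnatr_eq0.
  rewrite mulrBl mul1r mulrBr mulr1.
  have -> : h^-1 *: l = l + l.
    have -> : h^-1 = 1 + 1 by rewrite /h -fmorphV invrK rmorphMn.
    by rewrite scalerDl scale1r.
  by rewrite !opprB opprD -addrA; congr (_ + _); rewrite addrCA.
- rewrite opprB addrC subrK -[l]subr0; apply: vlim_le bl _ => n.
  by rewrite subr0 (le_trans (bc n)) //; have /andP[] := c01 n.
- by move=> y /lC yl; apply: commrB => //; exact: commr1.
Qed.

End Positive.

Lemma conj_i (R : rcfType) : Num.conj ('i%C : R[i]) = - 'i%C.
Proof. by apply/eqP; rewrite eq_complex /= oppr0 !eqxx. Qed.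

(** * The positive cone, defined by the norm *)

Section Cone.
Context (R : realType) (B : cstarType R).
Implicit Types (x y z k l : B) (r t e : R).

(** For selfadjoint [x] the inequality says that the spectrum lies in [0, 2 t]. In this form the
    witnesses simply add up under sums, by the triangle inequality. *)
Definition cpos x :=
  star x = x /\ exists2 t, 0 <= t & vnorm (t%:C%:A - x) <= t.

Lemma cpos0 : cpos 0.
Proof. by split; [exact: star0|exists 0; rewrite // subr0 vnorm_scalar normr0].
  Qed.

Lemma cposD x y : cpos x -> cpos y -> cpos (x + y).
Proof.
move=> [xS [t t0 xt]] [yS [s s0 ys]]; split; first by rewrite starD xS yS.
exists (t + s); first exact: addr_ge0.
rewrite rmorphD scalerDl opprD addrACA; apply: le_trans (vnormD _ _) _.
exact: lerD.
Qed.

Lemma cposZ r x : 0 <= r -> cpos x -> cpos (r%:C *: x).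
Proof.
move=> r0 [xS [t t0 xt]]; split; first by rewrite starZr xS.
exists (r * t); first exact: mulr_ge0.
rewrite rmorphM -scalerA -scalerBr vnormZr ger0_norm //.
by rewrite ler_wpM2l.
Qed.

Lemma cpos_scalar r : 0 <= r -> cpos (r%:C%:A).
Proof.
by move=> r0; split; [exact: star_scalar|exists r; rewrite // subrr vnorm0].
Qed.

Lemma cpos_sum (I : Type) (s : seq I) (P : pred I) (F : I -> B) :
  (forall i, P i -> cpos (F i)) -> cpos (\sum_(i <- s | P i) F i).
Proof. by move=> h; apply: big_ind => //; [exact: cpos0|exact: cposD]. Qed.

Lemma cposMn x n : cpos x -> cpos (x *+ n).
Proof.
move=> hx; elim: n => [|n IH]; first by rewrite mulr0n; exact: cpos0.
by rewrite mulrS; exact: cposD.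
Qed.

Lemma cpos_scalar_sub t x : star x = x -> vnorm x <= t -> cpos (t%:C%:A - x).
Proof.
move=> xS xt; split; first by rewrite starB star_scalar xS.
exists t; first exact: le_trans (vnorm_ge0 _) xt.
by rewrite opprB addrC subrK.
Qed.

(** With a = 1 - x / t the hypothesis reads |a| <= 1, and sqrt t times the root of 1 - a works. The
    commutation clause makes the roots of commuting elements commute, which is all that is used of
    functional calculus. *)
Lemma cpos_sqrt x : cpos x ->
  exists k, [/\ cpos k, k * k = x & forall y, GRing.comm y x -> GRing.comm y k].
Proof.
move=> [xS [t]]; rewrite le_eqVlt => /predU1P[<-|t0] xt.
  have -> : x = 0.
    apply: vnorm_small => e e0; apply: le_trans (ltW e0).
    by move: xt; rewrite scale0r sub0r vnormN.
  exists 0; split; [exact: cpos0|exact: mulr0|].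
  by move=> y _; exact: commr0.
have tC : t%:C != 0 :> R[i] by rewrite fmorph_eq0 gt_eqF.
pose a := 1 - (t^-1)%:C *: x.
have ta : t%:C *: a = t%:C%:A - x.
  by rewrite scalerBr scalerA fmorphV mulfV // scale1r.
have [||k [kS kk k1 kC]] := @sqrt_one_sub R B a.
- by rewrite starB star1 starZr xS.
- move: xt; rewrite -ta vnormZr gtr0_norm //.
  by rewrite -{2}[t]mulr1 ler_pM2l.
have st : Num.sqrt t * Num.sqrt t = t by rewrite -expr2 sqr_sqrtr // ltW.
exists ((Num.sqrt t)%:C *: k); split.
- split; first by rewrite starZr kS.
  exists (Num.sqrt t); first exact: sqrtr_ge0.
  rewrite -scalerBr vnormZr ger0_norm ?sqrtr_ge0 //.
  by rewrite -[leRHS]mulr1 ler_wpM2l ?sqrtr_ge0.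
- rewrite -scalerAl -scalerAr scalerA -rmorphM st kk /a opprB addrC subrK.
  by rewrite scalerA fmorphV mulfV // scale1r.
- move=> y yx; rewrite /GRing.comm -scalerAl -scalerAr; congr (_ *: _).
  apply: kC; apply: commrB; first exact: commr1.
  by rewrite /GRing.comm -scalerAl -scalerAr yx.
Qed.

(* [u = k + i l] is normal, with [u^* u = k^2 + l^2] and real part [k]. *)
Lemma vnorm_sqr_le k l : star k = k -> star l = l -> GRing.comm k l ->
  vnorm k ^+ 2 <= vnorm (k * k + l * l).
Proof.
move=> kS lS kl; pose u := k + 'i%C *: l.
have uS : star u = k - 'i%C *: l.
  by rewrite starD starZ kS lS conj_i scaleNr.
have -> : k * k + l * l = star u * u.
  have mk : ('i%C *: l) * k = k * ('i%C *: l).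
    by rewrite -scalerAl -scalerAr kl.
  have mm : ('i%C *: l) * ('i%C *: l) = - (l * l).
    by rewrite -scalerAl -scalerAr scalerA -expr2 sqr_i scaleN1r.
  by rewrite uS mulrBl !mulrDr mk mm opprD opprK addrA addrK.
rewrite vnorm_starM ler_sqr ?nnegrE ?vnorm_ge0 //.
have := vnormD u (star u); rewrite vnorm_star {2}/u uS addrACA subrr addr0.
rewrite -mulr2n -scaler_nat -(rmorph_nat (real_complex R)) vnormZr normr_nat.
rewrite -mulr2n -mulr_natl; lra.
Qed.

(** After scaling to |c| <= 1, the root [s] of 1 - c^2 commutes with [c], hence |1 - c^2| = |s|^2 <=
    |s^2 + c^2| = 1. The 1 added in [t] prevents a division by zero. *)
Lemma cpos_sqr k : star k = k -> cpos (k * k).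
Proof.
move=> kS; split; first by rewrite starM kS.
pose t := vnorm k + 1; have t0 : 0 < t by have := vnorm_ge0 k; rewrite /t; lra.
pose c := (t^-1)%:C *: k.
have cS : star c = c by rewrite starZr kS.
have tC : t%:C != 0 :> R[i] by rewrite fmorph_eq0 gt_eqF.
have tc : t%:C *: c = k by rewrite scalerA fmorphV mulfV // scale1r.
have c1 : vnorm c <= 1.
  rewrite vnormZr gtr0_norm ?invr_gt0 // mulrC ler_pdivrMr // mul1r /t; lra.
have [||s [sS ss _ sC]] := @sqrt_one_sub R B (c * c).
- by rewrite starM cS.
- by rewrite vnorm_sqr // expr_le1 ?vnorm_ge0.
exists (t ^+ 2); first exact: sqr_ge0.
rewrite -tc -scalerAl -scalerAr scalerA -rmorphM -expr2 -scalerBr vnormZr.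
rewrite ger0_norm ?sqr_ge0 // -[leRHS]mulr1 ler_wpM2l ?sqr_ge0 //.
rewrite -ss vnorm_sqr //; apply: le_trans (vnorm_sqr_le sS cS _) _.
  by apply/commr_sym/sC; apply: commrM.
by rewrite ss subrK vnorm1.
Qed.

(** With x = k^2 and t - x = l^2 for commuting [k] and [l], |x| = |k|^2 <= |k^2 + l^2| = t. *)
Lemma vnorm_le_scalar t x : 0 <= t -> cpos x -> cpos (t%:C%:A - x) ->
  vnorm x <= t.
Proof.
move=> t0 /cpos_sqrt[k [[kS _] kk _]] /cpos_sqrt[l [[lS _] ll lC]].
rewrite -kk vnorm_sqr //; apply: le_trans (vnorm_sqr_le kS lS _) _.
  apply: lC; apply: commrB.
    by rewrite /GRing.comm -scalerAl -scalerAr mulr1 mul1r.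
  by rewrite -kk; apply: commrM.
by rewrite kk ll addrC subrK vnorm_scalar ger0_norm.
Qed.

Lemma vnorm_scalar_sub t x : cpos x -> vnorm x <= t ->
  vnorm (t%:C%:A - x) <= t.
Proof.
move=> hx xt; apply: vnorm_le_scalar.
- exact: le_trans (vnorm_ge0 _) xt.
- by apply: cpos_scalar_sub => //; case: hx.
- by rewrite opprB addrC subrK.
Qed.

Lemma vnorm_leD x y : cpos x -> cpos y -> vnorm x <= vnorm (x + y).
Proof.
move=> hx hy; apply: vnorm_le_scalar; rewrite ?vnorm_ge0 //.
have -> : forall a : B, a - x = (a - (x + y)) + y.
  by move=> a; rewrite opprD addrA subrK.
by apply: cposD => //; apply: cpos_scalar_sub => //; case: (cposD hx hy).
Qed.

Lemma cpos_antisym x : cpos x -> cpos (- x) -> x = 0.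
Proof.
move=> hx hNx; apply: vnorm_small => e e0; apply: le_trans (ltW e0).
by apply: vnorm_le_scalar; rewrite // scale0r sub0r.
Qed.

(** The witness must not depend on the approximant: |x| + 1 serves for all those within distance 1,
    by [vnorm_scalar_sub], and hence for the limit. *)
Lemma cpos_closed x :
  (forall e, 0 < e -> exists2 y, cpos y & vnorm (x - y) <= e) -> cpos x.
Proof.
move=> h; split.
  apply/eqP; rewrite -subr_eq0; apply/eqP/vnorm_small => e e0.
  have [|y [yS _] xy] := h (e / 2); first by lra.
  have -> : star x - x = star (x - y) + (y - x).
    by rewrite starB yS addrA subrK.
  apply: le_trans (vnormD _ _) _; rewrite vnorm_star [vnorm (y - _)]vdistC; lra.
exists (vnorm x + 1); first by have := vnorm_ge0 x; lra.
apply/ler_addgt0Pr => e e0; pose d := Num.min 1 e.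
have [|y hy xy] := h d; first by rewrite lt_min ltr01.
have [d1 de] : d <= 1 /\ d <= e by rewrite !ge_min !lexx orbT.
rewrite -[_ - x](subrKA y); apply: le_trans (vnormD _ _) _.
rewrite [vnorm (y - x)]vdistC; apply: lerD; last exact: le_trans xy de.
apply: vnorm_scalar_sub => //.
rewrite -[y](subrK x) addrC; apply: le_trans (vnormD _ _) _.
by rewrite lerD2l vdistC (le_trans xy d1).
Qed.

End Cone.

(** * Positivity of x^* x *)

Section StarSquare.
Context (R : realType) (B : cstarType R).
Implicit Types (x y z k l : B) (r t e : R).

Lemma cpos_double x : cpos (x + x) -> cpos x.
Proof.
move=> hx; have -> : x = (2^-1)%:C *: (x + x).
  rewrite -mulr2n -scaler_nat scalerA fmorphV rmorph_nat mulVf ?pnatr_eq0 //.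
  by rewrite scale1r.
by apply: cposZ; rewrite // invr_ge0 ler0n.
Qed.

Lemma selfadjoint_sqr_eq0 k : star k = k -> k * k = 0 -> k = 0.
Proof.
move=> kS kk; apply: vnorm0_eq0; apply/eqP.
by rewrite -sqrf_eq0 -vnorm_sqr // kk vnorm0.
Qed.

Lemma vnormX_le1 x n : vnorm x <= 1 -> vnorm (x ^+ n) <= 1.
Proof.
move=> x1; elim: n => [|n IH]; first by rewrite expr0 vnorm1.
rewrite exprS; apply: le_trans (vnormM _ _) _.
by apply: mulr_ile1; rewrite ?vnorm_ge0.
Qed.

Lemma expr_sqr_cpos z n : star z = z -> cpos ((z * z) ^+ n).
Proof.
move=> zS; rewrite -expr2 -exprM mulnC exprM expr2; apply: cpos_sqr.
by elim: n => [|n IH]; rewrite ?expr0 ?star1 // exprS starM IH zS -exprSr exprS.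
Qed.

(* [y^* (1 - y y^* )^n y = - (1 + c)^n c] has norm at most [|y|^2], whereas
   the right-hand side dominates [n c^2]. *)
Lemma star_mul_neg_sqr_le1 y z : star z = z -> star y * y = - (z * z) ->
  vnorm (y * star y) <= 1 -> z * z = 0.
Proof.
move=> zS; set c := z * z => yc q1; set q := y * star y in q1 *.
(* The squares of [y + star y] and of [s], both selfadjoint, add up to 2 (q - c), and [c] is itself
   a square. *)
have qpos : cpos q.
  apply: cpos_double.
  pose s := 'i%C *: (y - star y).
  have sS : star s = s.
    by rewrite starZ starB starK conj_i -[star y - y]opprB scalerN scaleNr
      opprK.
  have -> : q + q = (y + star y) * (y + star y) + s * s + (c + c).
    rewrite /s -scalerAl -scalerAr scalerA -['i%C * _]expr2 sqr_i scaleN1r.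
    have -> : (y + star y) * (y + star y)
        = (y * y + star y * star y) + (q - c).
      by rewrite mulrDl !mulrDr yc -/q [- c + _]addrC addrACA.
    have -> : (y - star y) * (y - star y)
        = (y * y + star y * star y) - (q - c).
      by rewrite mulrBl !mulrBr yc -/q !opprB opprK addrACA [- q + _]addrC.
    by rewrite opprB [X in X + (c + c)]addrC [X in X + (c + c)]addrA subrK
      addrACA subrK.
  apply: cposD; [apply: cposD; apply: cpos_sqr => //|].
    by rewrite starD starK addrC.
  by apply: cposD; exact: cpos_sqr.
(* Since star y * q = - (c * star y), [star y] carries powers of 1 - q to powers of 1 + c; the
   former have norm at most 1. *)
have shift n : star y * (1 - q) ^+ n = (1 + c) ^+ n * star y.
  elim: n => [|n IH]; first by rewrite !expr0 mulr1 mul1r.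
  rewrite exprSr mulrA IH exprSr -!mulrA; congr (_ * _).
  by rewrite mulrBr mulr1 mulrA yc mulrDl mul1r mulNr opprK.
have bnd n : vnorm (c * (c + 1) ^+ n) <= vnorm y ^+ 2.
  have -> : c * (c + 1) ^+ n = - (star y * (1 - q) ^+ n * y).
    rewrite shift -mulrA yc mulrN opprK [c + 1]addrC.
    by apply: commrX; apply: commrD; [exact: commr1|].
  rewrite vnormN -[leRHS]mulr1 expr2 mulrAC.
  apply: le_trans (vnormM _ _) _; rewrite ler_wpM2r ?vnorm_ge0 //.
  apply: le_trans (vnormM _ _) _; rewrite vnorm_star ler_wpM2l ?vnorm_ge0 //.
  by apply: vnormX_le1; have := vnorm_scalar_sub qpos q1;
    rewrite rmorph1 scale1r.
have grow n : n%:R * vnorm (c * c) <= vnorm y ^+ 2.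
  case: n => [|n]; first by rewrite mul0r sqr_ge0.
  apply: le_trans (bnd n.+1); rewrite -[n.+1%:R]ger0_norm // -vnormZr
    rmorph_nat.
  (* Only the linear term of the binomial expansion is kept, the others being positive multiples of
     powers of z^2. *)
  rewrite exprD1n mulr_sumr (bigD1 (inord 1)) //= inordK // bin1 expr1 mulrnAr.
  rewrite scaler_nat; apply: vnorm_leD; first by apply/cposMn/cpos_sqr;
    rewrite starM zS.
  apply: cpos_sum => i _; rewrite mulrnAr -exprS; apply/cposMn.
  exact: expr_sqr_cpos.
have cc0 : c * c = 0.
  apply: vnorm_small => e e0.
  have [n hn] : exists n : nat, vnorm y ^+ 2 / e < n%:R.
    by exists (Num.bound (vnorm y ^+ 2 / e)); apply: archi_boundP;
      rewrite divr_ge0 ?sqr_ge0 // ltW.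
  rewrite ltr_pdivrMr // in hn; have := grow n.
  case: n hn => [|n]; first by rewrite mul0r ltNge sqr_ge0.
  by move=> h1 h2; have := le_lt_trans h2 h1; rewrite ltr_pM2l ?ltr0Sn //
    => /ltW.
by apply: selfadjoint_sqr_eq0 => //; rewrite starM zS.
Qed.

Lemma star_mul_neg_sqr y z : star z = z -> star y * y = - (z * z) -> z * z = 0.
Proof.
move=> zS yz; pose t := vnorm y + 1.
have t0 : 0 < t by have := vnorm_ge0 y; rewrite /t; lra.
have tC : t%:C != 0 :> R[i] by rewrite fmorph_eq0 gt_eqF.
pose a := (t^-1)%:C : R[i].
have : (a *: z) * (a *: z) = 0.
  apply: (@star_mul_neg_sqr_le1 (a *: y)).
  - by rewrite starZr zS.
  - by rewrite starZr -!scalerAl -!scalerAr yz !scalerN.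
  - have ay : vnorm (a *: y) <= 1.
      rewrite vnormZr gtr0_norm ?invr_gt0 // mulrC ler_pdivrMr // mul1r /t; lra.
    apply: le_trans (vnormM _ _) _; rewrite vnorm_star.
    by apply: mulr_ile1; rewrite ?vnorm_ge0.
rewrite -scalerAl -scalerAr scalerA => /(congr1 (fun b => (t%:C * t%:C) *: b)).
rewrite scaler0 scalerA /a fmorphV mulrACA mulfV // mulr1 scale1r //.
Qed.

(** Let [k] be the root of h^2, the absolute value of [h], and d = k - h, twice the negative part.
    Then h d = - k d, so y = x d satisfies y^* y = d h d = - k d^2 = - z^2, where [z] is the root of
    [k] times [d]. By [star_mul_neg_sqr] this vanishes, which forces d = 0, that is h = k. *)
Lemma cpos_star_mul x : cpos (star x * x).
Proof.
set h := star x * x; have hS : star h = h by rewrite starM starK.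
have [k [[kS kpos] kk kC]] := cpos_sqrt (cpos_sqr hS).
have [q [[qS _] qq qC]] := cpos_sqrt (conj kS kpos).
have hk : GRing.comm h k by apply: kC; apply: commrM.
pose d := k - h; have dS : star d = d by rewrite starB kS hS.
have kd : GRing.comm k d by apply: commrB => //; exact/commr_sym.
have hd : GRing.comm h d by apply: commrB.
have dq : GRing.comm d q by apply: qC; apply/commr_sym.
have dd : d * d = (k * d) *+ 2.
  rewrite mulr2n {1}/d mulrBl; congr (_ + _).
  by rewrite /d !mulrBr -kk hk opprB.
pose z := q * d; have zS : star z = z by rewrite starM dS qS.
have zz : z * z = k * (d * d).
  by rewrite /z -mulrA [d * _]mulrA dq -[q * d * d]mulrA mulrA qq.
have kkd : h * (k * d) = - (k * (k * d)).
  by rewrite mulrA hk -mulrA -mulrN; congr (_ * _);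
    rewrite /d !mulrBr hk kk opprB.
have z0 : z * z = 0.
  apply: (@star_mul_neg_sqr (x * d)) => //.
  rewrite starM dS -mulrA [star x * _]mulrA -/h hd mulrA dd mulrnAl.
  have -> : k * d * h = h * (k * d).
    by rewrite -mulrA -hd mulrA -hk mulrA.
  by rewrite kkd zz dd mulrnAr mulNrn.
have kd0 : k * d = 0.
  apply: selfadjoint_sqr_eq0; first by rewrite starM kS dS kd.
  have -> : (k * d) * (k * d) = k * (z * z).
    by rewrite zz -!mulrA [d * (k * d)]mulrA -kd -mulrA.
  by rewrite z0 mulr0.
have d0 : d = 0.
  by apply: selfadjoint_sqr_eq0; rewrite // dd kd0 mul0rn.
by have -> : h = k by apply/esym/eqP; rewrite -subr_eq0 -/d d0.
Qed.

End StarSquare.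

Section LinearFunctions.
Context (K : pzRingType) (V W : lmodType K) (f : V -> W).
Hypothesis fl : linear f.

Let F : {linear V -> W} := HB.pack f (GRing.isLinear.Build K V W *:%R f fl).

Lemma lin0 : f 0 = 0. Proof. exact: (linear0 F). Qed.
Lemma linD : {morph f : x y / x + y}. Proof. exact: (linearD F). Qed.
Lemma linN : {morph f : x / - x}. Proof. exact: (linearN F). Qed.
Lemma linB : {morph f : x y / x - y}. Proof. exact: (linearB F). Qed.
Lemma linZ c : {morph f : x / c *: x}. Proof. exact: (linearZ_LR F). Qed.
Lemma lin_sum (I : Type) (s : seq I) (P : pred I) (G : I -> V) :
  f (\sum_(i <- s | P i) G i) = \sum_(i <- s | P i) f (G i).
Proof. exact: (linear_sum F). Qed.

End LinearFunctions.

Lemma shom_cpos (R : realType) (A B : cstarType R) (f : A -> B) x :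
  star_hom f -> cpos x -> cpos (f x).
Proof.
move=> fh /cpos_sqrt[k [[kS _] <- _]]; rewrite (shomM fh).
by apply: cpos_sqr; rewrite -(shom_star fh) kS.
Qed.

Lemma shom_scalar (R : realType) (A B : cstarType R) (f : A -> B) c :
  star_hom f -> f c%:A = c%:A.
Proof. by move=> fh; rewrite (linZ (shom_linear fh)) (shom1 fh). Qed.

(** [f] preserves the positivity of |x|^2 - x^* x, and the order bounds the norm. *)
Lemma shom_contractive (R : realType) (A B : cstarType R) (f : A -> B) x :
  star_hom f -> vnorm (f x) <= vnorm x.
Proof.
move=> fh; rewrite -ler_sqr ?nnegrE ?vnorm_ge0 // -vnorm_starM.
apply: vnorm_le_scalar; rewrite ?sqr_ge0 //; first exact: cpos_star_mul.
rewrite -(shom_scalar _ fh) -(shom_star fh) -(shomM fh) -(linB (shom_linear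
  fh)).
apply: (shom_cpos fh); apply: cpos_scalar_sub.
  by rewrite starM starK.
by rewrite vnorm_starM.
Qed.

(** * Positive matrices and Cholesky factorization *)

Section MatrixPositivity.
Context (R : realType) (B : cstarType R).
Implicit Types (x y z k l : B) (r t e : R).

Lemma cpos_conj x y : cpos x -> cpos (star y * x * y).
Proof.
move=> /cpos_sqrt[k [[kS _] <- _]].
have -> : star y * (k * k) * y = star (k * y) * (k * y).
  by rewrite starM kS !mulrA.
exact: cpos_star_mul.
Qed.

(** Neumann series: a = 1 - x / M has norm at most 1 - e / M < 1. The inverse of the root [c] is [c]
    times the inverse of [x]. *)
Lemma cpos_invertible x e : 0 < e -> cpos (x - e%:C%:A) ->
  exists c d, [/\ star c = c, c * c = x, c * d = 1 & d * c = 1].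
Proof.
move=> e0 xe.
have xpos : cpos x.
  by rewrite -(subrK e%:C%:A x); apply: cposD => //; apply: cpos_scalar;
    exact: ltW.
(* Adding [e] makes [M] positive and M - e = |x| nonnegative, as needed to bound the norm of M - x
   by M - e. *)
pose M := vnorm x + e; have M0 : 0 < M by have := vnorm_ge0 x; rewrite /M; lra.
have MC : M%:C != 0 :> R[i] by rewrite fmorph_eq0 gt_eqF.
pose q := 1 - M^-1 * e.
pose a := 1 - (M^-1)%:C *: x.
have aq : vnorm a <= q.
  have -> : a = (M^-1)%:C *: (M%:C%:A - x).
    by rewrite /a scalerBr scalerA fmorphV mulVf // scale1r.
  have -> : q = M^-1 * (M - e) by rewrite /q mulrBr mulVf // gt_eqF.
  rewrite vnormZr gtr0_norm ?invr_gt0 // ler_wpM2l ?invr_ge0 1?[0 <= M]ltW //.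
  apply: vnorm_le_scalar.
  - by rewrite /M addrK vnorm_ge0.
  - apply: cpos_scalar_sub; first by case: xpos.
    by rewrite /M lerDl ltW.
  - by rewrite rmorphB scalerBl opprB addrC addrA subrK.
have q0 : 0 <= q by exact: le_trans (vnorm_ge0 _) aq.
have q1 : q < 1 by rewrite /q ltrBlDr ltrDl mulr_gt0 ?invr_gt0.
pose s n := \sum_(i < n) a ^+ i.
have aX n : vnorm (a ^+ n) <= q ^+ n.
  elim: n => [|n IH]; first by rewrite !expr0 vnorm1.
  by rewrite !exprS; apply: le_trans (vnormM _ _) _; rewrite ler_pM ?vnorm_ge0.
have [l sl] : exists l, vlim s l.
  apply: (@vlim_dominated _ _ _ (fun n => \sum_(i < n) q ^+ i) (1 - q)^-1).
    move=> m n; elim: n => [|n IH]; first by rewrite leqn0 => /eqP->;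
      rewrite !subrr vnorm0.
    rewrite leq_eqVlt => /predU1P[->|/IH {}IH]; first by rewrite !subrr vnorm0.
    rewrite /s !big_ord_recr /= -!/(s _) [_ + a ^+ n]addrC [_ + q ^+ n]addrC
      -!addrA.
    by apply: le_trans (vnormD _ _) _; apply: lerD.
  move=> n; rewrite -[leRHS]mul1r ler_pdivlMr ?subr_gt0 // mulrC.
  rewrite -(opprB q) mulNr -subrX1 opprB; have := exprn_ge0 n q0; lra.
have sa n : s n.+1 = 1 + s n * a.
  rewrite /s big_ord_recl expr0 mulr_suml; congr (_ + _).
  by apply: eq_bigr => i _; rewrite exprSr.
have as_ n : s n.+1 = 1 + a * s n.
  rewrite /s big_ord_recl expr0 mulr_sumr; congr (_ + _).
  by apply: eq_bigr => i _; rewrite exprS.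
have sl' : vlim (fun n => s n.+1) l.
  by move=> d /sl[N hN]; exists N => n Nn; apply: hN; exact: leqW.
have la : l = 1 + l * a.
  apply: (vlim_unique sl'); apply: vlim_eq (vlimD (vlim_cst 1) (vlimM sl
    (vlim_cst a))) => n.
  by rewrite sa.
have al : l = 1 + a * l.
  apply: (vlim_unique sl'); apply: vlim_eq (vlimD (vlim_cst 1) (vlimM (vlim_cst
    a) sl)) => n.
  by rewrite as_.
have [c [[cS _] cc _]] := cpos_sqrt xpos.
pose m := (M^-1)%:C *: l.
have ax : (M^-1)%:C *: x = 1 - a by rewrite /a opprB addrC subrK.
have mx : m * x = 1.
  by rewrite /m -scalerAl scalerAr ax mulrBr mulr1 {1}la addrK.
have xm : x * m = 1.
  by rewrite /m -scalerAr scalerAl ax mulrBl mul1r {1}al addrK.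
exists c, (c * m); split=> //; first by rewrite mulrA cc.
have -> : c * m = m * c.
  have : m * (c * c) * c * m = m * c * (c * c) * m by rewrite !mulrA.
  by rewrite cc mx mul1r -[in RHS]mulrA xm mulr1.
by rewrite -mulrA cc.
Qed.

Definition psd n (X : 'I_n -> 'I_n -> B) :=
  (forall i j, star (X i j) = X j i) /\
  forall b : 'I_n -> B, cpos (\sum_i \sum_j star (b i) * X i j * b j).

(** The corner entry dominates [e], so it has an invertible root [c]; the row c^-1 X_0j is split off
    and the Schur complement [Y] is treated by induction. Strict positivity makes the pivots
    invertible, so the lower bound [e] has to be inherited by [Y]. *)
Lemma cholesky n (X : 'I_n -> 'I_n -> B) e : 0 < e ->
  (forall i j, star (X i j) = X j i) ->
  (forall b : 'I_n -> B, cpos (\sum_i \sum_j star (b i) * X i j * b j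
                               - e%:C *: \sum_i star (b i) * b i)) ->
  exists s : seq ('I_n -> B),
    forall i j, X i j = \sum_(l <- s) star (l i) * l j.
Proof.
move=> e0; elim: n X => [|n IH] X XS Xpos.
  by exists [::] => -[].
have [|c [d [cS cc cd dc]]] := @cpos_invertible (X ord0 ord0) e e0.
  have := Xpos (fun i => if i == ord0 then 1 else 0).
  rewrite (bigD1 ord0) //= (bigD1 ord0) //= (bigD1 (P := predT) ord0) //=.
  rewrite !big1 ?addr0 ?eqxx ?star1 ?mulr1 ?mul1r // => i /negPf ->.
  - by rewrite mulr0.
  - by rewrite big1 // => j _; rewrite star0 !mul0r.
  - by rewrite mulr0.
have dS : star d = d.
  have : star d * c = 1 by rewrite -{1}cS -starM cd star1.
  by move=> /(congr1 (fun z => z * d)); rewrite -mulrA cd mulr1 mul1r.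
pose l j := d * X ord0 j.
have l0 : l ord0 = c by rewrite /l -cc mulrA dc mul1r.
pose Y i j := X i j - star (l i) * l j.
have Y0j j : Y ord0 j = 0.
  by rewrite /Y l0 cS /l mulrA cd mul1r subrr.
have Yi0 i : Y i ord0 = 0.
  rewrite /Y l0 /l starM dS -mulrA dc mulr1 XS subrr //.
pose Y' i j := Y (lift ord0 i) (lift ord0 j).
have [||s hs] := IH Y'.
- by move=> i j; rewrite /Y' /Y starB starM starK XS.
- move=> b.
  (* This first coordinate gives sum l_i b'_i = 0: the rank-one part vanishes at [b'], and the form
     of [X] there is that of [Y'] at [b]. The surplus e b0^* b0 is added back below. *)
  pose b0 := - (d * \sum_j l (lift ord0 j) * b j).
  pose b' i := if unlift ord0 i is Some i' then b i' else b0.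
  have b'0 : b' ord0 = b0 by rewrite /b' unlift_none.
  have b'l i : b' (lift ord0 i) = b i by rewrite /b' liftK.
  have lb : \sum_i l i * b' i = 0.
    rewrite big_ord_recl b'0 l0 mulrN mulrA cd mul1r.
    under [X in _ + X]eq_bigr do rewrite b'l.
    by rewrite addNr.
  have XY : \sum_i \sum_j star (b' i) * X i j * b' j
      = \sum_i \sum_j star (b i) * Y' i j * b j.
    transitivity (\sum_i \sum_j star (b' i) * Y i j * b' j).
      have E : \sum_i \sum_j star (b' i) * (star (l i) * l j) * b' j = 0.
        transitivity (star (\sum_i l i * b' i) * (\sum_i l i * b' i)).
          rewrite star_sum mulr_suml; apply: eq_bigr => i _.
          rewrite mulr_sumr; apply: eq_bigr => j _.
          by rewrite [star (l i * b' i)]starM !mulrA.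
        by rewrite lb mulr0.
      rewrite -[RHS]addr0 -[in X in _ = _ + X]E -big_split;
        apply: eq_bigr => i _ /=.
      rewrite -big_split; apply: eq_bigr => j _ /=.
      by rewrite -mulrDl -mulrDr /Y subrK.
    rewrite big_ord_recl big1 ?add0r => [|j _]; last by rewrite Y0j mulr0 mul0r.
    apply: eq_bigr => i _; rewrite big_ord_recl Yi0 mulr0 mul0r add0r.
    by apply: eq_bigr => j _; rewrite !b'l.
  have := Xpos b'; rewrite XY big_ord_recl b'0.
  under [X in _ *: (_ + X)]eq_bigr do rewrite b'l.
  move=> h; have := cposD h (cposZ (ltW e0) (cpos_star_mul b0)).
  by rewrite scalerDr opprD addrA addrAC subrK.
pose ext (f : 'I_n -> B) j := if unlift ord0 j is Some j' then f j' else 0.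
exists (l :: map ext s) => i j; rewrite big_cons big_map.
have -> : X i j = star (l i) * l j + Y i j by rewrite addrC subrK.
congr (_ + _); rewrite /ext.
case: (unliftP ord0 i) => [i'|] ->; last first.
  by rewrite Y0j big1 // => f _; rewrite star0 mul0r.
case: (unliftP ord0 j) => [j'|] ->; last first.
  by rewrite Yi0 big1 // => f _; rewrite mulr0.
by rewrite -/(Y' i' j') hs.

Qed.

Definition scalar_diag n (r : R) (i j : 'I_n) : B :=
  if i == j then r%:C%:A else 0.

(** The pivots of a semidefinite matrix need not be invertible; the shift by [e] makes them so, and
    its users let [e] tend to 0. *)
Lemma psd_factor n (X : 'I_n -> 'I_n -> B) e : 0 < e -> psd X ->
  exists s : seq ('I_n -> B),
    forall i j, X i j + scalar_diag e i j = \sum_(l <- s) star (l i) * l j.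
Proof.
move=> e0 [XS Xpos]; apply: (cholesky e0) => [i j|b].
  rewrite starD XS /scalar_diag eq_sym.
  by case: eqP => _; rewrite ?star_scalar ?star0.
have -> : \sum_i \sum_j star (b i) * (X i j + scalar_diag e i j) * b j
  = \sum_i \sum_j star (b i) * X i j * b j + e%:C *: \sum_i star (b i) * b i.
  rewrite scaler_sumr -big_split; apply: eq_bigr => i _ /=.
  rewrite [X in _ = _ + X](_ : _ = \sum_j star (b i) * scalar_diag e i j * b j).
    by rewrite -big_split; apply: eq_bigr => j _; rewrite mulrDr mulrDl.
  rewrite (bigD1 i) //= big1 ?addr0 /scalar_diag ?eqxx.
    by rewrite mulr_algr scalerAl.
  by move=> j /negPf; rewrite eq_sym => ->; rewrite mulr0 mul0r.
by rewrite addrK.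
Qed.

End MatrixPositivity.

(** The test vectors [b] need not be images under [f], so this form is not the image of a form.
    Instead a factorization of X + d is mapped to a factorization, and [d] tends to 0. *)
Lemma shom_psd (R : realType) (A B : cstarType R) (f : A -> B) n
    (X : 'I_n -> 'I_n -> A) :
  star_hom f -> psd X -> psd (fun i j => f (X i j)).
Proof.
move=> fh Xp; split=> [i j|b]; first by rewrite -(shom_star fh) Xp.1.
apply: cpos_closed => e e0.
set N := \sum_i star (b i) * b i.
pose d := e / (vnorm N + 1).
have N0 := vnorm_ge0 N.
have d0 : 0 < d by rewrite divr_gt0 //; lra.
have [s hs] := psd_factor d0 Xp.
exists (\sum_(l <- s) star (\sum_i f (l i) * b i) * (\sum_i f (l i) * b i)).
  by apply: cpos_sum => l _; exact: cpos_star_mul.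
have -> : \sum_(l <- s) star (\sum_i f (l i) * b i) * (\sum_i f (l i) * b i)
  = \sum_i \sum_j star (b i) * f (X i j) * b j + d%:C *: N.
  have -> : d%:C *: N = \sum_i \sum_j star (b i) * f (scalar_diag A d i j) * b
    j.
    rewrite scaler_sumr; apply: eq_bigr => i _.
    rewrite (bigD1 i) //= big1 ?addr0 /scalar_diag ?eqxx.
      by rewrite (shom_scalar _ fh) mulr_algr scalerAl.
    by move=> j /negPf; rewrite eq_sym => ->; rewrite (lin0 (shom_linear fh))
      mulr0 mul0r.
  rewrite -big_split /=.
  transitivity (\sum_i \sum_j \sum_(l <- s) star (b i) * (star (f (l i)) * f (l
    j)) * b j).
    under eq_bigr do rewrite star_sum mulr_suml.
    rewrite exchange_big; apply: eq_bigr => i _ /=.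
    rewrite exchange_big; apply: eq_bigr => l _ /=.
    by rewrite mulr_sumr; apply: eq_bigr => j _; rewrite starM !mulrA.
  apply: eq_bigr => i _; rewrite -big_split; apply: eq_bigr => j _ /=.
  rewrite -mulrDl -mulrDr -(linD (shom_linear fh)) hs (lin_sum (shom_linear
    fh)).
  rewrite mulr_sumr mulr_suml; apply: eq_bigr => l _.
  by rewrite (shomM fh) (shom_star fh).
rewrite opprD addrA subrr sub0r vnormN vnormZr gtr0_norm // /d.
by rewrite mulrAC ler_pdivrMr ?ler_pM2l //; lra.
Qed.

(** * States and the Gelfand-Naimark representation *)

Section HahnBanach.
Context (R : realType) (V : lmodType R[i]).
Implicit Types (p q f : V -> R) (x y : V) (r t : R).

Definition sublinear p :=
  (forall x y, p (x + y) <= p x + p y) /\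
  (forall r x, 0 <= r -> p (r%:C *: x) <= r * p x).

Lemma sublinear0 p : sublinear p -> p 0 = 0.
Proof.
move=> [pD pZ]; apply/eqP; rewrite eq_le; apply/andP; split.
  by have := pZ 0 0 (lexx _); rewrite scaler0 mul0r.
by have := pD 0 0; rewrite addr0; lra.
Qed.

Lemma sublinearZ p r x : sublinear p -> 0 <= r -> p (r%:C *: x) = r * p x.
Proof.
move=> ps; rewrite le_eqVlt => /predU1P[<-|r0].
  by rewrite scale0r mul0r sublinear0.
apply/eqP; rewrite eq_le (ps.2 _ _ (ltW r0)) /=.
have := ps.2 r^-1 (r%:C *: x); rewrite invr_ge0 => /(_ (ltW r0)).
rewrite scalerA fmorphV mulVf ?fmorph_eq0 ?gt_eqF // scale1r.
by rewrite ler_pdivlMl.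
Qed.

Lemma sublinear_opp p x : sublinear p -> - p (- x) <= p x.
Proof.
by move=> ps; have := ps.1 x (- x); rewrite subrr sublinear0 //; lra.
Qed.

(** The largest sublinear functional below [p] whose value at - x is at most - p x. *)
Definition tilt p x y := inf [set p (y + t%:C *: x) - t * p x | t in [set t | 0
  <= t]].

Lemma tilt_lbound p x y : sublinear p ->
  lbound [set p (y + t%:C *: x) - t * p x | t in [set t | 0 <= t]] (- p (- y)).
Proof.
move=> ps _ [t /= t0 <-]; have := ps.1 (y + t%:C *: x) (- y).
by rewrite addrC addKr sublinearZ //; lra.
Qed.

Lemma tilt_le p x y t : sublinear p -> 0 <= t ->
  tilt p x y <= p (y + t%:C *: x) - t * p x.
Proof.
move=> ps t0; apply: ge_inf; last by exists t.
by exists (- p (- y)); exact: tilt_lbound.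
Qed.

Lemma le_tilt p x y a :
  (forall t, 0 <= t -> a <= p (y + t%:C *: x) - t * p x) -> a <= tilt p x y.
Proof.
move=> h; apply: lb_le_inf => [|_ [t /= t0 <-]]; last exact: h.
by exists (p (y + 0%:C *: x) - 0 * p x), 0 => /=.
Qed.

Lemma tilt_sublinear p x : sublinear p -> sublinear (tilt p x).
Proof.
move=> ps; split=> [y z|r y].
  rewrite -lerBlDr; apply: le_tilt => t t0.
  rewrite lerBlDr [leRHS]addrC -lerBlDr; apply: le_tilt => s s0.
  rewrite lerBlDr; apply: le_trans (tilt_le x (y + z) ps (addr_ge0 t0 s0)) _.
  have := ps.1 (y + t%:C *: x) (z + s%:C *: x).
  by rewrite addrACA -scalerDl -rmorphD; lra.
rewrite le_eqVlt => /predU1P[<-|r0].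
  rewrite scale0r mul0r.
  by apply: le_trans (tilt_le x 0 ps (lexx 0)) _;
    rewrite scale0r addr0 sublinear0 // mul0r subrr.
rewrite -ler_pdivrMl //; apply: le_tilt => t t0; rewrite ler_pdivrMl //.
apply: le_trans (tilt_le x _ ps (mulr_ge0 (ltW r0) t0)) _.
by rewrite rmorphM -scalerA -scalerDr sublinearZ ?(ltW r0) // mulrBr mulrA.
Qed.

Lemma tilt_le_self p x y : sublinear p -> tilt p x y <= p y.
Proof.
move=> ps; apply: le_trans (tilt_le x y ps (lexx 0)) _.
by rewrite scale0r addr0 mul0r subr0.
Qed.

Lemma tilt_opp p x : sublinear p -> tilt p x (- x) <= - p x.
Proof.
move=> ps; apply: le_trans (tilt_le x (- x) ps ler01) _.
by rewrite scale1r addNr sublinear0 // mul1r sub0r.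
Qed.

Lemma minimal_sublinear p : sublinear p ->
  exists q, [/\ sublinear q, forall x, q x <= p x &
    forall q', sublinear q' -> (forall x, q' x <= q x) -> q' = q].
Proof.
move=> ps; pose T := {q | sublinear q /\ forall x, q x <= p x}.
(* Zorn's lemma yields maximal elements, hence the reversed order. *)
pose le (q q' : T) := `[< forall x, sval q' x <= sval q x >].
have p0 : sublinear p /\ forall x, p x <= p x by [].
have [||||q qmin] := @Zorn T le.
- by move=> q; apply/asboolP => x.
- move=> q1 q2 q3 /asboolP h1 /asboolP h2; apply/asboolP => x.
  exact: le_trans (h2 x) (h1 x).
- move=> [q qP] [q' qP'] /asboolP h1 /asboolP h2; apply: eq_exist.
  by apply: funext => x; apply/eqP; rewrite eq_le h1 h2.
- move=> A Atot; have [[a Aa]|A0] := pselect (A !=set0); last first.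
    by exists (exist _ p p0) => q Aq; case: A0; exists q.
  pose E x := (fun q : T => sval q x) @` A.
  (* The infimum over the chain is finite, as q x >= - q (- x) >= - p (- x). *)
  pose m x := inf (E x).
  have Elb x : lbound (E x) (- p (- x)).
    move=> _ [[q [qs qp]] _ <-] /=.
    by have := sublinear_opp x qs; have := qp (- x); lra.
  have mle (q : T) x : A q -> m x <= sval q x.
    by move=> Aq; apply: ge_inf; [exists (- p (- x)); exact: Elb|exists q].
  have lem x c : (forall q : T, A q -> c <= sval q x) -> c <= m x.
    move=> h; apply: lb_le_inf => [|_ [q Aq <-]]; last exact: h.
    by exists (sval a x), a.
  have ms : sublinear m.
    split=> [x y|r x].
      rewrite -lerBlDr; apply: (lem) => q Aq.
      rewrite lerBlDr [leRHS]addrC -lerBlDr; apply: (lem) => q' Aq'.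
      rewrite lerBlDr [leRHS]addrC.
      (* Subadditivity needs one functional for both summands: the smaller of [q] and [q']. *)
      have [/asboolP h|/asboolP h] := Atot q q' Aq Aq'.
        apply: le_trans (mle _ _ Aq') _; apply: le_trans ((svalP q').1.1 _ _) _.
        by rewrite lerD2r.
      apply: le_trans (mle _ _ Aq) _; apply: le_trans ((svalP q).1.1 _ _) _.
      by rewrite lerD2l.
    rewrite le_eqVlt => /predU1P[<-|r0].
      apply: le_trans (mle _ _ Aa) _.
      by rewrite scale0r mul0r (sublinear0 (svalP a).1).
    rewrite -ler_pdivrMl //; apply: (lem) => q Aq; rewrite ler_pdivrMl //.
    apply: le_trans (mle _ _ Aq) _.
    by rewrite (sublinearZ _ (svalP q).1) // ltW.
  have mp : sublinear m /\ forall x, m x <= p x.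
    by split=> // x; apply: le_trans (mle _ _ Aa) _; case: a Aa => a [].
  by exists (exist _ m mp) => q Aq; apply/asboolP => x; exact: mle.
exists (sval q); split; [exact: (svalP q).1|exact: (svalP q).2|].
move=> q' q's q'q.
have q'P : sublinear q' /\ forall x, q' x <= p x.
  by split=> // x; apply: le_trans (q'q x) _; exact: (svalP q).2.
by have /(congr1 sval) := qmin (exist _ q' q'P) (introT (asboolP _) q'q).
Qed.

(* A minimal sublinear functional coincides with all its tilts, and this forces
   it to be odd. *)
Lemma hahn_banach p x0 : sublinear p ->
  exists f, [/\ forall x y, f (x + y) = f x + f y,
    forall r x, f (r%:C *: x) = r * f x,
    forall x, f x <= p x & f x0 = p x0].
Proof.
(* Minimality is taken below the tilt at [x0] and not below [p]: this gives f (- x0) <= - p x0,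
   hence f x0 = p x0. *)
move=> ps; have [f [fs fp fmin]] := minimal_sublinear (tilt_sublinear x0 ps).
have fN x : f (- x) = - f x.
  apply/eqP; rewrite eq_le; apply/andP; split; last first.
    by have := sublinear_opp x fs; lra.
  rewrite -{1}(fmin _ (tilt_sublinear x fs)) ?tilt_opp // => y.
  exact: tilt_le_self.
exists f; split.
- move=> x y; apply/eqP; rewrite eq_le fs.1 /=.
  by have := fs.1 (- x) (- y); rewrite -opprD !fN; lra.
- move=> r x; case: (leP 0 r) => [r0|/ltW r0]; first exact: sublinearZ.
  apply: oppr_inj; rewrite -fN -scaleNr -rmorphN sublinearZ ?oppr_ge0 //.
  by rewrite mulNr.
- by move=> x; apply: le_trans (fp x) _; exact: tilt_le_self.
- apply/eqP; rewrite eq_le (le_trans (fp x0)) ?tilt_le_self //=.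
  by have := le_trans (fp (- x0)) (tilt_opp x0 ps); rewrite fN; lra.
Qed.

End HahnBanach.

(** * States attaining the norm *)

Section States.
Context (R : realType) (B : cstarType R).
Implicit Types (x y a : B) (t : R).

Definition re_part x : B := (2^-1)%:C *: (x + star x).

Lemma re_part_star x : star (re_part x) = re_part x.
Proof. by rewrite starZr starD starK addrC. Qed.

Lemma re_part_self x : star x = x -> re_part x = x.
Proof.
move=> xS; rewrite /re_part xS -mulr2n -scaler_nat scalerA fmorphV rmorph_nat.
by rewrite mulVf ?pnatr_eq0 // scale1r.
Qed.

Lemma re_partD x y : re_part (x + y) = re_part x + re_part y.
Proof. by rewrite /re_part starD addrACA scalerDr. Qed.

Lemma re_partZ t x : re_part (t%:C *: x) = t%:C *: re_part x.
Proof. by rewrite /re_part starZr -scalerDr !scalerA mulrC. Qed.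

Lemma cpos_scalar_ge0 t : cpos (t%:C%:A : B) -> 0 <= t.
Proof.
move=> tp; case: (leP 0 t) => // t0.
have : (t%:C%:A : B) = 0.
  apply: cpos_antisym => //; rewrite -scaleNr -rmorphN.
  by apply: cpos_scalar; rewrite oppr_ge0 ltW.
by move=> /(congr1 (@vnorm R B)); rewrite vnorm_scalar vnorm0
  => /normr0_eq0 t_0; rewrite t_0 ltxx in t0.
Qed.

(** The largest spectral value of the real part. A real linear functional below it kills skew
    elements, is nonnegative on the cone and takes the value 1 at 1. *)
Definition majorant x := inf [set t | cpos (t%:C%:A - re_part x)].

Lemma majorant_lbound x :
  lbound [set t | cpos (t%:C%:A - re_part x)] (- vnorm (re_part x)).
Proof.
move=> t /= tp; rewrite -subr_ge0 opprK; apply: cpos_scalar_ge0.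
have np : cpos ((vnorm (re_part x))%:C%:A + re_part x).
  rewrite -[X in _ + X]opprK; apply: cpos_scalar_sub; rewrite ?vnormN //.
  by rewrite starN re_part_star.
by have := cposD tp np; rewrite addrC addrACA subrr addr0 -scalerDl -rmorphD
  addrC.
Qed.

Lemma majorant_le x t : cpos (t%:C%:A - re_part x) -> majorant x <= t.
Proof.
move=> tp; apply: ge_inf => //.
by exists (- vnorm (re_part x)); exact: majorant_lbound.
Qed.

Lemma le_majorant x s :
  (forall t, cpos (t%:C%:A - re_part x) -> s <= t) -> s <= majorant x.
Proof.
move=> h; apply: lb_le_inf => [|t /h //].
exists (vnorm (re_part x)) => /=; apply: cpos_scalar_sub => //.
exact: re_part_star.
Qed.

Lemma majorant_sublinear : sublinear majorant.
Proof.
split=> [x y|r x].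
  rewrite -lerBlDr; apply: le_majorant => t tp.
  rewrite lerBlDr [leRHS]addrC -lerBlDr; apply: le_majorant => s sp.
  rewrite lerBlDr; apply: majorant_le.
  rewrite re_partD rmorphD scalerDl opprD addrC [- _ - _]addrC.
  have := cposD tp sp; rewrite addrACA addrC.
  by rewrite [s%:C%:A + _]addrC [- re_part y - _]addrC.
rewrite le_eqVlt => /predU1P[<-|r0].
  rewrite mul0r; apply: majorant_le.
  by rewrite re_partZ !scale0r subr0; exact: cpos0.
rewrite -ler_pdivrMl //; apply: le_majorant => t tp.
rewrite ler_pdivrMl //; apply: majorant_le.
by rewrite re_partZ rmorphM -scalerA -scalerBr; apply: cposZ => //; exact: ltW.
Qed.

(** Hahn-Banach provides a real functional below [majorant] and equal to it at h = a^* a, where it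
    is |h| = |a|^2; its complexification is the state. *)
Lemma exists_state a : exists F : B -> R[i], [/\ scalar F,
  forall x, F (star x) = Num.conj (F x), forall x, cpos x -> 0 <= F x,
  F 1 = 1 & F (star a * a) = (vnorm a ^+ 2)%:C].
Proof.
set h := star a * a.
have hS : star h = h by rewrite starM starK.
have [f [fD fZ fp fh]] := hahn_banach h majorant_sublinear.
have fN x : f (- x) = - f x.
  by rewrite -scaleN1r -(rmorphN1 (real_complex R)) fZ mulN1r.
have f0 x : re_part x = 0 -> f x = 0.
  move=> x0; have E y : re_part y = 0 -> f y <= 0.
    move=> y0; apply: le_trans (fp y) _; apply: majorant_le.
    by rewrite y0 scale0r subr0; exact: cpos0.
  apply/eqP; rewrite eq_le E //= -oppr_le0 -fN E //.
  by rewrite -scaleN1r -(rmorphN1 (real_complex R)) re_partZ x0 scaler0.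
have iE (c : R[i]) : c = (complex.Re c)%:C + 'i%C * (complex.Im c)%:C.
  exact: complexE.
have fis x : star x = x -> f ('i%C *: x) = 0.
  move=> xS; apply: f0; rewrite /re_part starZ xS conj_i scaleNr subrr.
  by rewrite scaler0.
have fstar x : f (star x) = f x.
  apply/eqP; rewrite -subr_eq0 -fN -fD f0 //.
  by rewrite /re_part starB starK addrC addrA subrK subrr scaler0.
(* The usual complexification f x - i f (i x); it is real on selfadjoint elements because [f] kills
   skew ones. *)
pose F x := (f x) -i* (f ('i%C *: x)).
have Fh x : star x = x -> F x = (f x)%:C.
  by move=> xS; rewrite /F fis // oppr0.
exists F; split.
- move=> c x y; rewrite /F.
  have fc z : f (c *: z) = complex.Re c * f z + complex.Im c * f ('i%C *: z).
    by rewrite {1}[c]iE scalerDl ['i%C * _]mulrC -scalerA fD !fZ.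
  rewrite scalerDr scalerA mulrC -scalerA !fD !fc scalerA -expr2 sqr_i scaleN1r
    fN.
  by case: c {fc} => r s /=; apply/eqP; rewrite eq_complex /=; apply/andP;
    split; apply/eqP; ring.
- move=> x; rewrite /F fstar -[f ('i%C *: x)]fstar starZ conj_i scaleNr fN.
  by apply/eqP; rewrite eq_complex /= !opprK !eqxx.
- move=> x xp; rewrite Fh; last by case: xp.
  rewrite ler0c -oppr_le0 -fN; apply: le_trans (fp _) _; apply: majorant_le.
  by rewrite re_part_self ?starN ?xp.1 // scale0r sub0r opprK.
- rewrite Fh ?star1 //; congr (_%:C); apply/eqP; rewrite eq_le.
  apply/andP; split.
    apply: le_trans (fp _) _; apply: majorant_le.
    by rewrite re_part_self ?star1 // scale1r subrr; exact: cpos0.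
  rewrite -lerN2 -fN; apply: le_trans (fp _) _; apply: majorant_le.
  by rewrite re_part_self ?starN ?star1 // rmorphN1 scaleN1r subrr;
    exact: cpos0.
- rewrite Fh // -vnorm_starM -/h fh; congr (_%:C); apply/eqP; rewrite eq_le.
  apply/andP; split.
    by apply: majorant_le; rewrite re_part_self //; exact: cpos_scalar_sub.
  apply: le_majorant => t; rewrite re_part_self // => tp.
  apply: vnorm_le_scalar => //; last exact: cpos_star_mul.
  apply: cpos_scalar_ge0; rewrite -(subrK h t%:C%:A).
  by apply: cposD => //; exact: cpos_star_mul.
Qed.

End States.

Lemma invSn_small (R : realType) (e : R) : 0 < e ->
  exists N, forall n, (N <= n)%N -> n.+1%:R^-1 < e.
Proof.
move=> e0; exists (Num.bound e^-1) => n Nn.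
rewrite invf_plt ?posrE //; apply: lt_le_trans (archi_boundP _) _.
  by rewrite invr_ge0 ltW.
by rewrite ler_nat ltnW.
Qed.

(** * Extension of bounded maps from a dense image *)

Section Extension.
Context (R : realType) (V : lmodType R[i]) (X W : banachType R).
Context (eta : V -> X) (T : V -> W) (M : R).
Hypotheses (eta_linear : linear eta) (T_linear : linear T).
Hypothesis eta_dense : forall x e, 0 < e -> exists v, vnorm (x - eta v) < e.
Hypotheses (M0 : 0 <= M) (T_bounded : forall v, vnorm (T v) <= M * vnorm (eta
  v)).

Let M1 : 0 < 2 * (M + 1). Proof. by move: M0; lra. Qed.

Let T_lipschitz v w : vnorm (T v - T w) <= M * vnorm (eta v - eta w).
Proof. by rewrite -(linB T_linear) -(linB eta_linear). Qed.

(** Characterizes the value of the extension at [x] by inequalities instead of a sequence: values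
    exist by completeness and are unique by density, and linearity follows from uniqueness. *)
Let extends x w := forall v, vnorm (w - T v) <= M * vnorm (x - eta v).

Let extends_exists x : exists w, extends x w.
Proof.
have /choice[v hv] : forall n : nat, exists v, vnorm (x - eta v) < n.+1%:R^-1.
  by move=> n; apply: eta_dense; rewrite invr_gt0 ltr0Sn.
have [|w hw] := @vnorm_complete R W (T \o v).
  move=> e e0; have d0 : 0 < e / (2 * (M + 1)) by rewrite divr_gt0.
  have [N hN] := invSn_small d0; exists N => m n /hN hm /hN hn /=.
  apply: le_lt_trans (T_lipschitz _ _) _.
  have := ler_wpM2l M0 (vdist_triangle x (eta (v m)) (eta (v n))).
  rewrite [vnorm (eta _ - x)]vdistC.
  have := lt_trans (hv m) hm; have := lt_trans (hv n) hn.
  rewrite !ltr_pdivlMr //.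
  move: (vnorm_ge0 (x - eta (v m))) (vnorm_ge0 (x - eta (v n))); lra.
exists w => y; apply/ler_addgt0Pr => e e0.
have d0 : 0 < e / (2 * (M + 1)) by rewrite divr_gt0.
have [N hN] := invSn_small d0; have [|N' hN'] := hw (e / 2); first by lra.
pose n := maxn N N'; have := hN' n (leq_maxr _ _).
have : vnorm (x - eta (v n)) * (2 * (M + 1)) < e.
  by rewrite -ltr_pdivlMr //; apply: lt_trans (hv n) (hN n (leq_maxl _ _)).
rewrite /=.
have := T_lipschitz (v n) y.
have := vdist_triangle (T (v n)) w (T y).
have := ler_wpM2l M0 (vdist_triangle x (eta (v n)) (eta y)).
rewrite [vnorm (eta _ - x)]vdistC [vnorm (w - T (v n))]vdistC.
move: (vnorm_ge0 (x - eta (v n))); lra.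
Qed.

Let extends_unique x w w' : extends x w -> extends x w' -> w = w'.
Proof.
move=> h h'; apply/eqP; rewrite -subr_eq0; apply/eqP/vnorm_small => e e0.
have d0 : 0 < e / (2 * (M + 1)) by rewrite divr_gt0.
have [v hv] := eta_dense x d0; move: (h v) (h' v) hv.
rewrite ltr_pdivlMr //.
have := vdist_triangle (T v) w w'; rewrite [vnorm (T v - _)]vdistC.
move: (vnorm_ge0 (x - eta v)); lra.
Qed.

Lemma bounded_extension : exists S : X -> W, [/\ linear S,
  forall v, S (eta v) = T v & forall x, vnorm (S x) <= M * vnorm x].
Proof.
have /choice[S hS] := extends_exists.
exists S; split.
- move=> c x y; apply: (extends_unique (hS _)) => v.
  apply/ler_addgt0Pr => e e0.
  pose k := complex.Re `|c|; have kE : k%:C = `|c| by rewrite /k normc_def.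
  have k0 : 0 <= k by rewrite -ler0c kE.
  (* With [a] and [b] the distances of [x] and [y] to [eta v1] and [eta v2], the error is at most 2
     M (k a + b), which this denominator brings below [e]. *)
  have k1 : 0 < 4 * (M + 1) * (k + 1).
    by apply: mulr_gt0; last lra; move: M1; lra.
  have d0 : 0 < e / (4 * (M + 1) * (k + 1)) by exact: divr_gt0.
  have [v1 h1] := eta_dense x d0; have [v2 h2] := eta_dense y d0.
  have vk (U : banachType R) (z : U) : vnorm (c *: z) = k * vnorm z.
    by apply: complexI; rewrite vnormZ -kE -rmorphM.
  have -> : c *: S x + S y - T v
      = (c *: (S x - T v1) + (S y - T v2)) + (T (c *: v1 + v2) - T v).
    by rewrite T_linear scalerBr [X in _ = X + _]addrACA -opprD addrA subrK.
  have := vnormD (c *: (S x - T v1) + (S y - T v2)) (T (c *: v1 + v2) - T v).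
  have := vnormD (c *: (S x - T v1)) (S y - T v2); rewrite vk.
  have := T_lipschitz (c *: v1 + v2) v.
  have := ler_wpM2l k0 (hS x v1); have := hS y v2.
  have := ler_wpM2l M0 (vdist_triangle (c *: x + y) (eta (c *: v1 + v2)) (eta
    v)).
  have : vnorm (eta (c *: v1 + v2) - (c *: x + y))
      <= k * vnorm (x - eta v1) + vnorm (y - eta v2).
    rewrite vdistC eta_linear opprD addrACA -scalerBr.
    by apply: le_trans (vnormD _ _) _; rewrite vk.
  move=> /(ler_wpM2l M0).
  have {}h1 : vnorm (x - eta v1) * (4 * (M + 1) * (k + 1)) < e.
    by rewrite -ltr_pdivlMr.
  have {}h2 : vnorm (y - eta v2) * (4 * (M + 1) * (k + 1)) < e.
    by rewrite -ltr_pdivlMr.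
  move: (vnorm_ge0 (x - eta v1)) (vnorm_ge0 (y - eta v2)) h1 h2.
  set a := vnorm (x - _); set b := vnorm (y - _) => a0 b0 h1 h2.
  have := mulr_ge0 k0 a0; have := mulr_ge0 M0 a0; have := mulr_ge0 M0 b0.
  have := mulr_ge0 k0 b0; have := mulr_ge0 M0 (mulr_ge0 k0 b0); lra.
- by move=> v; apply/eqP; rewrite -subr_eq0; apply/eqP/vnorm0_eq0/eqP;
  rewrite eq_le vnorm_ge0 andbT (le_trans (hS _ v)) // subrr vnorm0 mulr0.
- by move=> x; have := hS x 0; rewrite (lin0 T_linear) (lin0 eta_linear) !subr0.
Qed.

End Extension.

(** * The complex modulus and completeness of the complex numbers *)

Section ComplexModulus.
Context (R : realType).
Implicit Types (z w : R[i]).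

(** The norm of [R[i]] takes values in [R[i]]; here the modulus is a real number, comparable with
    [vnorm]. *)
Definition modc z : R := complex.Re `|z|.

Lemma modcE z : (modc z)%:C = `|z|.
Proof. by rewrite /modc normc_def. Qed.

Lemma modc_ge0 z : 0 <= modc z.
Proof. by rewrite -ler0c modcE. Qed.

Lemma modcM z w : modc (z * w) = modc z * modc w.
Proof. by apply: complexI; rewrite rmorphM /= !modcE normrM. Qed.

Lemma modcN z : modc (- z) = modc z.
Proof. by rewrite /modc normrN. Qed.

Lemma modc0 : modc 0 = 0.
Proof. by rewrite /modc normr0. Qed.

Lemma modc1 : modc 1 = 1.
Proof. by rewrite /modc normr1. Qed.

Lemma modc_i : modc ('i%C : R[i]) = 1.
Proof. by rewrite /modc normc_def /= expr0n add0r expr1n sqrtr1. Qed.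

Lemma modcD z w : modc (z + w) <= modc z + modc w.
Proof. by rewrite -lecR rmorphD /= !modcE ler_normD. Qed.

Lemma modcB z w : modc (z - w) = modc (w - z).
Proof. by rewrite -modcN opprB. Qed.

Lemma modc_eq0 z : modc z = 0 -> z = 0.
Proof. by move=> h; apply/eqP; rewrite -normr_eq0 -modcE h. Qed.

Lemma modc_real (r : R) : modc r%:C = `|r|.
Proof. by rewrite /modc normc_def /= expr0n addr0 sqrtr_sqr. Qed.

Lemma Re_le_modc z : `|complex.Re z| <= modc z.
Proof.
by rewrite /modc normc_def /= -sqrtr_sqr ler_wsqrtr // lerDl sqr_ge0.
Qed.

Lemma Im_le_modc z : `|complex.Im z| <= modc z.
Proof.
by rewrite /modc normc_def /= -sqrtr_sqr ler_wsqrtr // lerDr sqr_ge0.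
Qed.

Lemma modc_le z : modc z <= `|complex.Re z| + `|complex.Im z|.
Proof.
rewrite {1}[z]complexE; apply: le_trans (modcD _ _) _; rewrite modcM !modc_real.
by rewrite /modc normc_def /= expr0n add0r expr1n sqrtr1 mul1r.
Qed.

Lemma modc_small z : (forall e, 0 < e -> modc z <= e) -> z = 0.
Proof.
move=> h; apply: modc_eq0; apply/eqP; rewrite eq_le modc_ge0 andbT.
by apply/ler_addgt0Pr => e e0; rewrite add0r h.
Qed.

Lemma vnormZc (V : banachType R) c (x : V) : vnorm (c *: x) = modc c * vnorm x.
Proof. by apply: complexI; rewrite vnormZ rmorphM /= modcE. Qed.

(** The limit is obtained as the limit inferior, the supremum of the eventual lower bounds. *)
Lemma real_cauchy (u : nat -> R) :
  (forall e, 0 < e -> exists N, forall m n, (N <= m)%N -> (N <= n)%N ->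
     `|u m - u n| < e) ->
  exists l, forall e, 0 < e -> exists N, forall n, (N <= n)%N -> `|u n - l| < e.
Proof.
move=> hu.
pose S := [set x | exists N, forall n, (N <= n)%N -> x <= u n].
have Slb e N : (forall m n, (N <= m)%N -> (N <= n)%N -> `|u m - u n| < e) ->
    S (u N - e).
  move=> h; exists N => n Nn; have := h _ _ (leqnn N) Nn.
  by rewrite ltr_norml => /andP[_]; lra.
have Sub e N : (forall m n, (N <= m)%N -> (N <= n)%N -> `|u m - u n| < e) ->
    ubound S (u N + e).
  move=> h x [M hM]; have := h _ _ (leqnn N) (leq_maxl N M).
  by have := hM _ (leq_maxr N M); rewrite ltr_norml => ? /andP[? _]; lra.
have S0 : has_sup S.
  have [N hN] := hu 1 ltr01.
  by split; [exists (u N - 1); exact: Slb|exists (u N + 1); exact: Sub].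
exists (sup S) => e e0; have [|N hN] := hu (e / 2); first lra.
exists N => n Nn; have := hN _ _ (leqnn N) Nn.
have : u N - e / 2 <= sup S by apply: ub_le_sup; [exact: S0.2|exact: Slb].
have : sup S <= u N + e / 2 by apply: ge_sup; [exact: S0.1|exact: Sub].
by rewrite !ltr_norml => ? ? /andP[? ?]; apply/andP; split; lra.
Qed.

Lemma complex_cauchy (u : nat -> R[i]) :
  (forall e, 0 < e -> exists N, forall m n, (N <= m)%N -> (N <= n)%N ->
     modc (u m - u n) < e) ->
  exists l, forall e, 0 < e -> exists N, forall n, (N <= n)%N ->
    modc (u n - l) < e.
Proof.
move=> hu.
have ReB z w : complex.Re (z - w) = complex.Re z - complex.Re w :> R by case: z
  w => [? ?] [? ?].
have ImB z w : complex.Im (z - w) = complex.Im z - complex.Im w :> R by case: z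
  w => [? ?] [? ?].
have [|a ha] := @real_cauchy (fun n => complex.Re (u n)).
  move=> e /hu[N hN]; exists N => m n Nm Nn.
  by rewrite -ReB; apply: le_lt_trans (Re_le_modc _) _; exact: hN.
have [|b hb] := @real_cauchy (fun n => complex.Im (u n)).
  move=> e /hu[N hN]; exists N => m n Nm Nn.
  by rewrite -ImB; apply: le_lt_trans (Im_le_modc _) _; exact: hN.
exists (a +i* b) => e e0; have e20 : 0 < e / 2 by lra.
have [N hN] := ha _ e20; have [M hM] := hb _ e20.
exists (maxn N M) => n; rewrite geq_max => /andP[/hN h1 /hM h2].
apply: le_lt_trans (modc_le _) _; rewrite ReB ImB /=; lra.
Qed.

End ComplexModulus.

(** * Semi-inner products and the Cauchy-Schwarz inequality *)

Record semiInner (R : realType) (V : lmodType R[i]) := SemiInner {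
  sip :> V -> V -> R[i];
  sip_scalar : forall y, scalar (sip^~ y);
  sip_conj : forall x y, sip y x = Num.conj (sip x y);
  sip_ge0 : forall x, 0 <= sip x x }.

Section SemiInnerTheory.
Context (R : realType) (V : lmodType R[i]) (d : semiInner V).
Implicit Types x y z : V.

Lemma sipDl x y z : d (x + y) z = d x z + d y z.
Proof. exact: (linD (@sip_scalar _ _ d z)). Qed.
Lemma sipZl c x z : d (c *: x) z = c * d x z.
Proof. exact: (linZ (@sip_scalar _ _ d z)). Qed.
Lemma sip0l z : d 0 z = 0.
Proof. exact: (lin0 (@sip_scalar _ _ d z)). Qed.
Lemma sipBl x y z : d (x - y) z = d x z - d y z.
Proof. exact: (linB (@sip_scalar _ _ d z)). Qed.
Lemma sipDr x y z : d z (x + y) = d z x + d z y.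
Proof. by rewrite !(sip_conj d _ z) sipDl rmorphD. Qed.
Lemma sipBr x y z : d z (x - y) = d z x - d z y.
Proof. by rewrite !(sip_conj d _ z) sipBl rmorphB. Qed.
Lemma sipZr c x z : d z (c *: x) = Num.conj c * d z x.
Proof. by rewrite !(sip_conj d _ z) sipZl rmorphM. Qed.

Definition sipn x : R := Num.sqrt (complex.Re (d x x)).

Lemma sipn_ge0 x : 0 <= sipn x. Proof. exact: sqrtr_ge0. Qed.

Lemma sipn_sqr x : (sipn x ^+ 2)%:C = d x x.
Proof.
have h := sip_ge0 d x; have := h; rewrite lecE /= => /andP[/eqP im re].
by rewrite sqr_sqrtr // [RHS]complexE im mulr0 addr0.
Qed.

Lemma sip_cauchy_schwarz x y : modc (d x y) <= sipn x * sipn y.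
Proof.
set z := d x y; set m := modc z ^+ 2.
have zz : Num.conj z * z = m%:C.
  by rewrite mulrC -normCK -modcE -rmorphXn.
(* The squared norm of x - s z y for real [s]; the factor [z] makes the linear term real. *)
have key (s : R) : 0 <= sipn x ^+ 2 - (s + s) * m + s ^+ 2 * m * sipn y ^+ 2.
  have cs : Num.conj (s%:C * z) = s%:C * Num.conj z.
    by rewrite rmorphM; congr (_ * _); exact: conjc_real.
  have := sip_ge0 d (x - (s%:C * z) *: y).
  rewrite !(sipBl, sipBr, sipZl, sipZr) -!sipn_sqr (sip_conj d x y) -/z cs.
  have -> : (sipn x ^+ 2)%:C - s%:C * Num.conj z * z
     - (s%:C * z * Num.conj z - s%:C * z * (s%:C * Num.conj z * (sipn y ^+
       2)%:C))
    = (sipn x ^+ 2)%:C - (s%:C + s%:C) * (Num.conj z * z)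
      + s%:C ^+ 2 * (Num.conj z * z) * (sipn y ^+ 2)%:C by ring.
  rewrite zz => h.
  rewrite -ler0c; apply: le_trans h _; rewrite le_eqVlt; apply/orP; left.
  by apply/eqP; rewrite !(rmorphD, rmorphB, rmorphM, rmorphXn, rmorphN).
rewrite -ler_sqr ?nnegrE ?modc_ge0 ?mulr_ge0 ?sipn_ge0 // -/m exprMn.
have [y0|y0] := eqVneq (sipn y) 0.
  rewrite y0 expr0n mulr0; case: (leP m 0) => // m0.
  (* When [y] is a null vector the quadratic takes the value -1 at this [s], so [m] cannot be
     positive. *)
  have := key ((sipn x ^+ 2 + 1) / (2 * m)).
  rewrite y0 expr0n mulr0 addr0.
  have -> : ((sipn x ^+ 2 + 1) / (2 * m) + (sipn x ^+ 2 + 1) / (2 * m)) * m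
      = sipn x ^+ 2 + 1 by field; rewrite gt_eqF.
  lra.
have y1 : 0 < sipn y ^+ 2 by rewrite exprn_gt0 // lt_def y0 sipn_ge0.
(* The minimizer of the quadratic. *)
have := key (sipn y ^- 2).
have -> : sipn x ^+ 2 - (sipn y ^- 2 + sipn y ^- 2) * m + (sipn y ^- 2) ^+ 2 *
  m * sipn y ^+ 2
   = (sipn x ^+ 2 * sipn y ^+ 2 - m) / sipn y ^+ 2 by field.
by rewrite pmulr_lge0 ?invr_gt0 // subr_ge0.
Qed.

End SemiInnerTheory.

(* The completion of a semi-inner product space [V] is realized as the closure
   of the functionals [d x] in the bounded functions on [V]. *)
Section Completion.
Context (R : realType) (V : lmodType R[i]) (d : semiInner V).
Implicit Types (x y : V).

Definition approximable : {pred V -> R[i]^o} := fun g =>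
  `[< forall e : R, 0 < e ->
      exists x, forall y, modc (g y - d x y) <= e * sipn d y >].

Lemma approximable_submod : submod_closed approximable.
Proof.
split=> [|c g h /asboolP hg /asboolP hh].
  apply/asboolP => e e0; exists 0 => y.
  by rewrite sip0l subr0 modc0 mulr_ge0 ?sipn_ge0 ?ltW.
apply/asboolP => e e0.
have c0 := modc_ge0 c.
have e1 : 0 < e / (2 * (modc c + 1)) by apply: divr_gt0 => //; lra.
have [x hx] := hg _ e1; have [|z hz] := hh (e / 2); first lra.
exists (c *: x + z) => y; rewrite sipDl sipZl.
have -> : (c *: g + h) y - (c * d x y + d z y)
    = c * (g y - d x y) + (h y - d z y).
  by rewrite mulrBr opprD addrACA.
apply: le_trans (modcD _ _) _; rewrite modcM.
have := ler_wpM2l c0 (hx y); have := hz y; have := sipn_ge0 d y.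
have : modc c * (e / (2 * (modc c + 1)) * sipn d y) <= e / 2 * sipn d y.
  rewrite mulrA ler_wpM2r ?sipn_ge0 // mulrCA ler_pM2l //.
  by rewrite ler_pdivrMr; lra.
lra.
Qed.

HB.instance Definition _ :=
  GRing.isSubmodClosed.Build R[i] (V -> R[i]^o) approximable
    approximable_submod.

Record completion := Completion {
  cval :> V -> R[i]^o;
  cvalP : cval \in approximable }.

HB.instance Definition _ := [isSub for cval].
HB.instance Definition _ := [Choice of completion by <:].
HB.instance Definition _ := [SubChoice_isSubLmodule of completion by <:].

Implicit Types g h : completion.

Definition cnorm g : R :=
  inf [set M | 0 <= M /\ forall y, modc (g y) <= M * sipn d y].

Lemma completionP g e : 0 < e ->
  exists x, forall y, modc (g y - d x y) <= e * sipn d y.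
Proof. by move: e; exact/asboolP/cvalP. Qed.

Lemma cvalD g h y : (g + h) y = g y + h y. Proof. by []. Qed.
Lemma cvalB g h y : (g - h) y = g y - h y. Proof. by []. Qed.
Lemma cvalZ c g y : (c *: g) y = c * g y. Proof. by []. Qed.

Lemma cnorm_has_inf g :
  has_inf [set M | 0 <= M /\ forall y, modc (g y) <= M * sipn d y].
Proof.
split; last by exists 0 => M [].
have [x hx] := completionP g ltr01.
exists (sipn d x + 1); split=> [|y]; first by rewrite addr_ge0 ?sipn_ge0.
rewrite -[g y](subrK (d x y)); apply: le_trans (modcD _ _) _.
have := hx y; have := sip_cauchy_schwarz d x y; lra.
Qed.

Lemma cnorm_ge0 g : 0 <= cnorm g.
Proof.
by apply: lb_le_inf => [|M []//]; exact: (cnorm_has_inf g).1.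
Qed.

Lemma modc_le_cnorm g y : modc (g y) <= cnorm g * sipn d y.
Proof.
have [y0|y0] := eqVneq (sipn d y) 0.
  have [[M [_ hM]] _] := cnorm_has_inf g.
  by have := hM y; rewrite y0 !mulr0.
have y1 : 0 < sipn d y by rewrite lt_def y0 sipn_ge0.
rewrite -ler_pdivrMr //; apply: lb_le_inf; first exact: (cnorm_has_inf g).1.
by move=> M [_ hM]; rewrite ler_pdivrMr.
Qed.

Lemma cnorm_le g M : 0 <= M -> (forall y, modc (g y) <= M * sipn d y) ->
  cnorm g <= M.
Proof. by move=> M0 hM; apply: ge_inf => //; exact: (cnorm_has_inf g).2. Qed.

Lemma cnormD g h : cnorm (g + h) <= cnorm g + cnorm h.
Proof.
apply: cnorm_le => [|y]; first by rewrite addr_ge0 ?cnorm_ge0.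
rewrite cvalD mulrDl; apply: le_trans (modcD _ _) _.
by apply: lerD; exact: modc_le_cnorm.
Qed.

Lemma cnormZ_le c g : cnorm (c *: g) <= modc c * cnorm g.
Proof.
apply: cnorm_le => [|y]; first by rewrite mulr_ge0 ?cnorm_ge0 ?modc_ge0.
by rewrite cvalZ modcM -mulrA ler_wpM2l ?modc_ge0 // modc_le_cnorm.
Qed.

Lemma cnormZ c g : (cnorm (c *: g))%:C = `|c| * (cnorm g)%:C.
Proof.
rewrite -modcE -rmorphM; congr (_%:C); apply/eqP; rewrite eq_le cnormZ_le /=.
have [->|c0] := eqVneq c 0; first by rewrite modc0 mul0r cnorm_ge0.
have mc : 0 < modc c.
  by rewrite lt_def modc_ge0 andbT; apply: contra c0 => /eqP/modc_eq0 ->.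
have := cnormZ_le c^-1 (c *: g); rewrite scalerA mulVf // scale1r.
have -> : modc c^-1 = (modc c)^-1.
  by apply: (mulfI (lt0r_neq0 mc)); rewrite -modcM mulfV // modc1 mulfV //
    lt0r_neq0.
by rewrite ler_pdivlMl.
Qed.

Lemma cnorm0_eq0 g : cnorm g = 0 -> g = 0.
Proof.
move=> g0; apply: val_inj; apply: funext => y /=.
apply: modc_eq0; apply/eqP; rewrite eq_le modc_ge0 andbT.
by have := modc_le_cnorm g y; rewrite g0 mul0r.
Qed.

(** Limits are taken pointwise. The Cauchy estimates are uniform in [y] relative to its seminorm, so
    they survive in the limit, which is therefore approximable. *)
Lemma cnorm_complete (u : nat -> completion) :
  (forall e : R, 0 < e -> exists N, forall m n, (N <= m)%N -> (N <= n)%N ->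
     cnorm (u m - u n) < e) ->
  exists l, forall e : R, 0 < e -> exists N, forall n, (N <= n)%N ->
     cnorm (u n - l) < e.
Proof.
move=> hu.
have ucauchy e : 0 < e -> exists N, forall m n, (N <= m)%N -> (N <= n)%N ->
    forall y, modc (u m y - u n y) <= e * sipn d y.
  move=> /hu[N hN]; exists N => m n Nm Nn y; rewrite -cvalB.
  apply: le_trans (modc_le_cnorm _ _) _.
  by rewrite ler_wpM2r ?sipn_ge0 // ltW // hN.
have /choice[l hl] : forall y, exists z, forall e : R, 0 < e ->
    exists N, forall n, (N <= n)%N -> modc (u n y - z) < e.
  move=> y; apply: complex_cauchy => e e0.
  have y0 := sipn_ge0 d y.
  have [|N hN] := ucauchy (e / (sipn d y + 1)); first by apply: divr_gt0 => //;
    lra.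
  exists N => m n Nm Nn; apply: le_lt_trans (hN _ _ Nm Nn y) _.
  rewrite mulrAC ltr_pdivrMr; last lra.
  by rewrite ltr_pM2l //; lra.
have ul e : 0 < e -> exists N, forall n, (N <= n)%N ->
    forall y, modc (u n y - l y) <= e * sipn d y.
  move=> /ucauchy[N hN]; exists N => n Nn y; apply/ler_addgt0Pr => t t0.
  have [M hM] := hl y t t0.
  rewrite -(subrKA (u (maxn N M) y)); apply: le_trans (modcD _ _) _.
  apply: lerD; last exact/ltW/hM/leq_maxr.
  exact/hN/leq_maxl.
have lP : (l : V -> R[i]^o) \in approximable.
  apply/asboolP => e e0; have e20 : 0 < e / 2 by lra.
  have [N /(_ N (leqnn N)) hN] := ul _ e20.
  have [x hx] := completionP (u N) e20.
  exists x => y; rewrite -(subrKA (u N y)); apply: le_trans (modcD _ _) _.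
  by rewrite modcB; have := hN y; have := hx y; lra.
exists (Completion lP) => e e0; have e20 : 0 < e / 2 by lra.
have [N hN] := ul _ e20; exists N => n Nn.
apply: (@le_lt_trans _ _ (e / 2)); last lra.
by apply: cnorm_le => [|y]; [lra|exact: hN].
Qed.

HB.instance Definition _ := Lmodule_isBanach.Build R completion
  cnormD cnormZ cnorm0_eq0 cnorm_complete.

Lemma sip_approximable x : (d x : V -> R[i]^o) \in approximable.
Proof.
apply/asboolP => e e0; exists x => y.
by rewrite subrr modc0 mulr_ge0 ?sipn_ge0 ?ltW.
Qed.

(** The free argument of [d x] is the conjugate-linear one, so that [ceta] is linear. By
    Cauchy-Schwarz null vectors are sent to 0, which makes the quotient by them implicit. *)
Definition ceta x : completion := Completion (sip_approximable x).

Lemma ceta_linear : linear ceta.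
Proof.
move=> c x y; apply: val_inj; apply: funext => z /=.
by rewrite sipDl sipZl.
Qed.

Lemma vnorm_ceta x : vnorm (ceta x) = sipn d x.
Proof.
apply/eqP; rewrite eq_le; apply/andP; split.
  by apply: cnorm_le => [|y]; [exact: sipn_ge0|exact: sip_cauchy_schwarz].
have [x0|x0] := eqVneq (sipn d x) 0; first by rewrite x0 vnorm_ge0.
have x1 : 0 < sipn d x by rewrite lt_def x0 sipn_ge0.
have := modc_le_cnorm (ceta x) x; rewrite /= -sipn_sqr modc_real.
by rewrite ger0_norm ?sqr_ge0 // expr2 ler_pM2r.
Qed.

Lemma ceta_dense g e : 0 < e -> exists x, vnorm (g - ceta x) < e.
Proof.
move=> e0; have e20 : 0 < e / 2 by lra.
have [x hx] := completionP g e20; exists x.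
apply: (@le_lt_trans _ _ (e / 2)); last lra.
by apply: cnorm_le => [|y]; [lra|exact: hx].
Qed.

(** The polarization identity. As it refers to the norm alone, conjugate symmetry and the relation
    to the norm are identities between norms; linearity in the first argument is obtained from the
    image of [V] by density and continuity. *)
Definition cdot g h : R[i] :=
  ((vnorm (g + h) ^+ 2 - vnorm (g - h) ^+ 2) / 4)
  +i* ((vnorm (g + 'i%C *: h) ^+ 2 - vnorm (g - 'i%C *: h) ^+ 2) / 4).

Lemma cdot_ceta x y : cdot (ceta x) (ceta y) = d x y.
Proof.
rewrite /cdot -!(linZ ceta_linear) -!(linD ceta_linear) -!(linB ceta_linear).
rewrite !vnorm_ceta.
have E z : sipn d z ^+ 2 = complex.Re (d z z) by rewrite -sipn_sqr.
rewrite !E !(sipBl, sipBr, sipDl, sipDr, sipZl, sipZr).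
rewrite (sip_conj d x y) -[d x x]sipn_sqr -[d y y]sipn_sqr.
rewrite -![Num.conj _]/(_^*)%C.
case: (d x y) => a b /=; apply/eqP; rewrite eq_complex /=.
by apply/andP; split; apply/eqP; field.
Qed.

Lemma cdot_conj g h : cdot h g = Num.conj (cdot g h).
Proof.
rewrite -[Num.conj _]/((cdot g h)^*)%C /cdot /=; congr (_ +i* _).
  by rewrite [h + g]addrC [vnorm (h - g)]vdistC.
have -> : h + 'i%C *: g = 'i%C *: (g - 'i%C *: h).
  by rewrite scalerBr scalerA -expr2 sqr_i scaleN1r opprK addrC.
have -> : h - 'i%C *: g = (- 'i%C) *: (g + 'i%C *: h).
  by rewrite scaleNr scalerDr scalerA -expr2 sqr_i scaleN1r opprD opprK addrC.
by rewrite !vnormZc modcN modc_i !mul1r; field.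
Qed.

Lemma cdot_vnorm g : cdot g g = (vnorm g ^+ 2)%:C.
Proof.
rewrite /cdot subrr vnorm0 expr0n subr0.
have -> : g + g = (2 : R)%:C *: g by rewrite rmorph_nat scaler_nat mulr2n.
have -> : g + 'i%C *: g = (1 + 'i%C) *: g by rewrite scalerDl scale1r.
have -> : g - 'i%C *: g = (1 - 'i%C) *: g by rewrite scalerBl scale1r.
have -> : vnorm ((1 - 'i%C) *: g) = vnorm ((1 + 'i%C) *: g).
  by rewrite !vnormZc /modc !normc_def /=; congr (Num.sqrt _ * _); ring.
rewrite subrr mul0r vnormZr exprMn normr_nat; congr (_ +i* _).
by field.
Qed.

Lemma vnorm_sqr_dist (g g' : completion) (t : R) : vnorm (g - g') <= t -> t <=
  1 ->
  `|vnorm g ^+ 2 - vnorm g' ^+ 2| <= t * (2 * vnorm g + 1).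
Proof.
move=> gt t1.
have h1 : vnorm g' <= vnorm g + t.
  have := vdist_triangle g g' 0; rewrite !subr0 vdistC; lra.
have h2 : vnorm g <= vnorm g' + t.
  have := vdist_triangle g' g 0; rewrite !subr0; lra.
have := vnorm_ge0 g; have := vnorm_ge0 g'; have := vnorm_ge0 (g - g').
move: gt h1 h2; move: (vnorm g) (vnorm g') (vnorm (g - g')) => a b c.
move=> *; rewrite ler_norml; apply/andP; split; nra.
Qed.

Lemma cdot_dist (g g' h h' : completion) (t : R) :
  vnorm (g - g') <= t -> vnorm (h - h') <= t -> t <= 1 / 2 ->
  modc (cdot g h - cdot g' h') <= t * (4 * (vnorm g + vnorm h) + 2).
Proof.
move=> gt ht t1.
have key (c : R[i]) : modc c = 1 ->
    `|vnorm (g + c *: h) ^+ 2 - vnorm (g' + c *: h') ^+ 2|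
      <= 2 * t * (2 * (vnorm g + vnorm h) + 1).
  move=> c1; have t0 := le_trans (vnorm_ge0 _) gt.
  have H : vnorm ((g + c *: h) - (g' + c *: h')) <= 2 * t.
    rewrite opprD addrACA -scalerBr; apply: le_trans (vnormD _ _) _.
    by rewrite vnormZc c1; lra.
  apply: le_trans (vnorm_sqr_dist H _) _; first lra.
  apply: ler_wpM2l; first lra.
  have := vnormD g (c *: h); rewrite vnormZc c1; lra.
have := key 1 (modc1 R); have := key (-1); rewrite modcN => /(_ (modc1 R)).
have := key 'i%C (modc_i R); have := key (- 'i%C);
  rewrite modcN => /(_ (modc_i R)).
rewrite !scaleNr !scale1r; set K := 2 * t * _ => k1 k2 k3 k4.
have diff (a b a' b' : R) : `|a - a'| <= K -> `|b - b'| <= K ->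
    `|(a - b) / 4 - (a' - b') / 4| <= K / 2.
  by clear; rewrite !ler_norml => /andP[? ?] /andP[? ?]; apply/andP; split; lra.
apply: le_trans (modc_le _) _.
have -> : t * (4 * (vnorm g + vnorm h) + 2) = K / 2 + K / 2 by rewrite /K;
  field.
by apply: lerD; [exact: diff k4 k3|exact: diff k2 k1].
Qed.

Lemma cdot_continuous g h e : 0 < e ->
  exists2 t, 0 < t & forall g' h', vnorm (g - g') <= t -> vnorm (h - h') <= t ->
    modc (cdot g h - cdot g' h') <= e.
Proof.
move=> e0; pose K := 4 * (vnorm g + vnorm h) + 2.
have K0 : 0 < K by have := vnorm_ge0 g; have := vnorm_ge0 h; rewrite /K; lra.
exists (Num.min (1 / 2) (e / K)) => [|g' h' hg hh].
  by rewrite lt_min; apply/andP; split; [lra|exact: divr_gt0].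
apply: le_trans (cdot_dist hg hh _) _; first by rewrite ge_min lexx.
by rewrite -/K -ler_pdivlMr // ge_min lexx orbT.
Qed.

Lemma cdot_scalar h : scalar (cdot^~ h).
Proof.
move=> c g1 g2; apply/eqP; rewrite -subr_eq0; apply/eqP/modc_small => e e0.
have c0 := modc_ge0 c.
have ce : modc c * (e / (3 * (modc c + 1))) <= e / 3.
  rewrite mulrA ler_pdivrMr; last lra.
  by have := mulr_ge0 (ltW e0) c0; lra.
have [|t0 t00 H0] := @cdot_continuous (c *: g1 + g2) h (e / 3); first lra.
have [|t1 t10 H1] := @cdot_continuous g1 h (e / (3 * (modc c + 1))).
  by apply: divr_gt0 => //; lra.
have [|t2 t20 H2] := @cdot_continuous g2 h (e / 3); first lra.
(* One radius for all three estimates; [c *: x1 + x2] is off by at most (|c| + 1) t. *)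
have [t [t_gt0 tt1 tt2 tt0 tc0]] : exists t : R,
    [/\ 0 < t, t <= t1, t <= t2, t <= t0 & t * (modc c + 1) <= t0].
  exists (Num.min (t0 / (modc c + 1)) (Num.min t0 (Num.min t1 t2))).
  have c1 : 0 < modc c + 1 by rewrite ltr_wpDl.
  split; rewrite ?lt_min ?t00 ?t10 ?t20 ?divr_gt0 //.
  - by rewrite !ge_min lexx !orbT.
  - by rewrite !ge_min lexx !orbT.
  - by rewrite !ge_min lexx !orbT.
  - by rewrite -ler_pdivlMr // !ge_min lexx.
have [x1 /ltW hx1] := ceta_dense g1 t_gt0; have [x2 /ltW hx2] := ceta_dense g2
  t_gt0.
have [y /ltW hy] := ceta_dense h t_gt0.
have {}H0 := H0 (ceta (c *: x1 + x2)) (ceta y).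
have {}H1 := H1 _ _ (le_trans hx1 tt1) (le_trans hy tt1).
have {}H2 := H2 _ _ (le_trans hx2 tt2) (le_trans hy tt2).
have {}H0 : modc (cdot (c *: g1 + g2) h - cdot (ceta (c *: x1 + x2)) (ceta y))
  <= e / 3.
  apply: H0; last exact: le_trans hy tt0.
  rewrite ceta_linear opprD addrACA -scalerBr; apply: le_trans (vnormD _ _) _.
  rewrite vnormZc; apply: le_trans tc0; rewrite mulrDr mulr1 mulrC.
  by apply: lerD => //; rewrite mulrC [leRHS]mulrC ler_wpM2l.
have {}H1 : modc (c * cdot g1 h - c * cdot (ceta x1) (ceta y)) <= e / 3.
  rewrite -mulrBr modcM; apply: le_trans (ler_wpM2l c0 H1) _.
  exact: ce.
move: H0 H1 H2; rewrite !cdot_ceta sipDl sipZl.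
move: (cdot (c *: g1 + g2) h) (c * cdot g1 h) (cdot g2 h) => p q r.
move: (c * d x1 y) (d x2 y) => q' r' H0 H1 H2.
have -> : p - (q + r) = (p - (q' + r')) - ((q - q') + (r - r')) by ring.
apply: le_trans (modcD _ _) _; rewrite modcN.
have := modcD (q - q') (r - r'); clear -H0 H1 H2; lra.
Qed.

HB.instance Definition _ :=
  Banach_isHilbert.Build R completion cdot_scalar cdot_conj cdot_vnorm.

Lemma dot_ceta x y : dot (ceta x) (ceta y) = d x y.
Proof. exact: cdot_ceta. Qed.

End Completion.

(** * Bounded linear maps between Banach spaces *)

Definition bounded (R : realType) (V W : banachType R) (f : V -> W) :=
  linear f /\ exists M : R, forall x, vnorm (f x) <= M * vnorm x.

Section BoundedMaps.
Context (R : realType).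
Implicit Types V W X : banachType R.

Lemma boundedP V W (f : V -> W) : bounded f ->
  exists2 M : R, 0 < M & forall x, vnorm (f x) <= M * vnorm x.
Proof.
move=> [_ [M hM]]; exists (`|M| + 1) => [|x]; first by have := normr_ge0 M; lra.
apply: le_trans (hM x) _; apply: ler_wpM2r; first exact: vnorm_ge0.
by have := ler_norm M; lra.
Qed.

Lemma bounded_lincomb V W (f g : V -> W) c : bounded f -> bounded g ->
  bounded (fun x => c *: f x + g x).
Proof.
move=> fb gb; split=> [a x y|].
  rewrite fb.1 gb.1 !scalerDr !scalerA mulrC -!addrA; congr (_ + _).
  by rewrite addrCA.
have [M M0 hM] := boundedP fb; have [N N0 hN] := boundedP gb.
exists (modc c * M + N) => x; apply: le_trans (vnormD _ _) _.
rewrite vnormZc mulrDl -mulrA; apply: lerD => //.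
by rewrite ler_wpM2l ?modc_ge0.
Qed.

Lemma bounded_comp V W X (f : W -> X) (g : V -> W) : bounded f -> bounded g ->
  bounded (f \o g).
Proof.
move=> fb gb; split=> [a x y|] /=; first by rewrite gb.1 fb.1.
have [M M0 hM] := boundedP fb; have [N N0 hN] := boundedP gb.
exists (M * N) => x /=; apply: le_trans (hM _) _.
by rewrite -mulrA ler_wpM2l // ltW.
Qed.

Lemma bounded_id V : bounded (fun x : V => x).
Proof. by split=> //; exists 1 => x; rewrite mul1r. Qed.

Lemma bounded_dist V W (f : V -> W) : bounded f ->
  exists2 M : R, 0 < M & forall x y, vnorm (f x - f y) <= M * vnorm (x - y).
Proof.
move=> fb; have [M M0 hM] := boundedP fb; exists M => // x y.
by rewrite -(linB fb.1).
Qed.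

Lemma bounded_dense_eq (T : Type) V W (eta : T -> V) (f g : V -> W) :
  (forall x e, 0 < e -> exists v, vnorm (x - eta v) < e) ->
  bounded f -> bounded g -> (forall v, f (eta v) = g (eta v)) -> f =1 g.
Proof.
move=> dense fb gb fg x; apply/eqP; rewrite -subr_eq0; apply/eqP.
apply: vnorm_small => e e0.
have [M M0 hM] := bounded_dist fb; have [N N0 hN] := bounded_dist gb.
have [|v hv] := dense x (e / (M + N)); first by apply: divr_gt0 => //; lra.
have {}hv : vnorm (x - eta v) * (M + N) < e by rewrite -ltr_pdivlMr //; lra.
apply: le_trans (vdist_triangle (f (eta v)) _ _) _; rewrite {2}fg.
by have := hM x (eta v); have := hN x (eta v); rewrite [vnorm (g _ - _)]vdistC;
  lra.
Qed.

End BoundedMaps.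

(** * The GNS construction *)

Section GNS.
Context (R : realType) (B : cstarType R) (F : B -> R[i]).
Hypotheses (F_scalar : scalar F) (F_star : forall x, F (star x) = Num.conj (F
  x)).
Hypothesis F_pos : forall x, cpos x -> 0 <= F x.

Lemma gns_scalar (y : B) : scalar (fun x => F (star y * x)).
Proof. by move=> c u v; rewrite mulrDr -scalerAr F_scalar. Qed.

Lemma gns_conj (x y : B) : F (star x * y) = Num.conj (F (star y * x)).
Proof. by rewrite -F_star starM starK. Qed.

Lemma gns_ge0 (x : B) : 0 <= F (star x * x).
Proof. exact/F_pos/cpos_star_mul. Qed.

Definition gns_inner := SemiInner gns_scalar gns_conj gns_ge0.

(** The difference of the squares is the value of [F] at x^* (|b|^2 - b^* b) x, a conjugate of a
    positive element. *)
Lemma gns_sipn_mul (b x : B) :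
  sipn gns_inner (b * x) <= vnorm b * sipn gns_inner x.
Proof.
rewrite -ler_sqr ?nnegrE ?mulr_ge0 ?sipn_ge0 ?vnorm_ge0 // exprMn -lecR.
rewrite [leRHS]rmorphM /= !sipn_sqr /= -subr_ge0.
have -> : star (b * x) * (b * x) = star x * (star b * b) * x.
  by rewrite starM !mulrA.
have FZ c u : F (c *: u) = c * F u by exact: (linZ F_scalar).
rewrite -FZ -(linB F_scalar).
have -> : (vnorm b ^+ 2)%:C *: (star x * x) - star x * (star b * b) * x
    = star x * ((vnorm b ^+ 2)%:C%:A - star b * b) * x.
  by rewrite mulrBr mulrBl mulr_algr scalerAl.
apply/F_pos/cpos_conj/cpos_scalar_sub; first by rewrite starM starK.
by rewrite vnorm_starM.
Qed.

Lemma gns_rep : exists pi : B -> completion gns_inner -> completion gns_inner,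
  unital_rep pi /\ forall b x, pi b (ceta gns_inner x) = ceta gns_inner (b * x).
Proof.
set d := gns_inner; pose H := completion d.
have /choice[pi hpi] : forall b, exists S : H -> H, [/\ linear S,
    forall x, S (ceta d x) = ceta d (b * x) &
    forall x, vnorm (S x) <= vnorm b * vnorm x].
  move=> b; apply: (@bounded_extension _ B H H (ceta d) (fun x
    => ceta d (b * x))).
  - exact: ceta_linear.
  - by move=> c x y; rewrite mulrDr -scalerAr ceta_linear.
  - exact: ceta_dense.
  - exact: vnorm_ge0.
  - by move=> x; rewrite !vnorm_ceta gns_sipn_mul.
have piE b x : pi b (ceta d x) = ceta d (b * x) by case: (hpi b).
have pib b : bounded (pi b) by have [? _ ?] := hpi b; split=> //;
  exists (vnorm b).
exists pi; split=> //; split.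
- by move=> b; have [l _ bd] := hpi b; split=> //; exists (vnorm b).
- move=> c a b; apply: (bounded_dense_eq (@ceta_dense _ _ d)) => // [|x].
    exact: bounded_lincomb.
  by rewrite !piE -ceta_linear mulrDl scalerAl.
- apply: (bounded_dense_eq (@ceta_dense _ _ d)) => // [|x].
    exact: bounded_id.
  by rewrite piE mul1r.
- move=> a b; apply: (bounded_dense_eq (@ceta_dense _ _ d)) => // [|x].
    exact: (bounded_comp (pib a) (pib b)).
  by rewrite !piE mulrA.
- move=> a x y; apply/eqP; rewrite -subr_eq0; apply/eqP/modc_small => e e0.
  have [M M0 hM] := bounded_dist (pib a).
  have [N N0 hN] := bounded_dist (pib (star a)).
  have e20 : 0 < e / 2 by lra.
  have [t t0 ht] := cdot_continuous (pi a x) y e20.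
  have [s s0 hs] := cdot_continuous x (pi (star a) y) e20.
  pose r := Num.min (Num.min t (t / M)) (Num.min s (s / N)).
  have r0 : 0 < r by rewrite !lt_min t0 s0 !divr_gt0.
  have [rt rM rs rN] : [/\ r <= t, r * M <= t, r <= s & r * N <= s].
    by rewrite -!ler_pdivlMr // !ge_min !lexx !orbT.
  have [u /ltW hu] := ceta_dense x r0; have [v /ltW hv] := ceta_dense y r0.
  have h1 : modc (dot (pi a x) y - dot (pi a (ceta d u)) (ceta d v)) <= e / 2.
    apply: ht; last exact: le_trans hv rt.
    apply: le_trans (hM _ _) _; apply: le_trans rM.
    by rewrite mulrC ler_wpM2r // ltW.
  have h2 : modc (dot x (pi (star a) y) - dot (ceta d u) (pi (star a) (ceta d
    v))) <= e / 2.
    apply: hs; first exact: le_trans hu rs.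
    apply: le_trans (hN _ _) _; apply: le_trans rN.
    by rewrite mulrC ler_wpM2r // ltW.
  have E : dot (pi a (ceta d u)) (ceta d v) = dot (ceta d u) (pi (star a) (ceta
    d v)).
    by rewrite !piE !dot_ceta /= starM starK mulrA.
  rewrite -(subrKA (dot (pi a (ceta d u)) (ceta d v))).
  rewrite [in X in _ + X]E; apply: le_trans (modcD _ _) _.
  rewrite modcB in h2; move: (lerD h1 h2).
  by rewrite -splitr.
Qed.

End GNS.

(** The GNS representation of a state with F (a^* a) = |a|^2, at its cyclic vector. A representation
    depending on [a] is enough, since it is only compared with a supremum over representations. *)
Lemma norm_attaining_rep (R : realType) (B : cstarType R) (a : B) :
  exists (H : hilbertType R) (pi : B -> H -> H) (x : H),
    [/\ unital_rep pi, vnorm x <= 1 & vnorm (pi a x) = vnorm a].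
Proof.
have [F [Fl Fs Fp F1 Fa]] := exists_state a.
have [pi [pi_rep piE]] := gns_rep Fl Fs Fp.
have vE (x : B) : vnorm (ceta (gns_inner Fl Fs Fp) x) ^+ 2 = complex.Re (F
  (star x * x)).
  by rewrite vnorm_ceta sqr_sqrtr //; have := Fp _ (cpos_star_mul x);
    rewrite lecE => /andP[].
exists (completion (gns_inner Fl Fs Fp)), pi, (ceta _ 1); split=> //.
  by rewrite -(expr_le1 (n := 2)) ?vnorm_ge0 // vE star1 mulr1 F1.
apply/eqP; rewrite -(eqrXn2 (n := 2)) ?vnorm_ge0 //.
by rewrite piE vE mulr1 Fa.
Qed.

(** * The norm of the tensor algebra *)

Section OperatorNorm.
Context (R : realType) (H : hilbertType R).
Implicit Types (x y : H) (T : H -> H).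

Lemma dot0l y : dot (0 : H) y = 0.
Proof. exact: (lin0 (dot_scalar y)). Qed.

Lemma dot_suml (I : Type) (s : seq I) (P : pred I) (f : I -> H) y :
  dot (\sum_(i <- s | P i) f i) y = \sum_(i <- s | P i) dot (f i) y.
Proof. exact: (lin_sum (dot_scalar y)). Qed.

Lemma dot_sumr (I : Type) (s : seq I) (P : pred I) (f : I -> H) y :
  dot y (\sum_(i <- s | P i) f i) = \sum_(i <- s | P i) dot y (f i).
Proof. by rewrite dot_conj dot_suml rmorph_sum; apply: eq_bigr => i _;
  rewrite [RHS]dot_conj. Qed.

Lemma opnorm_le T M : 0 <= M -> (forall x, vnorm (T x) <= M * vnorm x) ->
  opnorm T <= M.
Proof.
move=> M0 hM; apply: ge_sup.
  by exists (vnorm (T 0)), 0 => //=; rewrite vnorm0.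
move=> _ [x /= x1 <-]; apply: le_trans (hM x) _.
by rewrite -[leRHS]mulr1 ler_wpM2l.
Qed.

Lemma le_opnorm T x : bounded T -> vnorm (T x) <= opnorm T * vnorm x.
Proof.
move=> Tb; have [M M0 hM] := boundedP Tb.
have [x0|x0] := eqVneq (vnorm x) 0.
  by rewrite (vnorm0_eq0 _ x0) (lin0 Tb.1) vnorm0 mulr0.
have x1 : 0 < vnorm x by rewrite lt_def x0 vnorm_ge0.
rewrite -ler_pdivrMr // mulrC -[X in X * _]gtr0_norm ?invr_gt0 // -vnormZr.
rewrite -(linZ Tb.1); apply: ub_le_sup.
  exists M => _ [y /= y1 <-]; apply: le_trans (hM y) _.
  by rewrite -[leRHS]mulr1 ler_wpM2l // ltW.
exists ((vnorm x)^-1%:C *: x) => //=.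
by rewrite vnormZr gtr0_norm ?invr_gt0 // mulVf.
Qed.

Lemma modc_dot x y : modc (dot x y) <= vnorm x * vnorm y.
Proof.
pose d := SemiInner (@dot_scalar R H) (@dot_conj R H)
  (fun x => eq_ind_r (fun z => 0 <= z) (eq_ind_r is_true (sqr_ge0 (vnorm x))
    (ler0c _)) (dot_vnorm x)).
have vE z : vnorm z = sipn d z.
  by rewrite /sipn /= dot_vnorm /= sqrtr_sqr ger0_norm ?vnorm_ge0.
by rewrite !vE; exact: (sip_cauchy_schwarz d).
Qed.

(* Cauchy-Schwarz for the semi-inner product [<T x, y>]. *)
Lemma vnorm_le_of_form T t : bounded T ->
  (forall x y, dot (T y) x = Num.conj (dot (T x) y)) ->
  (forall x, 0 <= dot (T x) x) ->
  (forall x, dot (T x) x <= (t * vnorm x ^+ 2)%:C) ->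
  forall x, vnorm (T x) <= t * vnorm x.
Proof.
move=> Tb TS T0 Tt x.
have Tscalar y : scalar (fun x => dot (T x) y).
  by move=> c u v; rewrite Tb.1 dotDl dotZl.
pose d := SemiInner Tscalar TS T0.
have dn y : sipn d y ^+ 2 <= t * vnorm y ^+ 2.
  by rewrite -lecR sipn_sqr; exact: Tt.
have tx0 : 0 <= t * vnorm x.
  have [->|x0] := eqVneq (vnorm x) 0; first by rewrite mulr0.
  have x1 : 0 < vnorm x by rewrite lt_def x0 vnorm_ge0.
  have := le_trans (sqr_ge0 _) (dn x).
  by rewrite !pmulr_lge0 ?exprn_gt0.
have [->//|p0] := eqVneq (vnorm (T x)) 0.
have p1 : 0 < vnorm (T x) by rewrite lt_def p0 vnorm_ge0.
have := sip_cauchy_schwarz d x (T x).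
rewrite /= dot_vnorm modc_real ger0_norm ?sqr_ge0 //.
rewrite -ler_sqr ?nnegrE ?sqr_ge0 ?mulr_ge0 ?sipn_ge0 // [leRHS]exprMn => h.
have := le_trans h (ler_pM (sqr_ge0 _) (sqr_ge0 _) (dn x) (dn (T x))).
have -> : t * vnorm x ^+ 2 * (t * vnorm (T x) ^+ 2)
  = (t * vnorm x) ^+ 2 * vnorm (T x) ^+ 2 by ring.
by rewrite expr2 ler_pM2r ?exprn_gt0 // ler_sqr ?nnegrE // ltW.
Qed.

End OperatorNorm.

(** * Adjoints and uniform bounds for ucp maps *)

Section UcpMaps.
Context (R : realType) (S : opSystemType R).
Context (H : hilbertType R) (phi : S -> H -> H).
Hypothesis phi_ucp : ucp_BH phi.
Implicit Types (s t : S) (x y : H).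

Lemma ucpD s t x : phi (s + t) x = phi s x + phi t x.
Proof. by have := ucpBH_linear phi_ucp 1 s t x; rewrite !scale1r. Qed.

Lemma ucp0 x : phi 0 x = 0.
Proof. by apply: (addrI (phi 0 x)); rewrite -ucpD !addr0. Qed.

Lemma ucpZ c s x : phi (c *: s) x = c *: phi s x.
Proof. by have := ucpBH_linear phi_ucp c s 0 x; rewrite ucp0 !addr0. Qed.

Lemma ucpN s x : phi (- s) x = - phi s x.
Proof. by rewrite -scaleN1r ucpZ scaleN1r. Qed.

Lemma ucp_bounded s : bounded (phi s).
Proof. by have [l b] := ucpBH_bop phi_ucp s. Qed.

End UcpMaps.

Lemma dotNl (R : realType) (H : hilbertType R) (x y : H) : dot (- x) y = - dot
  x y.
Proof. by rewrite -scaleN1r dotZl mulN1r. Qed.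

(** Positivity of this matrix encodes at once the bound [r] on the norm of [s] and, by hermitian
    symmetry of its images, the compatibility of positive maps with [star]. *)
Definition pair_mx (R : realType) (S : opSystemType R) (r : R) (s : S) :
  'M[S]_2 :=
  \matrix_(i, j) (if i == j then r%:C *: ounit
                  else if i == ord0 then - s else - star s).

Lemma mpos_pair_mx (R : realType) (S : opSystemType R) (s : S) :
  exists2 r : R, 0 < r & mpos 2 (pair_mx r s).
Proof.
pose X : 'M[S]_2 := \matrix_(i, j)
  (if i == j then 0 else if i == ord0 then s else star s).
have [|r r0 rX] := @ounit_order R S 2 X.
  apply/matrixP => i j; rewrite !mxE -!val_eqE.
  by case: i => [[|[|//]] ?]; case: j => [[|[|//]] ?] /=; rewrite ?star0 ?starK.
exists r => //; have -> // : pair_mx r s = unit_mx_of ounit r 2 - X.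
apply/matrixP => i j; rewrite !mxE.
by case: eqP => _; [rewrite subr0|case: eqP => _; rewrite sub0r].
Qed.

(** The form of [pair_mx r s] at the vectors [x] and [y]. Since [r] is chosen before [H] and [phi],
    the bounds derived from it are uniform. *)
Lemma ucp_BH_pair (R : realType) (S : opSystemType R) (s : S) :
  exists2 r : R, 0 < r & forall (H : hilbertType R) (phi : S -> H -> H),
    ucp_BH phi -> forall x y : H,
    0 <= (r * (vnorm x ^+ 2 + vnorm y ^+ 2))%:C
         - (dot (phi s y) x + dot (phi (star s) x) y).
Proof.
have [r r0 rX] := mpos_pair_mx s.
exists r => // H phi phi_ucp x y.
have := ucpBH_pos phi_ucp rX (fun i => if i == ord0 then x else y).
rewrite !big_ord_recl !big_ord0 /= !mxE /=.
rewrite !(ucpN phi_ucp) !(ucpZ phi_ucp) !(ucpBH_unit phi_ucp).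
rewrite !addr0 !dotZl !dotNl !dot_vnorm.
move=> h; apply: le_trans h _; rewrite le_eqVlt; apply/orP; left; apply/eqP.
by rewrite [(r * _)%:C]rmorphM /= [(_ + _)%:C]rmorphD /=; ring.
Qed.

(** Nonnegative elements of [R[i]] are real: the vanishing of the imaginary parts at (x, y) and at
    (x, i y) gives the two components of the identity. *)
Lemma ucp_BH_star (R : realType) (S : opSystemType R) (H : hilbertType R)
    (phi : S -> H -> H) s x y : ucp_BH phi ->
  dot (phi (star s) x) y = dot x (phi s y).
Proof.
move=> phi_ucp; have [r r0 /(_ H phi phi_ucp) h] := ucp_BH_pair s.
have hi := h x ('i%C *: y); have {}h := h x y.
move: h hi; rewrite (linZ (ucp_bounded phi_ucp s).1) dotZl dotZr.
rewrite [dot x (phi s y)]dot_conj -![Num.conj _]/(_^*)%C.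
case: (dot (phi s y) x) => a b; case: (dot (phi (star s) x) y) => a' b'.
rewrite !lecE /= => /andP[/eqP h1 _] /andP[/eqP h2 _].
by apply/eqP; rewrite eq_complex /=; apply/andP; split; apply/eqP; lra.
Qed.

Lemma ucp_BH_norm_le (R : realType) (S : opSystemType R) (s : S) :
  exists2 r : R, 0 < r & forall (H : hilbertType R) (phi : S -> H -> H),
    ucp_BH phi -> forall x : H, vnorm (phi s x) <= r * vnorm x.
Proof.
have [r r0 hr] := ucp_BH_pair s; exists r => // H phi phi_ucp y.
(* At x = phi s y / r the inequality, multiplied by [r], becomes |phi s y|^2 <= r^2 |y|^2. *)
have := hr H phi phi_ucp ((r^-1)%:C *: phi s y) y.
rewrite (ucp_BH_star _ _ _ phi_ucp) dotZr dotZl dot_vnorm -[Num.conj _]/(_^*)%C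
  conjc_real.
rewrite -!rmorphM -rmorphD -rmorphB ler0c vnormZr gtr0_norm ?invr_gt0 //.
move=> h0; rewrite -ler_sqr ?nnegrE ?mulr_ge0 ?vnorm_ge0 ?(ltW r0) //; move: h0.
set p := vnorm (phi s y); set q := vnorm y => h.
have : 0 <= r * (r * ((r^-1 * p) ^+ 2 + q ^+ 2) - (r^-1 * p ^+ 2 + r^-1 * p ^+
  2)).
  exact: mulr_ge0 (ltW r0) h.
have -> : r * (r * ((r^-1 * p) ^+ 2 + q ^+ 2) - (r^-1 * p ^+ 2 + r^-1 * p ^+ 2))
  = (r * q) ^+ 2 - p ^+ 2 by field; rewrite gt_eqF.
by rewrite subr_ge0.
Qed.

(** * Representations of the tensor algebra *)

Section TensorNorm.
Context (R : realType) (A : cstarType R) (S : opASystemType A).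
Implicit Types (u v : tensAlg S).

Section OneMap.
Context (H : hilbertType R) (phi : S -> H -> H).
Hypothesis phiP : A_ucp_BH phi.
Let phi_ucp := phiP.1.

Lemma pi_words_bounded (u : seq (word S)) : bounded (pi_words phi u).
Proof.
rewrite /pi_words; elim: u => [|w u IH].
  split=> [c x y|]; first by rewrite !big_nil scaler0 addr0.
  by exists 0 => x; rewrite big_nil vnorm0 mul0r.
have -> : (fun x => \sum_(w' <- w :: u) foldr phi x (wseq w'))
   = (fun x => 1 *: foldr phi x (wseq w) + \sum_(w' <- u) foldr phi x (wseq
     w')).
  by apply: funext => x; rewrite big_cons scale1r.
apply: bounded_lincomb => //; elim: (wseq w) => [|s l IHl] /=;
  first exact: bounded_id.
exact: (bounded_comp (ucp_bounded phi_ucp s) IHl).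
Qed.

Lemma pi_bounded u : bounded (pi_ phi u).
Proof. exact: pi_words_bounded. Qed.

Lemma pi_linear c u v x : pi_ phi (c *: u + v) x = c *: pi_ phi u x + pi_ phi v
  x.
Proof.
rewrite -(tpiK u) -(tpiK v).
rewrite -[_ *: _]/(tscale _ _) tscale_tpi -[_ + _]/(tadd _ _) tadd_tpi.
rewrite !(pi_tpi phiP) /pi_words big_cat /= big_map scaler_sumr; congr (_ + _).
by apply: eq_bigr => w _; rewrite /= (ucpZ phi_ucp).
Qed.

Lemma pi_tens w x : pi_ phi (tens w) x = foldr phi x (wseq w).
Proof. by rewrite (pi_tpi phiP) /pi_words big_cons big_nil addr0. Qed.

Lemma pi_tmul u v x : pi_ phi (tmul u v) x = pi_ phi u (pi_ phi v x).
Proof.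
rewrite -(tpiK u) -(tpiK v) tmul_tpi !(pi_tpi phiP) /pi_words /fmul.
rewrite big_allpairs_dep; apply: eq_bigr => w _.
have fb : bounded (fun x => foldr phi x (wseq w)).
  elim: (wseq w) => [|s l IHl] /=; first exact: bounded_id.
  exact: (bounded_comp (ucp_bounded phi_ucp s) IHl).
rewrite (lin_sum fb.1); apply: eq_bigr => w' _.
by rewrite wseq_mul foldr_cat.
Qed.

Lemma pi_star u x y : dot (pi_ phi (star u) x) y = dot x (pi_ phi u y).
Proof.
rewrite -(tpiK u) -[star _]/(tstar _) tstar_tpi !(pi_tpi phiP) /pi_words /fstar.
rewrite big_map dot_suml dot_sumr; apply: eq_bigr => w _.
rewrite wseq_star; elim: (wseq w) x => [|s l IHl] x //=.
by rewrite rev_cons foldr_rcons IHl (ucp_BH_star _ _ _ phi_ucp).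
Qed.

End OneMap.

(** [M] depends on [u] only. This bounds the set in [tens_norm], whose supremum would otherwise have
    the default value 0. *)
Lemma pi_norm_le u : exists2 M : R, 0 <= M &
  forall (H : hilbertType R) (phi : S -> H -> H), A_ucp_BH phi ->
    forall x, vnorm (pi_ phi u x) <= M * vnorm x.
Proof.
rewrite /pi_; move: (repr u) => {}u; rewrite /pi_words.
elim: u => [|w u [M M0 hM]].
  by exists 0 => // H phi _ x; rewrite big_nil vnorm0 mul0r.
have [N N0 hN] : exists2 N : R, 0 <= N & forall (H : hilbertType R)
    (phi : S -> H -> H), A_ucp_BH phi -> forall x,
    vnorm (foldr phi x (wseq w)) <= N * vnorm x.
  elim: (wseq w) => [|s l [N N0 hN]].
    by exists 1 => // H phi _ x; rewrite mul1r.
  have [r r0 hr] := ucp_BH_norm_le s.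
  exists (r * N) => [|H phi phiP x /=]; first exact: mulr_ge0 (ltW r0) N0.
  apply: le_trans (hr _ _ phiP.1 _) _.
  by rewrite -mulrA ler_wpM2l ?(ltW r0) // hN.
exists (N + M) => [|H phi phiP x]; first exact: addr_ge0.
rewrite big_cons; apply: le_trans (vnormD _ _) _.
by rewrite mulrDl lerD // ?hN // hM.
Qed.

Lemma pi_le_tens_norm (H : hilbertType R) (phi : S -> H -> H) u x :
  A_ucp_BH phi -> vnorm (pi_ phi u x) <= tens_norm u * vnorm x.
Proof.
move=> phiP; apply: le_trans (le_opnorm _ (pi_bounded phiP u)) _.
apply: ler_wpM2r; first exact: vnorm_ge0.
apply: ub_le_sup; last by exists H, phi.
have [M M0 hM] := pi_norm_le u.
exists M => _ [K [psi [psiP ->]]]; apply: opnorm_le => //; exact: hM.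
Qed.

Lemma tens_norm_le u (M : R) : 0 <= M ->
  (forall (H : hilbertType R) (phi : S -> H -> H), A_ucp_BH phi ->
    forall x, vnorm (pi_ phi u x) <= M * vnorm x) ->
  tens_norm u <= M.
Proof.
move=> M0 hM; rewrite /tens_norm; set E := (X in sup X).
(* The supremum of the empty set is 0, whence the assumption 0 <= M. *)
have [E0|/set0P/negP/negPn/eqP->] := pselect (E !=set0); last by rewrite sup0.
apply: ge_sup => // _ [H [phi [phiP ->]]].
by apply: opnorm_le => // x; exact: hM.
Qed.

End TensorNorm.

(** * C*-algebras as operator systems *)

Section PsdTheory.
Context (R : realType) (B : cstarType R).
Implicit Types (x y a : B) (r t e : R).

Definition qform n (X : 'I_n -> 'I_n -> B) (b c : 'I_n -> B) : B :=
  \sum_i \sum_j star (b i) * X i j * c j.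

Lemma qformDX n (X Y : 'I_n -> 'I_n -> B) b c :
  qform (fun i j => X i j + Y i j) b c = qform X b c + qform Y b c.
Proof.
rewrite /qform -big_split; apply: eq_bigr => i _ /=.
rewrite -big_split; apply: eq_bigr => j _ /=.
by rewrite mulrDr mulrDl.
Qed.

Lemma qformZX n (X : 'I_n -> 'I_n -> B) z b c :
  qform (fun i j => z *: X i j) b c = z *: qform X b c.
Proof.
rewrite /qform scaler_sumr; apply: eq_bigr => i _ /=.
rewrite scaler_sumr; apply: eq_bigr => j _ /=.
by rewrite -scalerAr -scalerAl.
Qed.

Lemma qform_diag n r (b c : 'I_n -> B) :
  qform (scalar_diag B r) b c = r%:C *: \sum_i star (b i) * c i.
Proof.
rewrite /qform scaler_sumr; apply: eq_bigr => i _.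
rewrite (bigD1 i) //= big1 ?addr0 /scalar_diag ?eqxx.
  by rewrite mulr_algr scalerAl.
by move=> j /negPf; rewrite eq_sym => ->; rewrite mulr0 mul0r.
Qed.

Lemma qformDl n (X : 'I_n -> 'I_n -> B) b b' c :
  qform X (fun i => b i + b' i) c = qform X b c + qform X b' c.
Proof.
rewrite /qform -big_split; apply: eq_bigr => i _ /=.
by rewrite -big_split; apply: eq_bigr => j _ /=; rewrite starD !mulrDl.
Qed.

Lemma qformDr n (X : 'I_n -> 'I_n -> B) b c c' :
  qform X b (fun i => c i + c' i) = qform X b c + qform X b c'.
Proof.
rewrite /qform -big_split; apply: eq_bigr => i _ /=.
by rewrite -big_split; apply: eq_bigr => j _ /=; rewrite mulrDr.
Qed.

Lemma qformZl n (X : 'I_n -> 'I_n -> B) z b c :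
  qform X (fun i => z *: b i) c = Num.conj z *: qform X b c.
Proof.
rewrite /qform scaler_sumr; apply: eq_bigr => i _ /=.
rewrite scaler_sumr; apply: eq_bigr => j _ /=.
by rewrite starZ -!scalerAl.
Qed.

Lemma qformZr n (X : 'I_n -> 'I_n -> B) z b c :
  qform X b (fun i => z *: c i) = z *: qform X b c.
Proof.
rewrite /qform scaler_sumr; apply: eq_bigr => i _ /=.
rewrite scaler_sumr; apply: eq_bigr => j _ /=.
by rewrite -scalerAr.
Qed.

Lemma qform_delta n (X : 'I_n -> 'I_n -> B) i j :
  qform X (fun k => (k == i)%:R) (fun k => (k == j)%:R) = X i j.
Proof.
rewrite /qform (bigD1 i) //= (bigD1 j) //= !eqxx star1 mul1r mulr1.
rewrite !big1 ?addr0 // => k /negPf ->; last by rewrite mulr0.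
by rewrite big1 // => l _; rewrite star0 !mul0r.
Qed.

(** Polarization at b + c and b + i c, for coordinate vectors [b] and [c]. *)
Lemma qform_eq0 n (X : 'I_n -> 'I_n -> B) :
  (forall b, qform X b b = 0) -> forall i j, X i j = 0.
Proof.
move=> X0 i j; rewrite -(qform_delta X).
set b := (fun k => (k == i)%:R); set c := (fun k => (k == j)%:R); clearbody b c.
have h1 : qform X b c = - qform X c b.
  apply/eqP; rewrite -addr_eq0; apply/eqP.
  by have := X0 (fun k => b k + c k); rewrite qformDl !qformDr !X0 add0r addr0.
have h2 : qform X b c = qform X c b.
  have := X0 (fun k => b k + 'i%C *: c k).
  rewrite qformDl !qformDr !qformZl !qformZr !X0 !scaler0 add0r addr0.
  rewrite conj_i scaleNr => /eqP; rewrite subr_eq0 => /eqP /(congr1 (fun x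
    => - 'i%C *: x)).
  by rewrite !scalerA mulNr -expr2 sqr_i opprK !scale1r.
have : qform X b c *+ 2 = 0 by rewrite mulr2n {1}h1 h2 addNr.
by rewrite -scaler_nat => /eqP; rewrite scaler_eq0 pnatr_eq0 /= => /eqP.
Qed.

(** Completing the square: [t] times the element is w^* w + y^* (t^2 - a^* a) y, with w = t x - a
    y. *)
Lemma cpos_cross t x y a : 0 < t -> vnorm a <= t ->
  cpos (t%:C *: (star x * x + star y * y) - (star x * a * y + star y * star a *
    x)).
Proof.
move=> t0 at_.
have tC : t%:C != 0 :> R[i] by rewrite fmorph_eq0 gt_eqF.
set E := (X in cpos X).
have -> : E = (t^-1)%:C *: (t%:C *: E) by rewrite scalerA fmorphV mulVf //
  scale1r.
apply: cposZ; first by rewrite invr_ge0 ltW.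
pose w := t%:C *: x - a * y.
have -> : t%:C *: E = star w * w + star y * ((t ^+ 2)%:C%:A - star a * a) * y.
  rewrite /w /E starB starZr starM mulrBl !mulrBr -!scalerAl -!scalerAr !mulrA.
  rewrite [in RHS]mulrBl mulr1 -scalerAl [in RHS]rmorphM -scalerA !scalerDr
    !scalerN.
  set p := t%:C *: (t%:C *: (star x * x)); set q := t%:C *: (t%:C *: (star y *
    y)).
  set s := star x * a * y; set s' := star y * star a * x.
  set r := star y * star a * a * y.
  rewrite opprB -[RHS]addrA [X in _ = _ + X]addrC subrKA.
  by rewrite scalerDr opprD addrACA.
apply: cposD; first exact: cpos_star_mul.
apply/cpos_conj/cpos_scalar_sub; first by rewrite starM starK.
by rewrite vnorm_starM lerXn2r ?nnegrE ?vnorm_ge0 // ltW.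
Qed.

Definition mx_conj n m (a : 'I_n -> 'I_m -> B) (X : 'I_m -> 'I_m -> B) i j : B
  :=
  \sum_k \sum_l a i k * X k l * star (a j l).

(** The form of the conjugated matrix at [b] is the form of [X] at the vector with entries sum_i
    a_ik^* b_i. *)
Lemma psd_conj n m (a : 'I_n -> 'I_m -> B) X : psd X -> psd (mx_conj a X).
Proof.
move=> [XS Xp]; split=> [i j|b].
  rewrite /mx_conj star_sum exchange_big; apply: eq_bigr => k _ /=.
  rewrite star_sum; apply: eq_bigr => l _.
  by rewrite !starM starK XS mulrA.
have -> : \sum_i \sum_j star (b i) * mx_conj a X i j * b j
    = qform X (fun k => \sum_i star (a i k) * b i) (fun k => \sum_i star (a i
      k) * b i).
  rewrite /qform /mx_conj.
  transitivity (\sum_i \sum_j \sum_k \sum_l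
    star (b i) * a i k * X k l * (star (a j l) * b j)).
    apply: eq_bigr => i _; apply: eq_bigr => j _.
    rewrite mulr_sumr mulr_suml; apply: eq_bigr => k _.
    rewrite mulr_sumr mulr_suml; apply: eq_bigr => l _.
    by rewrite !mulrA.
  under eq_bigr do rewrite exchange_big.
  rewrite exchange_big; apply: eq_bigr => k _ /=.
  under eq_bigr do rewrite exchange_big.
  rewrite exchange_big; apply: eq_bigr => l _ /=.
  rewrite star_sum !mulr_suml; apply: eq_bigr => i _.
  by rewrite mulr_sumr; apply: eq_bigr => j _; rewrite starM starK.
exact: Xp.
Qed.

Lemma psd_order n (X : 'I_n -> 'I_n -> B) : (forall i j, star (X i j) = X j i)
  ->
  exists2 r : R, 0 < r & psd (fun i j => scalar_diag B r i j - X i j).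
Proof.
move=> XS; pose t := 1 + \sum_i \sum_j vnorm (X i j).
have s0 : 0 <= \sum_i \sum_j vnorm (X i j).
  by do 2 (apply: sumr_ge0 => ? _); exact: vnorm_ge0.
have t0 : 0 < t by rewrite /t; lra.
have Xt i j : vnorm (X i j) <= t.
  rewrite /t (bigD1 i) //= (bigD1 j) //=.
  have : 0 <= \sum_(k | k != j) vnorm (X i k).
    by apply: sumr_ge0 => ? _; exact: vnorm_ge0.
  have : 0 <= \sum_(k | k != i) \sum_j vnorm (X k j).
    by do 2 (apply: sumr_ge0 => ? _); exact: vnorm_ge0.
  lra.
(* Each pair (i, j) costs t (b_i^* b_i + b_j^* b_j), in total n t after halving; n + 1 keeps the
   constant positive when n = 0. *)
exists (n.+1%:R * t); first by rewrite mulr_gt0 ?ltr0Sn.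
split=> [i j|b].
  rewrite starB XS /scalar_diag eq_sym.
  by case: eqP => _; rewrite ?star_scalar ?star0.
pose N := \sum_i star (b i) * b i.
have Npos : cpos N by apply: cpos_sum => i _; exact: cpos_star_mul.
(* Doubling joins the (i, j) and (j, i) terms, and [cpos_cross] applies to each such pair. *)
apply: cpos_double.
have -> : \sum_i \sum_j star (b i) * (scalar_diag B (n.+1%:R * t) i j - X i j)
  * b j
   = (n.+1%:R * t)%:C *: N - qform X b b.
  rewrite -qform_diag -scaleN1r -qformZX -qformDX /qform.
  by apply: eq_bigr => i _; apply: eq_bigr => j _; rewrite scaleN1r.
set M := (t%:C *: N) *+ n.
have -> : (n.+1%:R * t)%:C *: N = t%:C *: N + M.
  by rewrite rmorphM rmorph_nat -scalerA scaler_nat mulrS.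
have sumM : \sum_i \sum_j t%:C *: (star (b i) * b i + star (b j) * b j) = M + M.
  have sumM1 : \sum_(i < n) \sum_(j < n) t%:C *: (star (b j) * b j) = M.
    by under eq_bigr do rewrite -scaler_sumr; rewrite sumr_const card_ord.
  rewrite -{2}sumM1 -sumM1 [X in _ = X + _]exchange_big -big_split.
  apply: eq_bigr => i _ /=; rewrite -big_split; apply: eq_bigr => j _ /=.
  by rewrite scalerDr.
have sumQ : \sum_i \sum_j (star (b i) * X i j * b j + star (b j) * star (X i j)
  * b i)
    = qform X b b + qform X b b.
  have Q2 : qform X b b = \sum_i \sum_j star (b j) * star (X i j) * b i.
    rewrite /qform exchange_big; apply: eq_bigr => i _ /=.
    by apply: eq_bigr => j _; rewrite XS.
  rewrite {2}Q2 /qform -big_split; apply: eq_bigr => i _ /=.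
  by rewrite -big_split.
have -> : t%:C *: N + M - qform X b b + (t%:C *: N + M - qform X b b)
  = (t%:C *: N + t%:C *: N) + \sum_i \sum_j
    (t%:C *: (star (b i) * b i + star (b j) * b j)
     - (star (b i) * X i j * b j + star (b j) * star (X i j) * b i)).
  under [in RHS]eq_bigr do rewrite sumrB.
  by rewrite sumrB sumM sumQ addrACA [X in X + _ = _]addrACA -opprD -[LHS]addrA.
apply: cposD.
  by apply: cposD; apply: cposZ => //; exact: ltW.
by apply: cpos_sum => i _; apply: cpos_sum => j _; apply: cpos_cross.
Qed.

Lemma psd_archi n (X : 'I_n -> 'I_n -> B) :
  (forall r, 0 < r -> psd (fun i j => scalar_diag B r i j + X i j)) -> psd X.
Proof.
move=> h; split=> [i j|b].
  have := (h 1 ltr01).1 i j; rewrite starD /scalar_diag eq_sym.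
  by case: eqP => _; rewrite ?star_scalar ?star0 => /addrI.
apply: cpos_closed => e e0.
set N := \sum_i star (b i) * b i.
pose d := e / (vnorm N + 1).
have N0 := vnorm_ge0 N.
have d0 : 0 < d by rewrite divr_gt0 //; lra.
exists (qform (fun i j => scalar_diag B d i j + X i j) b b).
  exact: (h d d0).2.
rewrite qformDX qform_diag opprD addrC -addrA addNr addr0 vnormN vnormZr.
by rewrite gtr0_norm // /d mulrAC ler_pdivrMr ?ler_pM2l //; lra.
Qed.

End PsdTheory.

(* A C*-algebra [B] as an operator [A]-system, [A] acting through [k]; a matrix
   [X] over [B] is positive when all [sum b_i^* X_ij b_j] are. *)
Definition opsys (R : realType) (A B : cstarType R) (k : A -> B)
  (kh : star_hom k) : Type := B.

Section OpSystemOfCStar.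
Context (R : realType) (A B : cstarType R) (k : A -> B) (kh : star_hom k).
Local Notation T := (opsys kh).

HB.instance Definition _ := StarSpace.copy T B.

Definition opsys_pos n (X : 'M[T]_n) : Prop := psd (X : 'I_n -> 'I_n -> B).

Lemma psd_ext n (X Y : 'I_n -> 'I_n -> B) : (forall i j, X i j = Y i j) ->
  psd X -> psd Y.
Proof.
by move=> XY; have -> // : X = Y; apply: funext => i; apply: funext => j.
Qed.

Lemma hermitian_mxP (V : starSpaceType R) n (X : 'M[V]_n) :
  (map_mx star X)^T = X <-> forall i j, star (X i j) = X j i.
Proof.
split=> [E i j|E]; last by apply/matrixP => i j; rewrite !mxE.
by rewrite -[in RHS]E !mxE.
Qed.

Lemma opsys_pos_star n (X : 'M[T]_n) : opsys_pos X -> (map_mx star X)^T = X.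
Proof. by move=> [XS _]; apply/hermitian_mxP. Qed.

Lemma opsys_pos0 n : opsys_pos (0 : 'M[T]_n).
Proof.
split=> [i j|b]; first by rewrite !mxE star0.
apply: cpos_sum => i _; apply: cpos_sum => j _.
by rewrite mxE mulr0 mul0r; exact: cpos0.
Qed.

Lemma opsys_posD n (X Y : 'M[T]_n) :
  opsys_pos X -> opsys_pos Y -> opsys_pos (X + Y).
Proof.
move=> [XS Xp] [YS Yp].
apply: (@psd_ext _ (fun i j => (X i j : B) + Y i j)) => [i j|];
  first by rewrite mxE.
split=> [i j|b]; first by rewrite starD XS YS.
rewrite -/(qform _ b b) qformDX; apply: cposD; [exact: Xp|exact: Yp].
Qed.

Lemma opsys_posZ n (r : R) (X : 'M[T]_n) : 0 <= r ->
  opsys_pos X -> opsys_pos (map_mx ( *:%R r%:C) X).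
Proof.
move=> r0 [XS Xp].
apply: (@psd_ext _ (fun i j => r%:C *: (X i j : B))) => [i j|];
  first by rewrite mxE.
split=> [i j|b]; first by rewrite starZr XS.
rewrite -/(qform _ b b) qformZX; apply: cposZ => //; exact: Xp.
Qed.

Lemma opsys_pos_proper n (X : 'M[T]_n) : opsys_pos X -> opsys_pos (- X) -> X =
  0.
Proof.
move=> [_ Xp] [_ XNp]; apply/matrixP => i j; rewrite mxE.
apply: (@qform_eq0 _ B n (X : 'I_n -> 'I_n -> B)) => b.
apply: cpos_antisym; first exact: Xp.
have -> : - qform (X : 'I_n -> 'I_n -> B) b b
    = \sum_i \sum_j star (b i) * ((- X) i j : B) * b j.
  rewrite -scaleN1r -qformZX.
  by apply: eq_bigr => l _; apply: eq_bigr => m _; rewrite mxE scaleN1r.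
exact: XNp.
Qed.

Lemma opsys_pos_congr m n (M : 'M[R[i]]_(m, n)) (X : 'M[T]_m) : opsys_pos X ->
  opsys_pos (\matrix_(i, j) \sum_k \sum_l (Num.conj (M k i) * M l j) *: X k l).
Proof.
move=> Xp.
apply: psd_ext (psd_conj (fun i k => (Num.conj (M k i))%:A : B) Xp) => i j.
rewrite mxE; apply: eq_bigr => l _; apply: eq_bigr => p _.
by rewrite starZ conjCK star1 mulr_algr mulr_algl scalerA mulrC.
Qed.

Lemma opsys_unit_star : star (1 : B) = 1 :> T. Proof. exact: star1. Qed.

Lemma opsys_order n (X : 'M[T]_n) : (map_mx star X)^T = X ->
  exists2 r : R, 0 < r & opsys_pos (unit_mx_of (1 : B) r n - X).
Proof.
move=> /hermitian_mxP XS; have [r r0 rX] := psd_order XS.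
by exists r => //; apply: psd_ext rX => i j; rewrite !mxE.
Qed.

Lemma opsys_archi n (X : 'M[T]_n) :
  (forall r : R, 0 < r -> opsys_pos (unit_mx_of (1 : B) r n + X)) -> opsys_pos
    X.
Proof.
move=> h; apply: psd_archi => r r0.
by apply: psd_ext (h r r0) => i j; rewrite !mxE.
Qed.

HB.instance Definition _ := StarSpace_isOpSystem.Build R T
  opsys_pos_star opsys_pos0 opsys_posD opsys_posZ opsys_pos_proper
  opsys_pos_congr opsys_unit_star opsys_order opsys_archi.

Definition opsys_lact (a : A) (s : T) : T := k a * (s : B).
Definition opsys_ract (s : T) (a : A) : T := (s : B) * k a.

Lemma opsys_lact_linear a : linear (opsys_lact a).
Proof. by move=> c s t; rewrite /opsys_lact mulrDr scalerAr. Qed.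
Lemma opsys_lact_linearl s : linear (opsys_lact^~ s).
Proof. by move=> c a b; rewrite /opsys_lact (shom_linear kh) mulrDl scalerAl.
  Qed.
Lemma opsys_ract_linear s : linear (opsys_ract s).
Proof. by move=> c a b; rewrite /opsys_ract (shom_linear kh) mulrDr scalerAr.
  Qed.
Lemma opsys_ract_linearl a : linear (opsys_ract^~ a).
Proof. by move=> c s t; rewrite /opsys_ract mulrDl scalerAl. Qed.
Lemma opsys_lact1 s : opsys_lact 1 s = s.
Proof. by rewrite /opsys_lact (shom1 kh) mul1r. Qed.
Lemma opsys_ract1 s : opsys_ract s 1 = s.
Proof. by rewrite /opsys_ract (shom1 kh) mulr1. Qed.
Lemma opsys_lactA a b s : opsys_lact (a * b) s = opsys_lact a (opsys_lact b s).
Proof. by rewrite /opsys_lact (shomM kh) mulrA. Qed.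
Lemma opsys_ractA s a b : opsys_ract s (a * b) = opsys_ract (opsys_ract s a) b.
Proof. by rewrite /opsys_ract (shomM kh) mulrA. Qed.
Lemma opsys_lractA a s b : opsys_ract (opsys_lact a s) b = opsys_lact a
  (opsys_ract s b).
Proof. by rewrite /opsys_ract /opsys_lact mulrA. Qed.
Lemma opsys_star_lact a s : star (opsys_lact a s) = opsys_ract (star s) (star
  a).
Proof. by rewrite /opsys_ract (shom_star kh) -starM. Qed.
Lemma opsys_lact_unit a : opsys_lact a ounit = opsys_ract ounit a.
Proof. by rewrite /opsys_lact /opsys_ract mulr1 mul1r. Qed.
Lemma opsys_pos_act n m (a : 'M[A]_(n, m)) (X : 'M[T]_m) : mpos m X ->
  mpos n (\matrix_(i, j) \sum_p \sum_l
    opsys_ract (opsys_lact (a i p) (X p l)) (star (a j l))).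
Proof.
move=> Xp; apply: psd_ext (psd_conj (fun i p => k (a i p)) Xp) => i j.
rewrite mxE; apply: eq_bigr => p _; apply: eq_bigr => l _.
by rewrite /opsys_ract (shom_star kh).
Qed.

HB.instance Definition _ := OpSystem_isOpASystem.Build R A T
  opsys_lact_linear opsys_lact_linearl opsys_ract_linear opsys_ract_linearl
  opsys_lact1 opsys_ract1 opsys_lactA opsys_ractA opsys_lractA opsys_star_lact
  opsys_lact_unit opsys_pos_act.

End OpSystemOfCStar.

(** * Homomorphisms and representations of C*-algebras *)

Lemma cstar_bounded_mull (R : realType) (B : cstarType R) (a : B) :
  bounded (fun x : B => a * x).
Proof.
split=> [c x y|]; first by rewrite mulrDr scalerAr.
by exists (vnorm a) => x; exact: vnormM.
Qed.

Lemma cstar_bounded_mulr (R : realType) (B : cstarType R) (a : B) :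
  bounded (fun x : B => x * a).
Proof.
split=> [c x y|]; first by rewrite mulrDl scalerAl.
by exists (vnorm a) => x; rewrite mulrC; exact: vnormM.
Qed.

Lemma shom_bounded (R : realType) (A B : cstarType R) (f : A -> B) :
  star_hom f -> bounded f.
Proof.
move=> fh; split; first exact: (shom_linear fh).
by exists 1 => x; rewrite mul1r; exact: shom_contractive.
Qed.

Lemma shom_comp (R : realType) (A B C : cstarType R) (f : B -> C) (g : A -> B) :
  star_hom f -> star_hom g -> star_hom (f \o g).
Proof.
move=> fh gh; split=> [c x y||x y|x] /=.
- by rewrite (shom_linear gh) (shom_linear fh).
- by rewrite (shom1 gh) (shom1 fh).
- by rewrite (shomM gh) (shomM fh).
- by rewrite (shom_star gh) (shom_star fh).
Qed.

(** A factorization of X + e turns the form into a sum of squared norms; then [e] tends to 0. *)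
Lemma rep_psd (R : realType) (B : cstarType R) (H : hilbertType R)
    (pi : B -> H -> H) n (X : 'I_n -> 'I_n -> B) (x : 'I_n -> H) :
  unital_rep pi -> psd X -> 0 <= \sum_i \sum_j dot (pi (X i j) (x j)) (x i).
Proof.
move=> pr Xp; set z := \sum_i _.
have piD a b y : pi (a + b) y = pi a y + pi b y.
  by have := rep_linear pr 1 a b y; rewrite !scale1r.
have pi0 y : pi 0 y = 0 by apply: (addrI (pi 0 y)); rewrite -piD !addr0.
have piZ c a y : pi (c *: a) y = c *: pi a y.
  by have := rep_linear pr c a 0 y; rewrite pi0 !addr0.
pose N := \sum_i vnorm (x i) ^+ 2.
have N0 : 0 <= N by apply: sumr_ge0 => i _; exact: sqr_ge0.
have key (e : R) : 0 < e -> 0 <= z + (e * N)%:C.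
  move=> e0; have [s hs] := psd_factor e0 Xp.
  have -> : (e * N)%:C = \sum_i \sum_j dot (pi (scalar_diag B e i j) (x j)) (x
    i).
    rewrite rmorphM rmorph_sum mulr_sumr; apply: eq_bigr => i _ /=.
    rewrite (bigD1 i) //= big1 ?addr0 /scalar_diag ?eqxx.
      by rewrite piZ (rep1 pr) dotZl dot_vnorm.
    by move=> j /negPf; rewrite eq_sym => ->; rewrite pi0 dot0l.
  have -> : z + \sum_i \sum_j dot (pi (scalar_diag B e i j) (x j)) (x i)
    = \sum_(l <- s) dot (\sum_j pi (l j) (x j)) (\sum_i pi (l i) (x i)).
    transitivity (\sum_i \sum_j \sum_(l <- s) dot (pi (l j) (x j)) (pi (l i) (x
      i))).
      rewrite /z -big_split; apply: eq_bigr => i _ /=.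
      rewrite -big_split; apply: eq_bigr => j _ /=.
      rewrite -dotDl -piD hs.
      rewrite (big_morph (fun a => pi a (x j)) (fun a b => piD a b _) (pi0 _)).
      rewrite dot_suml; apply: eq_bigr => l _.
      by rewrite (repM pr) (rep_star pr) starK.
    under eq_bigr do rewrite exchange_big.
    rewrite exchange_big; apply: eq_bigr => l _ /=.
    rewrite dot_sumr; apply: eq_bigr => i _.
    by rewrite dot_suml.
  by apply: sumr_ge0 => l _; rewrite dot_vnorm ler0c sqr_ge0.
have : complex.Im z = 0 /\ forall e : R, 0 < e -> 0 <= complex.Re z + e * N.
  split=> [|e /key].
    have := key 1 ltr01; case: (z) => a b; rewrite lecE /= => /andP[/eqP + _].
    by rewrite addr0.
  by case: (z) => a b; rewrite lecE /= => /andP[].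
move=> [im re]; rewrite lecE /= im eqxx /=.
apply/ler_addgt0Pr => e e0; have e1 : 0 < e / (N + 1) by rewrite divr_gt0 //;
  lra.
apply: le_trans (re _ e1) _; rewrite lerD2l mulrAC ler_pdivrMr; last lra.
by rewrite ler_pM2l //; lra.
Qed.

(** * The universal property and the isomorphism *)

Section UniversalCStar.
Context (R : realType) (A : cstarType R) (S : opASystemType A).
Context (U : cstarType R) (iota : tensAlg S -> U).
Hypothesis hU : is_universal_cstar iota.
Implicit Types (u v : tensAlg S) (s t : S) (a b : A).

Definition ucstar_gen s : U := iota (tens (s, [::])).
Local Notation gen := ucstar_gen.
Local Notation k := (ucstar_incl iota).

Lemma ucstar_bound u (M : R) : 0 <= M ->
  (forall (H : hilbertType R) (phi : S -> H -> H), A_ucp_BH phi ->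
    forall x, vnorm (pi_ phi u x) <= M * vnorm x) ->
  vnorm (iota u) <= M.
Proof. by move=> M0 hM; rewrite (ucstar_norm hU); exact: tens_norm_le. Qed.

(** [iota] kills the elements of norm 0, so relations absent from [tens_eq] can be obtained in [U]
    by checking them in every representation. *)
Lemma ucstar_eq u v : (forall (H : hilbertType R) (phi : S -> H -> H),
  A_ucp_BH phi -> pi_ phi u =1 pi_ phi v) -> iota u = iota v.
Proof.
move=> uv; apply/eqP; rewrite -subr_eq0 -(linB (ucstar_linear hU)); apply/eqP.
apply: vnorm0_eq0; apply/eqP; rewrite eq_le vnorm_ge0 andbT.
apply: ucstar_bound => // H phi phiP x; rewrite mul0r.
by rewrite addrC -scaleN1r (pi_linear phiP) uv // scaleN1r addNr vnorm0.
Qed.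

Lemma tmul_tens (w w' : word S) : tmul (tens w) (tens w') = tens (wmul w w').
Proof. by rewrite tmul_tpi. Qed.

Lemma ucstar_tens (w : word S) : iota (tens w) = \prod_(s <- wseq w) gen s.
Proof.
case: w => s l; rewrite /wseq /=; elim: l s => [|t l IH] s.
  by rewrite big_cons big_nil mulr1.
rewrite big_cons -IH -(ucstarM hU) tmul_tens //.
Qed.

Lemma ucstar_words (ws : seq (word S)) :
  iota (tpi ws) = \sum_(w <- ws) \prod_(s <- wseq w) gen s.
Proof.
elim: ws => [|w ws IH]; first by rewrite big_nil (lin0 (ucstar_linear hU)).
rewrite big_cons -IH -ucstar_tens -(linD (ucstar_linear hU)).
by congr iota; rewrite -[RHS]/(tadd _ _) tadd_tpi.
Qed.

(** Multiplication by [ounit] raises degrees in F(S), but every [phi] sends [ounit] to the identity;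
    hence its generator acts as 1 on the dense image of [iota]. *)
Lemma ucstar_gen_unit : gen ounit = 1.
Proof.
rewrite -[LHS]mulr1; apply: (bounded_dense_eq (ucstar_dense hU)
  (cstar_bounded_mull _) (bounded_id _)) => u.
rewrite -(ucstarM hU); apply: ucstar_eq => H phi phiP x.
by rewrite (pi_tmul phiP) (pi_tens phiP) /= (ucpBH_unit phiP.1).
Qed.

Lemma ucstar_gen_linear : linear gen.
Proof.
move=> c s t; rewrite /ucstar_gen -(ucstar_linear hU); congr iota.
rewrite -[RHS]/(tadd (tscale c _) _) tscale_tpi tadd_tpi.
exact/tpi_eq/(tens_add [::]).
Qed.

Lemma ucstar_gen_star s : gen (star s) = star (gen s).
Proof. by rewrite /ucstar_gen -(ucstar_star hU) -[star (tens _)]/(tstar _)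
  tstar_tpi. Qed.

Lemma ucstar_gen_bal s a t : gen (ract s a) * gen t = gen s * gen (lact a t).
Proof.
rewrite -!(ucstarM hU) !tmul_tens; congr iota.
exact/tpi_eq/(tens_bal [::]).
Qed.

(** Balancedness needs a second factor to which [a] can move; the generator of [ounit], equal to 1,
    provides it. *)
Lemma ucstar_gen_ract s a : gen (ract s a) = gen s * k a.
Proof. by rewrite -[LHS]mulr1 -ucstar_gen_unit ucstar_gen_bal. Qed.

Lemma ucstar_gen_lact a s : gen (lact a s) = k a * gen s.
Proof.
rewrite -[LHS]mul1r -ucstar_gen_unit -ucstar_gen_bal -lact_ounit //.
Qed.

Lemma ucstar_incl_hom : star_hom k.
Proof.
split=> [c a b||a b|a].
- by rewrite /ucstar_incl lact_linearl -[LHS]/(gen _) ucstar_gen_linear.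
- by rewrite /ucstar_incl lact1; exact: ucstar_gen_unit.
- by rewrite -[LHS]/(gen _) lactA ucstar_gen_lact.
- by rewrite -[RHS]/(star (gen _)) -ucstar_gen_star star_lact ounit_star
  -lact_ounit.
Qed.

Lemma ucstar_hom_eq (B : cstarType R) (f g : U -> B) : star_hom f -> star_hom g
  ->
  (forall s, f (gen s) = g (gen s)) -> f =1 g.
Proof.
move=> fh gh fg.
apply: (bounded_dense_eq (ucstar_dense hU) (shom_bounded fh) (shom_bounded gh))
  => u.
rewrite -(tpiK u) ucstar_words (lin_sum (shom_linear fh)) (lin_sum (shom_linear
  gh)).
apply: eq_bigr => w _.
rewrite (big_morph f (shomM fh) (shom1 fh)) (big_morph g (shomM gh) (shom1 gh)).
by apply: eq_bigr => s _.
Qed.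

Lemma psd_dense n (X : 'I_n -> 'I_n -> U) : (forall i j, star (X i j) = X j i)
  ->
  (forall u : 'I_n -> tensAlg S,
     cpos (qform X (fun i => iota (u i)) (fun i => iota (u i)))) -> psd X.
Proof.
move=> XS Xp; split=> // b.
have /choice[u hu] : forall m : nat, exists u : 'I_n -> tensAlg S,
    forall i, vnorm (b i - iota (u i)) < m.+1%:R^-1.
  move=> m; have /choice[w hw] : forall i, exists w, vnorm (b i - iota w) <
    m.+1%:R^-1.
    by move=> i; apply: (ucstar_dense hU); rewrite invr_gt0 ltr0Sn.
  by exists w.
have ub i : vlim (fun m => iota (u m i)) (b i).
  move=> e /invSn_small[N hN]; exists N => m /hN; rewrite vdistC.
  by apply: lt_trans; exact: hu.
have : vlim (fun m => qform X (fun i => iota (u m i)) (fun i => iota (u m i)))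
  (qform X b b).
  apply: vlim_sum => i; apply: vlim_sum => j.
  exact: (vlimM (vlimM (vlim_star (ub i)) (vlim_cst _)) (ub j)).
move=> lim; apply: cpos_closed => e /lim[N /(_ N (leqnn N)) hN].
by exists (qform X (fun i => iota (u N i)) (fun i => iota (u N i)));
  rewrite // vdistC ltW.
Qed.

(** At test vectors from F(S) the form is [iota v], and t = |v| is a witness for [cpos]: in every
    representation 0 <= pi v <= t as forms, hence 0 <= t - pi v <= t, and [vnorm_le_of_form] gives
    |t - pi v| <= t. *)
Lemma ucstar_gen_psd n (X : 'M[S]_n) : mpos n X -> psd (fun i j => gen (X i j)).
Proof.
move=> Xp; have /hermitian_mxP XS := @mpos_star _ S n X Xp.
apply: psd_dense => [i j|u]; first by rewrite -ucstar_gen_star XS.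
pose v := \sum_i \sum_j tmul (tmul (star (u i)) (tens (X i j, [::]))) (u j).
have vE : qform (fun i j => gen (X i j)) (fun i => iota (u i)) (fun i
  => iota (u i)) = iota v.
  rewrite /qform /v (lin_sum (ucstar_linear hU)); apply: eq_bigr => i _.
  rewrite (lin_sum (ucstar_linear hU)); apply: eq_bigr => j _.
  by rewrite !(ucstarM hU) (ucstar_star hU).
split.
  rewrite /qform star_sum; under eq_bigr do rewrite star_sum.
  rewrite exchange_big; apply: eq_bigr => j _ /=.
  by apply: eq_bigr => i _; rewrite !starM starK -ucstar_gen_star XS mulrA.
rewrite vE; set t := tens_norm v.
have t0 : 0 <= t by rewrite /t -(ucstar_norm hU) vnorm_ge0.
exists t => //.
(* Writing 1 as the generator of [ounit] brings t - v back to F(S), where the norm is tested in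
   representations. *)
rewrite -ucstar_gen_unit -(linZ (ucstar_linear hU)) -(linB (ucstar_linear hU)).
apply: ucstar_bound => // H phi phiP.
pose w := t%:C *: tens (ounit : S, [::]) - v.
have pl x : linear (fun u => pi_ phi u x) by move=> c ? ?; exact: pi_linear.
have wE x : pi_ phi w x = t%:C *: x - pi_ phi v x.
  by rewrite (linB (pl x)) (linZ (pl x)) (pi_tens phiP) /= (ucpBH_unit phiP.1).
have vdot x y : dot (pi_ phi v x) y
    = \sum_i \sum_j dot (phi (X i j) (pi_ phi (u j) x)) (pi_ phi (u i) y).
  rewrite (lin_sum (pl x)) dot_suml; apply: eq_bigr => i _.
  rewrite (lin_sum (pl x)) dot_suml; apply: eq_bigr => j _.
  by rewrite !(pi_tmul phiP) (pi_star phiP) (pi_tens phiP).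
have v0 x : 0 <= dot (pi_ phi v x) x.
  by rewrite vdot; apply: (ucpBH_pos phiP.1 Xp).
have vt x : dot (pi_ phi v x) x <= (t * vnorm x ^+ 2)%:C.
  rewrite -[leLHS]ger0_norm // -modcE lecR; apply: le_trans (modc_dot _ _) _.
  by rewrite expr2 mulrA ler_wpM2r ?vnorm_ge0 // pi_le_tens_norm.
have vS x y : dot (pi_ phi v y) x = Num.conj (dot (pi_ phi v x) y).
  rewrite !vdot rmorph_sum exchange_big; apply: eq_bigr => j _ /=.
  rewrite rmorph_sum; apply: eq_bigr => i _.
  by rewrite -XS (ucp_BH_star _ _ _ phiP.1) [LHS]dot_conj.
apply: vnorm_le_of_form.
- exact: pi_bounded.
- move=> x y; rewrite !wE -[RHS]dot_conj dotDl dotDr dotZl dotZr.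
  rewrite -[Num.conj _]/(_^*)%C conjc_real dotNl vS; congr (_ + _).
  by rewrite [RHS]dot_conj dotNl rmorphN.
- move=> x; rewrite wE dotDl dotNl dotZl dot_vnorm subr_ge0 -rmorphM.
  exact: vt.
- move=> x; rewrite wE dotDl dotNl dotZl dot_vnorm -rmorphM.
  by rewrite gerBl.
Qed.

Lemma ucstar_gen_ucp : ucp (ucstar_gen : S -> opsys ucstar_incl_hom).
Proof.
split; [exact: ucstar_gen_linear|exact: ucstar_gen_unit|].
by move=> n X /ucstar_gen_psd; apply: psd_ext => i j; rewrite mxE.
Qed.

Lemma ucstar_gen_bimodule : bimodule_map (ucstar_gen : S -> opsys
  ucstar_incl_hom).
Proof. by move=> a s b; rewrite ucstar_gen_ract ucstar_gen_lact. Qed.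

End UniversalCStar.

(** * Extension of ucp bimodule maps to the universal C*-algebra *)

Section Lift.
Context (R : realType) (A : cstarType R) (S : opASystemType A).
Context (B : cstarType R) (k : A -> B) (kh : star_hom k).
Context (m : S -> opsys kh) (m_ucp : ucp m) (m_bimod : bimodule_map m).
Implicit Types (u v : tensAlg S) (s t : S) (a b : A).

Let mB (s : S) : B := m s.

Let mB_linear : linear mB. Proof. exact: (ucp_linear m_ucp). Qed.

Let mB_unit : mB ounit = 1. Proof. exact: (ucp_unit m_ucp). Qed.

Lemma bimodule_lact a s : mB (lact a s) = k a * mB s.
Proof.
have := m_bimod a s 1; rewrite ract1 /mB => ->.
by rewrite -[LHS]/(k a * mB s * k 1) (shom1 kh) mulr1.
Qed.

Lemma bimodule_ract s a : mB (ract s a) = mB s * k a.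
Proof.
have := m_bimod 1 s a; rewrite lact1 /mB => ->.
by rewrite -[LHS]/(k 1 * mB s * k a) (shom1 kh) mul1r.
Qed.

Lemma bimodule_psd n (X : 'M[S]_n) : mpos n X -> psd (fun i j => mB (X i j)).
Proof. by move=> /(ucp_pos m_ucp); apply: psd_ext => i j; rewrite mxE. Qed.

(** Composites of [m] with representations of [B] are thus among the maps whose supremum is the norm
    of F(S). *)
Lemma rep_bimodule_ucp (H : hilbertType R) (pi : B -> H -> H) :
  unital_rep pi -> A_ucp_BH (fun s => pi (mB s)).
Proof.
move=> pr; split.
  split=> [s|c s t x|x|n X Xp x].
  - exact: (rep_bop pr).
  - by rewrite mB_linear (rep_linear pr).
  - by rewrite mB_unit (rep1 pr).
  - exact: (rep_psd _ pr (bimodule_psd Xp)).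
exists (fun a => pi (k a)).
  split=> [a|c a b x|x|a b x|a x y].
  - exact: (rep_bop pr).
  - by rewrite (shom_linear kh) (rep_linear pr).
  - by rewrite (shom1 kh) (rep1 pr).
  - by rewrite (shomM kh) (repM pr).
  - by rewrite (shom_star kh) (rep_star pr).
by move=> a s x; rewrite bimodule_lact (repM pr).
Qed.

Definition tlift_words (u : seq (word S)) : B :=
  \sum_(w <- u) \prod_(s <- wseq w) mB s.

Lemma tlift_words_cat (u v : seq (word S)) :
  tlift_words (u ++ v) = tlift_words u + tlift_words v.
Proof. by rewrite /tlift_words big_cat. Qed.

Lemma tlift_words1 (w : word S) : tlift_words [:: w] = \prod_(s <- wseq w) mB s.
Proof. exact: big_seq1. Qed.

Lemma tlift_words_tens (u v : seq (word S)) :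
  tens_eq u v -> tlift_words u = tlift_words v.
Proof.
elim=> {u v} //.
- by move=> u v w _ -> _ ->.
- by move=> u u' v v' _ E _ E'; rewrite !tlift_words_cat E E'.
- by move=> u v; rewrite !tlift_words_cat addrC.
- move=> l s t r; rewrite -[RHS]/(tlift_words ([:: _] ++ [:: _]))
  tlift_words_cat.
  rewrite !tlift_words1 !wseq_slot !big_cat !big_cons /=.
  by rewrite (linD mB_linear) mulrDl mulrDr.
- move=> l r; rewrite tlift_words1 wseq_slot big_cat big_cons /=.
  by rewrite (lin0 mB_linear) mul0r mulr0 /tlift_words big_nil.
- move=> l s a t r; rewrite !tlift_words1 !wseq_slot !big_cat !big_cons /=.
  by rewrite bimodule_ract bimodule_lact !mulrA.
Qed.

Definition tlift u : B := tlift_words (repr u).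

Lemma tlift_tpi (u : seq (word S)) : tlift (tpi u) = tlift_words u.
Proof. exact/tlift_words_tens/repr_tpi. Qed.

Lemma tlift_linear : linear tlift.
Proof.
move=> c u v; rewrite -(tpiK u) -(tpiK v).
rewrite -[_ *: _]/(tscale _ _) tscale_tpi -[_ + tpi _]/(tadd _ _) tadd_tpi.
rewrite !tlift_tpi /tlift_words big_cat /= big_map scaler_sumr; congr (_ + _).
apply: eq_bigr => w _.
by rewrite /wseq /= !big_cons (linZ mB_linear) scalerAl.
Qed.

Lemma tlift_mul u v : tlift (tmul u v) = tlift u * tlift v.
Proof.
rewrite -(tpiK u) -(tpiK v) tmul_tpi !tlift_tpi /tlift_words /fmul.
rewrite big_allpairs_dep mulr_suml; apply: eq_bigr => w _.
rewrite mulr_sumr; apply: eq_bigr => w' _.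
by rewrite wseq_mul big_cat.
Qed.

(** Positivity implies this: an off-diagonal entry of the image of [pair_mx], which is hermitian. *)
Lemma bimodule_star s : mB (star s) = star (mB s).
Proof.
have [r _ /bimodule_psd[/(_ ord0 (lift ord0 ord0)) + _]] := mpos_pair_mx s.
by rewrite !mxE /= !(linN mB_linear) starN => /oppr_inj.
Qed.

Lemma tlift_star u : tlift (star u) = star (tlift u).
Proof.
rewrite -(tpiK u) -[star (tpi _)]/(tstar _) tstar_tpi !tlift_tpi /tlift_words
  /fstar.
rewrite big_map star_sum; apply: eq_bigr => w _.
rewrite wseq_star; elim: (wseq w) => [|s l IH] /=;
  first by rewrite !big_nil star1.
by rewrite rev_cons -cats1 big_cat /= IH !big_cons big_nil mulr1 starM
  bimodule_star.
Qed.

Lemma tlift_rep (H : hilbertType R) (pi : B -> H -> H) u x : unital_rep pi ->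
  pi_ (fun s => pi (mB s)) u x = pi (tlift u) x.
Proof.
move=> pr; rewrite -(tpiK u) (pi_tpi (rep_bimodule_ucp pr)) tlift_tpi.
have pil y : linear (fun z => pi z y) by move=> c ? ?; exact: (rep_linear pr).
rewrite /pi_words /tlift_words (lin_sum (pil x)); apply: eq_bigr => w _.
elim: (wseq w) => [|s l IH] /=; first by rewrite big_nil (rep1 pr).
by rewrite big_cons (repM pr) IH.
Qed.

(** The norm of [tlift u] is attained in a representation [pi] of [B], and [pi] after [m] enters the
    supremum that is the norm of [iota u]. So [tlift] is contractive for the norm of [U] and extends
    by density. *)
Lemma ucstar_universal (U : cstarType R) (iota : tensAlg S -> U) :
  is_universal_cstar iota ->
  exists g : U -> B, star_hom g /\ forall s, g (ucstar_gen iota s) = m s.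
Proof.
move=> hU.
have tlift_norm u : vnorm (tlift u) <= 1 * vnorm (iota u).
  have [H [pi [x [pr x1 <-]]]] := norm_attaining_rep (tlift u).
  rewrite -(tlift_rep _ _ pr) mul1r (ucstar_norm hU).
  apply: le_trans (pi_le_tens_norm _ _ (rep_bimodule_ucp pr)) _.
  by rewrite -[leRHS]mulr1 ler_wpM2l // -(ucstar_norm hU) vnorm_ge0.
have [g [gl ge gn]] := bounded_extension (ucstar_linear hU) tlift_linear
  (ucstar_dense hU) ler01 tlift_norm.
have gb : bounded g by split=> //; exists 1.
have gs s : g (ucstar_gen iota s) = m s.
  by rewrite ge tlift_tpi tlift_words1; exact: big_seq1.
exists g; split=> //; split=> //.
- by rewrite -(ucstar_gen_unit hU) gs; exact: mB_unit.
(* Density is applied to one factor at a time, both sides being linear and bounded in it. *)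
- move=> x y; move: x; apply: (bounded_dense_eq (ucstar_dense hU)
    (bounded_comp gb (cstar_bounded_mulr y))
    (bounded_comp (cstar_bounded_mulr (g y)) gb)) => u /=.
  move: y; apply: (bounded_dense_eq (ucstar_dense hU)
    (bounded_comp gb (cstar_bounded_mull (iota u)))
    (bounded_comp (cstar_bounded_mull (g (iota u))) gb)) => v /=.
  by rewrite -(ucstarM hU) !ge tlift_mul.
(* [star] is conjugate-linear; conjugating [g] by it gives a linear map that can be compared with
   [g] on the dense image. *)
- have gsb : bounded (fun x => star (g (star x))).
    split=> [c x y|]; last by exists 1 => x; rewrite vnorm_star -[vnorm
      x]vnorm_star.
    by rewrite starD starZ gl starD starZ conjCK.
  move=> x; rewrite (bounded_dense_eq (ucstar_dense hU) gb gsb) /= ?starK //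
    => u.
  by rewrite -(ucstar_star hU) !ge tlift_star starK.
Qed.

End Lift.

(** * The two inverse homomorphisms *)

Lemma shom_ucp (R : realType) (A : cstarType R) (S : opSystemType R)
    (B C : cstarType R) (k : A -> B) (kh : star_hom k) (l : A -> C)
    (lh : star_hom l) (m : S -> opsys kh) (f : B -> C) :
  star_hom f -> ucp m -> ucp (f \o m : S -> opsys lh).
Proof.
move=> fh mu; split=> [c s t||n X Xp] /=.
- by rewrite (ucp_linear mu) (shom_linear fh).
- by rewrite (ucp_unit mu) -[LHS]/(f 1) (shom1 fh).
- have := shom_psd fh (ucp_pos mu Xp).
  by apply: psd_ext => i j; rewrite !mxE.
Qed.

Lemma shom_bimodule (R : realType) (A : cstarType R) (S : opASystemType A)
    (B C : cstarType R) (k : A -> B) (kh : star_hom k) (l : A -> C)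
    (lh : star_hom l) (m : S -> opsys kh) (f : B -> C) :
  star_hom f -> (forall a, f (k a) = l a) -> bimodule_map m ->
  bimodule_map (f \o m : S -> opsys lh).
Proof.
move=> fh fk mb a s b /=; rewrite mb -[LHS]/(f (k a * m s * k b)).
by rewrite !(shomM fh) !fk.
Qed.

Lemma ucp_comp (R : realType) (S T W : opSystemType R) (f : T -> W) (g : S ->
  T) :
  ucp f -> ucp g -> ucp (f \o g).
Proof.
move=> fu gu; split=> [c s t||n X Xp] /=.
- by rewrite (ucp_linear gu) (ucp_linear fu).
- by rewrite (ucp_unit gu) (ucp_unit fu).
- by rewrite map_mx_comp; exact/(ucp_pos fu)/(ucp_pos gu).
Qed.

Lemma bimodule_comp (R : realType) (A : cstarType R) (S T W : opASystemType A)
    (f : T -> W) (g : S -> T) :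
  bimodule_map f -> bimodule_map g -> bimodule_map (f \o g).
Proof. by move=> fb gb a s b /=; rewrite gb fb. Qed.

(** This makes the homomorphisms from [U1] and [U2] to [U] agree on the copies of [A]. *)
Lemma ucp_incl (R : realType) (A : cstarType R) (S T : opASystemType A)
    (phi : S -> T) a : ucp phi -> bimodule_map phi ->
  phi (lact a ounit) = lact a ounit.
Proof.
by move=> pu pb; have := pb a ounit 1; rewrite !ract1 (ucp_unit pu).
Qed.

Theorem proposition4p2 (R : realType) (A : cstarType R)
  (S1 S2 : opASystemType A) (hS1 : faithful S1) (hS2 : faithful S2)
  (S : opASystemType A) (phi1 : S1 -> S) (phi2 : S2 -> S)
  (hS : is_coproduct phi1 phi2)
  (U U1 U2 : cstarType R)
  (i : tensAlg S -> U) (i1 : tensAlg S1 -> U1) (i2 : tensAlg S2 -> U2)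
  (hU : is_universal_cstar i) (hU1 : is_universal_cstar i1)
  (hU2 : is_universal_cstar i2)
  (P : cstarType R) (j1 : U1 -> P) (j2 : U2 -> P)
  (hP : is_amalgamated_product (ucstar_incl i1) (ucstar_incl i2) j1 j2) :
  cstar_isomorphic U P.
Proof.
have [_ e1 e2 b1 b2 univ] := hS; have u1 := oemb_ucp e1; have u2 := oemb_ucp e2.
have [j1h j2h jk univP] := hP.
pose kU := ucstar_incl_hom hU.
have genU := ucstar_gen_ucp hU; have genUb := ucstar_gen_bimodule hU.
have m1u := ucp_comp genU u1; have m1b := bimodule_comp genUb b1.
have m2u := ucp_comp genU u2; have m2b := bimodule_comp genUb b2.
have [g1 [g1h g1E]] := ucstar_universal m1u m1b hU1.
have [g2 [g2h g2E]] := ucstar_universal m2u m2b hU2.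
have g1k a : g1 (ucstar_incl i1 a) = ucstar_incl i a.
  by rewrite -[LHS]/(g1 (ucstar_gen i1 _)) g1E /= (ucp_incl a u1 b1).
have g2k a : g2 (ucstar_incl i2 a) = ucstar_incl i a.
  by rewrite -[LHS]/(g2 (ucstar_gen i2 _)) g2E /= (ucp_incl a u2 b2).
have [|f [[fh fj1 fj2] _]] := univP U g1 g2 g1h g2h.
  by apply: funext => a /=; rewrite g1k g2k.
(* [A] acts on [P] through [U1]; by [jk] the map from [S2] is a bimodule map for the same action. *)
have kP : star_hom (j1 \o ucstar_incl i1).
  exact: shom_comp j1h (ucstar_incl_hom hU1).
have p1u := shom_ucp kP j1h (ucstar_gen_ucp hU1).
have p1b := shom_bimodule kP j1h (fun=> erefl) (ucstar_gen_bimodule hU1).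
have p2u := shom_ucp kP j2h (ucstar_gen_ucp hU2).
have p2b : bimodule_map (j2 \o ucstar_gen i2 : S2 -> opsys kP).
  apply: shom_bimodule j2h _ (ucstar_gen_bimodule hU2) => a.
  by rewrite jk.
have [Psi [[Pu Pb P1 P2] _]] := univ _ _ _ p1u p1b p2u p2b.
have [h [hh hE]] := ucstar_universal Pu Pb hU.
have fPu := shom_ucp kU fh Pu.
have fPb : bimodule_map (f \o Psi : S -> opsys kU).
  apply: shom_bimodule fh _ Pb => a.
  by rewrite -[LHS]/((f \o j1) (ucstar_incl i1 a)) fj1 g1k.
(* Both sides are ucp bimodule maps with the same restrictions to [S1] and [S2], so uniqueness for
   the coproduct applies. *)
have fPsi : f \o Psi = ucstar_gen i.
  have [G [_ Guniq]] := univ _ _ _ m1u m1b m2u m2b.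
  transitivity G; first apply/esym/Guniq; last apply: Guniq.
    split=> //; apply: funext => s /=.
      by rewrite -[Psi _]/((Psi \o phi1) s) P1 /= -[LHS]/((f \o j1) _) fj1 g1E.
    by rewrite -[Psi _]/((Psi \o phi2) s) P2 /= -[LHS]/((f \o j2) _) fj2 g2E.
  by split.
exists h => //; exists f.
  apply: (ucstar_hom_eq hU (shom_comp fh hh)) => [|s]; first by split.
  by rewrite /= hE -[LHS]/((f \o Psi) s) fPsi.
(* Uniqueness for [P] with [j1] and [j2] themselves as targets: that [h \o f] leaves them unchanged
   is checked on the generators of [U1] and [U2]. *)
have [G [_ Guniq]] := univP P j1 j2 j1h j2h jk.
suff : h \o f = id by move=> E x; rewrite -[LHS]/((h \o f) x) E.
transitivity G; first apply/esym/Guniq; last apply: Guniq.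
  split; first exact: shom_comp.
    apply: funext; apply: (ucstar_hom_eq hU1) => // [|s].
      by apply: shom_comp => //; apply: shom_comp.
    rewrite /= -[f _]/((f \o j1) _) fj1 g1E /= hE.
    by rewrite -[LHS]/((Psi \o phi1) s) P1.
  apply: funext; apply: (ucstar_hom_eq hU2) => // [|s].
    by apply: shom_comp => //; apply: shom_comp.
  rewrite /= -[f _]/((f \o j2) _) fj2 g2E /= hE.
  by rewrite -[LHS]/((Psi \o phi2) s) P2.
by split.
Qed.
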